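(* Let $G$ be a locally indicable group, let $C_{\ast}$ be a chain complex of right $\mathbb{Z}G$-modules, and let $\sigma\colon G\rightarrow \mathrm{GL}_n(\mathbb{C})$ be a linear representation of $G$. Then for all $i$ we have \[b^{(2),\sigma}_i(C_{\ast})=n\cdot b^{(2)}_i(C_{\ast}).\]
   Context: A group is locally indicable if every non-trivial finitely generated subgroup admits an epimorphism onto $\mathbb{Z}$. For $G$ locally indicable, the Linnell skew field $\mathcal{D}_G$ is the division closure of $\mathbb{C}G$ in the algebra $\mathcal{U}_G$ of operators affiliated to the group von Neumann algebra of $G$, i.e. the smallest subring containing $\mathbb{C}G$ and closed under taking inverses of elements that are invertible in $\mathcal{U}_G$; it is a skew field. Let $\tau\colon \mathbb{C}G\hookrightarrow\mathcal{D}_G$ be the inclusion. The column vectors $\mathcal{D}_G^n$ form a left $\mathbb{Z}G$-module via $g\cdot v=\sigma(g)\tau(g)v$ and a right $\mathcal{D}_G$-module in the obvious way. The twisted $\ell^2$-Betti numbers are \[b_i^{(2),\sigma}(C_* )=\dim_{\mathcal{D}_G}H_i(C_*\otimes_{\mathbb{Z}G}\mathcal{D}_G^n)\in\mathbb{N}\cup\{\infty\},\] and the untwisted ones are $b_i^{(2)}(C_* )=\dim_{\mathcal{D}_G}H_i(C_*\otimes_{\mathbb{Z}G}\mathcal{D}_G)$, where $G$ acts on $\mathcal{D}_G$ by left multiplication via $\tau$. Convention: $n\cdot\infty=\infty$ for $n>0$. *)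

(* Defs.v *)
From HB Require Import structures.
From mathcomp Require Import all_boot all_order all_algebra.
From mathcomp Require Import complex finmap.
From mathcomp.multinomials Require Import monalg.
From mathcomp Require Import all_classical all_reals all_analysis.
From mathcomp Require Import ring.

Set Implicit Arguments.
Unset Strict Implicit.
Unset Printing Implicit Defensive.

Import Order.TTheory GRing.Theory Num.Theory.

Local Open Scope classical_set_scope.
Local Open Scope ring_scope.

Definition subgroup (G : groupType) (H : set G) : Prop :=
  H 1%g /\ forall x y, H x -> H y -> H (x * y^-1)%g.

Definition generated (G : groupType) (s : seq G) : set G :=
  smallest (@subgroup G) [set` s].

(* Only the values of [phi] on [generated s] matter, so a homomorphism defined
   on this subgroup is represented by an arbitrary extension to [G]. *)
Definition locally_indicable (G : groupType) : Prop :=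
  forall s : seq G, (exists2 x, generated s x & x <> 1%g) ->
  exists phi : G -> int,
    (forall x y, generated s x -> generated s y ->
       phi (x * y)%g = phi x + phi y) /\
    (forall m : int, exists2 x, generated s x & phi x = m).

(* Additively this is [{malg K[G]}]; the ring structure of [monalg] is not
   available because its monoids have no non-trivial units. *)
Definition groupRing (K : nzRingType) (G : groupType) : Type := {malg K[G]}.

Section GroupRing.
Variables (K : nzRingType) (G : groupType).
Local Notation KG := {malg K[G]}.
Local Open Scope fset_scope.

HB.instance Definition _ := GRing.Lmodule.on (groupRing K G).

Definition gr_one : KG := << 1%g >>.

Definition gr_mul (a b : KG) : KG :=
  \sum_(g <- msupp a) \sum_(h <- msupp b) << a@_g * b@_h *g (g * h)%g >>.

Lemma gr_mulw (d1 d2 : {fset G}) a b : msupp a `<=` d1 -> msupp b `<=` d2 ->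
  gr_mul a b = \sum_(g <- d1) \sum_(h <- d2) << a@_g * b@_h *g (g * h)%g >>.
Proof.
move=> le1 le2; rewrite /gr_mul (big_fset_incl _ le1) /=.
  apply/eq_bigr=> g _; apply/big_fset_incl => // h _ /mcoeff_outdom ->.
  by rewrite mulr0 monalgU0.
by move=> g _ /mcoeff_outdom ag; rewrite big1 // => h _; rewrite ag mul0r monalgU0.
Qed.

Lemma gr_mulUU x y g h :
  gr_mul << x *g g >> << y *g h >> = << x * y *g (g * h)%g >>.
Proof. by rewrite (gr_mulw msuppU_le msuppU_le) !big_seq_fset1 !mcoeffUU. Qed.

Lemma gr_mulDl : left_distributive gr_mul +%R.
Proof.
move=> a b c.
rewrite (gr_mulw (msuppD_le a b) (fsubset_refl _)).
rewrite (gr_mulw (fsubsetUl (msupp a) (msupp b)) (fsubset_refl _)).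
rewrite (gr_mulw (fsubsetUr (msupp a) (msupp b)) (fsubset_refl _)).
rewrite -big_split /=; apply/eq_bigr => g _.
by rewrite -big_split /=; apply/eq_bigr => h _; rewrite mcoeffD mulrDl monalgUD.
Qed.

Lemma gr_mulDr : right_distributive gr_mul +%R.
Proof.
move=> c a b.
rewrite (gr_mulw (fsubset_refl _) (msuppD_le a b)).
rewrite (gr_mulw (fsubset_refl _) (fsubsetUl (msupp a) (msupp b))).
rewrite (gr_mulw (fsubset_refl _) (fsubsetUr (msupp a) (msupp b))).
rewrite -big_split /=; apply/eq_bigr => g _.
by rewrite -big_split /=; apply/eq_bigr => h _; rewrite mcoeffD mulrDr monalgUD.
Qed.

Lemma gr_mul0 : left_zero 0 gr_mul.
Proof. by move=> a; rewrite /gr_mul msupp0 big_seq_fset0. Qed.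

Lemma gr_mulr0 : right_zero 0 gr_mul.
Proof. by move=> a; rewrite /gr_mul big1 // => g _; rewrite msupp0 big_seq_fset0. Qed.

Lemma gr_mul_suml (I : Type) (s : seq I) (F : I -> KG) b :
  gr_mul (\sum_(i <- s) F i) b = \sum_(i <- s) gr_mul (F i) b.
Proof. exact: (big_morph (gr_mul^~ b) (fun _ _ => gr_mulDl _ _ _) (gr_mul0 _)). Qed.

Lemma gr_mul_sumr (I : Type) (s : seq I) (F : I -> KG) a :
  gr_mul a (\sum_(i <- s) F i) = \sum_(i <- s) gr_mul a (F i).
Proof. exact: (big_morph (gr_mul a) (fun _ _ => gr_mulDr _ _ _) (gr_mulr0 _)). Qed.

Lemma gr_mulA : associative gr_mul.
Proof.
move=> a b c; rewrite (monalgE a) !gr_mul_suml; apply/eq_bigr=> i _.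
rewrite (monalgE b) gr_mul_suml !gr_mul_sumr gr_mul_suml; apply/eq_bigr=> j _.
rewrite (monalgE c) !gr_mul_sumr; apply/eq_bigr=> k _.
by rewrite !gr_mulUU mulrA mulgA.
Qed.

Lemma gr_mul1 : left_id gr_one gr_mul.
Proof.
move=> a; rewrite [in LHS](monalgE a) gr_mul_sumr [RHS]monalgE.
by apply/eq_bigr=> g _; rewrite gr_mulUU mul1r mul1g.
Qed.

Lemma gr_mulr1 : right_id gr_one gr_mul.
Proof.
move=> a; rewrite [in LHS](monalgE a) gr_mul_suml [RHS]monalgE.
by apply/eq_bigr=> g _; rewrite gr_mulUU mulr1 mulg1.
Qed.

Lemma gr_one_neq0 : gr_one != 0.
Proof. by rewrite monalgU_eq0 oner_eq0. Qed.

HB.instance Definition _ := GRing.Zmodule_isNzRing.Build (groupRing K G)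
  gr_mulA gr_mul1 gr_mulr1 gr_mulDl gr_mulDr gr_one_neq0.

Definition gr_elt (g : G) : groupRing K G := (<< g >> : KG).
Definition gr_const (x : K) : groupRing K G := (<< x *g 1%g >> : KG).

End GroupRing.

Section FreeLift.
Variables (K : choiceType) (V : zmodType) (h : K -> V).

Definition free_lift (x : {malg int[K]}) : V :=
  \sum_(k <- msupp x) h k *~ x@_k.

Lemma free_liftw (d : {fset K}) (x : {malg int[K]}) : (msupp x `<=` d)%fset ->
  free_lift x = \sum_(k <- d) h k *~ x@_k.
Proof.
move=> le; rewrite /free_lift (big_fset_incl _ le) // => k _ /mcoeff_outdom ->.
by rewrite mulr0z.
Qed.

Lemma free_lift_is_zmod_morphism : zmod_morphism free_lift.
Proof.
move=> x y; pose d := (msupp x `|` msupp y)%fset.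
rewrite (@free_liftw d x) ?fsubsetUl // (@free_liftw d y) ?fsubsetUr //.
rewrite (@free_liftw d) ?msuppB_le // -sumrB; apply/eq_bigr => k _.
by rewrite mcoeffB mulrzBr.
Qed.

HB.instance Definition _ := GRing.isZmodMorphism.Build {malg int[K]} V free_lift
  free_lift_is_zmod_morphism.

Lemma free_liftU (k : K) (n : int) : free_lift << n *g k >> = h k *~ n.
Proof. by rewrite (free_liftw msuppU_le) big_seq_fset1 mcoeffUU. Qed.

End FreeLift.

Lemma free_ext (K : choiceType) (V : zmodType)
    (f g : {additive {malg int[K]} -> V}) :
  (forall k, f << k >> = g << k >>) -> f =1 g.
Proof.
move=> fg x; rewrite (monalgE x) !raddf_sum; apply/eq_bigr=> k _.
have -> : << x@_k *g k >> = << k >> *~ x@_k :> {malg int[K]}.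
  by rewrite -raddfMz /= intz.
by rewrite !raddfMz fg.
Qed.

Section QuotientModule.
Variables (A : nzRingType) (V : lmodType A) (S : submodClosed V).

(* [submodClosed] does not inherit from [zmodClosed] in the library. *)
Definition quot_ker : {pred V} := fun x => x \in S.

Lemma quot_ker_zmod_closed : zmod_closed quot_ker.
Proof.
by split=> [|x y xS yS]; rewrite /quot_ker unfold_in ?rpred0 // -scaleN1r rpredD // rpredZ.
Qed.
HB.instance Definition _ := GRing.isZmodClosed.Build V quot_ker
  quot_ker_zmod_closed.

Definition quot_mod : Type := Quotient.quot quot_ker.
HB.instance Definition _ := GRing.Zmodule.on quot_mod.

Definition quot_class (x : V) : quot_mod := \pi_(Quotient.quot quot_ker)%qT x.

Lemma quot_class_eq x y : quot_class x = quot_class y <-> x - y \in S.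
Proof.
by split=> [/eqP|h]; [|apply/eqP]; rewrite /quot_class -Quotient.idealrBE.
Qed.

Lemma quot_class_zmod_morphism : zmod_morphism quot_class.
Proof. by move=> x y; rewrite /quot_class !raddfB. Qed.
HB.instance Definition _ := GRing.isZmodMorphism.Build V quot_mod quot_class
  quot_class_zmod_morphism.

Lemma quot_classK (x : quot_mod) : quot_class (repr x) = x.
Proof. exact: reprK. Qed.

Definition quot_scale (a : A) (x : quot_mod) : quot_mod :=
  quot_class (a *: repr x).

Lemma quot_scaleE a x : quot_scale a (quot_class x) = quot_class (a *: x).
Proof.
apply/quot_class_eq; rewrite -scalerBr rpredZ //.
by apply/quot_class_eq; rewrite quot_classK.
Qed.

Lemma quot_scaleA a b x : quot_scale a (quot_scale b x) = quot_scale (a * b) x.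
Proof. by rewrite -(quot_classK x) !quot_scaleE scalerA. Qed.

Lemma quot_scale1 : left_id 1 quot_scale.
Proof. by move=> x; rewrite -(quot_classK x) quot_scaleE scale1r. Qed.

Lemma quot_scaleDr : right_distributive quot_scale +%R.
Proof.
move=> a x y; rewrite -(quot_classK x) -(quot_classK y).
by rewrite -raddfD !quot_scaleE scalerDr raddfD.
Qed.

Lemma quot_scaleDl x : {morph quot_scale^~ x : a b / a + b}.
Proof. by move=> a b; rewrite -(quot_classK x) !quot_scaleE scalerDl raddfD. Qed.

HB.instance Definition _ := GRing.Zmodule_isLmodule.Build A quot_mod
  quot_scaleA quot_scale1 quot_scaleDr quot_scaleDl.

End QuotientModule.

(* A right module over [A] is a left module over the converse ring: in it,
   [(a : A^c) *: m] is the right translate [m a]. *)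
Notation rmodType A := (lmodType A^c).

(* (A, D)-bimodules: the right [D]-module structure is the one of the carrier. *)
Record bimodule (A D : nzRingType) := Bimodule {
  bimod_sort :> rmodType D;
  lact : A -> bimod_sort -> bimod_sort;
  lact1 : forall v, lact 1 v = v;
  lactM : forall a b v, lact (a * b) v = lact a (lact b v);
  lactDl : forall a b v, lact (a + b) v = lact a v + lact b v;
  lactDr : forall a v w, lact a (v + w) = lact a v + lact a w;
  lactZ : forall a (d : D^c) v, lact a (d *: v) = d *: lact a v
}.

Section Tensor.
Variables (A D : nzRingType) (M : rmodType A) (N : bimodule A D).

Local Notation F := {malg int[(M * N)%type]}.
Local Notation gen m v := (<< (m, v) >> : F).

Inductive tens_rel : F -> Prop :=
| TensDl m m' v : tens_rel (gen (m + m') v - gen m v - gen m' v)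
| TensDr m v v' : tens_rel (gen m (v + v') - gen m v - gen m v')
| TensBal m (a : A) v : tens_rel (gen ((a : A^c) *: m) v - gen m (lact a v)).

Definition subzmod (V : zmodType) (S : set V) : Prop :=
  S 0 /\ forall x y, S x -> S y -> S (x - y).

Definition tens_ker : {pred F} :=
  fun x => `[< smallest (@subzmod F) tens_rel x >].

Lemma tens_ker_zmod_closed : zmod_closed tens_ker.
Proof.
split=> [|x y /asboolP hx /asboolP hy]; apply/asboolP => S hS.
  by case: hS => -[].
by case: (hS) => -[_ SB] _; apply: SB; [exact: hx | exact: hy].
Qed.
HB.instance Definition _ := GRing.isZmodClosed.Build F tens_ker
  tens_ker_zmod_closed.

Definition tensor : Type := Quotient.quot tens_ker.
HB.instance Definition _ := GRing.Zmodule.on tensor.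

Definition tens_class (x : F) : tensor := \pi_(Quotient.quot tens_ker)%qT x.

Lemma tens_class_zmod_morphism : zmod_morphism tens_class.
Proof. by move=> x y; rewrite /tens_class !raddfB. Qed.
HB.instance Definition _ := GRing.isZmodMorphism.Build F tensor tens_class
  tens_class_zmod_morphism.

Definition tens (m : M) (v : N) : tensor := tens_class (gen m v).

Lemma tens_class_eq x y : tens_class x = tens_class y <-> x - y \in tens_ker.
Proof.
by split=> [/eqP|h]; [|apply/eqP]; rewrite /tens_class -Quotient.idealrBE.
Qed.

Lemma tens_classK (t : tensor) : tens_class (repr t) = t.
Proof. exact: reprK. Qed.

Lemma tens_class_rel x : tens_rel x -> tens_class x = 0.
Proof.
move=> hx; rewrite -(raddf0 tens_class); apply/tens_class_eq.
by rewrite subr0; apply/asboolP => S [_]; apply.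
Qed.

Lemma tensDl m m' v : tens (m + m') v = tens m v + tens m' v.
Proof.
have /eqP := tens_class_rel (TensDl m m' v).
by rewrite !raddfB -addrA -opprD subr_eq0 => /eqP.
Qed.

Lemma tensDr m v v' : tens m (v + v') = tens m v + tens m v'.
Proof.
have /eqP := tens_class_rel (TensDr m v v').
by rewrite !raddfB -addrA -opprD subr_eq0 => /eqP.
Qed.

Lemma tens_bal m (a : A) v : tens ((a : A^c) *: m) v = tens m (lact a v).
Proof.
by have /eqP := tens_class_rel (TensBal m a v); rewrite raddfB subr_eq0 => /eqP.
Qed.

Lemma tens0l v : tens 0 v = 0.
Proof. by apply: (addrI (tens 0 v)); rewrite -tensDl !addr0. Qed.

Lemma tens_ext (V : zmodType) (f g : {additive tensor -> V}) :
  (forall m v, f (tens m v) = g (tens m v)) -> f =1 g.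
Proof.
move=> fg t; rewrite -(tens_classK t).
apply: (free_ext (f := f \o tens_class) (g := g \o tens_class)) => -[m v];
  exact: fg.
Qed.

Section Lift.
Variables (V : zmodType) (h : M -> N -> V).
Hypothesis hDl : forall m m' v, h (m + m') v = h m v + h m' v.
Hypothesis hDr : forall m v v', h m (v + v') = h m v + h m v'.
Hypothesis hbal : forall m (a : A) v, h ((a : A^c) *: m) v = h m (lact a v).

Definition tens_lift (t : tensor) : V :=
  free_lift (fun p => h p.1 p.2) (repr t).

Lemma tens_lift_class x :
  tens_lift (tens_class x) = free_lift (fun p => h p.1 p.2) x.
Proof.
apply/eqP; rewrite -subr_eq0 -raddfB; apply/eqP.
have /tens_class_eq/asboolP H := tens_classK (tens_class x).
apply: (H [set y | free_lift (fun p => h p.1 p.2) y = 0]); split.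
  split=> [|y z]; first exact: raddf0.
  by rewrite /mkset raddfB /= => -> ->; rewrite subrr.
move=> _ []; intros; rewrite /= !raddfB /= !free_liftU /= !mulr1z ?hDl ?hDr ?hbal ?subrr //.
  by rewrite addrAC addrK subrr.
by rewrite addrAC addrK subrr.
Qed.

Lemma tens_liftE m v : tens_lift (tens m v) = h m v.
Proof. by rewrite tens_lift_class free_liftU. Qed.

Lemma tens_lift_zmod_morphism : zmod_morphism tens_lift.
Proof.
move=> s t; rewrite -(tens_classK s) -(tens_classK t) -raddfB.
by rewrite !tens_lift_class raddfB.
Qed.
End Lift.

Definition tens_scale (d : D^c) : tensor -> tensor :=
  tens_lift (fun m v => tens m (d *: v)).

Lemma tens_scaleE d m v : tens_scale d (tens m v) = tens m (d *: v).
Proof.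
by apply: tens_liftE => *; rewrite ?tensDl ?scalerDr ?tensDr ?tens_bal ?lactZ.
Qed.

Lemma tens_scale_zmod_morphism d : zmod_morphism (tens_scale d).
Proof.
by apply: tens_lift_zmod_morphism => *;
  rewrite ?tensDl ?scalerDr ?tensDr ?tens_bal ?lactZ.
Qed.
HB.instance Definition _ d := GRing.isZmodMorphism.Build tensor tensor
  (tens_scale d) (tens_scale_zmod_morphism d).

Lemma tens_scaleA (a b : D^c) t :
  tens_scale a (tens_scale b t) = tens_scale (a * b) t.
Proof.
move: t; apply: (tens_ext (f := tens_scale a \o tens_scale b)
  (g := tens_scale (a * b))) => m v.
by rewrite /= !tens_scaleE scalerA.
Qed.

Lemma tens_scale1 : left_id 1 tens_scale.
Proof.
apply: (tens_ext (f := tens_scale 1) (g := idfun)) => m v.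
by rewrite /= tens_scaleE scale1r.
Qed.

Lemma tens_scaleDr : right_distributive tens_scale +%R.
Proof. by move=> d s t; rewrite raddfD. Qed.

Lemma tens_scaleDl t : {morph tens_scale^~ t : a b / a + b}.
Proof.
move=> a b; move: t; apply: (tens_ext (f := tens_scale (a + b))
  (g := tens_scale a \+ tens_scale b)) => m v.
by rewrite /= !tens_scaleE scalerDl tensDr.
Qed.

HB.instance Definition _ := GRing.Zmodule_isLmodule.Build D^c tensor
  tens_scaleA tens_scale1 tens_scaleDr tens_scaleDl.

Lemma tensZ (d : D^c) m v : d *: tens m v = tens m (d *: v).
Proof. exact: tens_scaleE. Qed.

End Tensor.

Section TensorMap.
Variables (A D : nzRingType) (M M' : rmodType A) (N : bimodule A D).
Variable f : {linear M -> M'}.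

Definition tens_map : tensor M N -> tensor M' N :=
  tens_lift (fun m v => tens (f m) v).

Lemma tens_mapE m v : tens_map (tens m v) = tens (f m) v.
Proof.
by apply: tens_liftE => *; rewrite ?linearD ?tensDl ?tensDr ?linearZ ?tens_bal.
Qed.

Lemma tens_map_zmod_morphism : zmod_morphism tens_map.
Proof.
by apply: tens_lift_zmod_morphism => *;
  rewrite ?linearD ?tensDl ?tensDr ?linearZ ?tens_bal.
Qed.
HB.instance Definition _ := GRing.isZmodMorphism.Build (tensor M N) (tensor M' N)
  tens_map tens_map_zmod_morphism.

Lemma tens_map_scalable : scalable tens_map.
Proof.
move=> d; apply: (tens_ext (f := tens_map \o *:%R d)
  (g := *:%R d \o tens_map)) => m v.
by rewrite /= tensZ !tens_mapE tensZ.
Qed.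
HB.instance Definition _ := GRing.isScalable.Build D^c (tensor M N) (tensor M' N)
  *:%R tens_map tens_map_scalable.

End TensorMap.

Arguments tens_map {A D M M'} N f.

(* The differential in degree [i] is [cdiff i (i - 1)]; as in any graded
   object whose components are dependent types, indexing [cdiff] by both
   degrees avoids transports along [i + 1 - 1 = i]. *)
Record chainComplex (A : nzRingType) := ChainComplex {
  cmod :> int -> lmodType A;
  cdiff : forall i j, {linear cmod i -> cmod j};
  cdiff_shape : forall i j, i <> j + 1 -> forall x, cdiff i j x = 0;
  cdiffK : forall i j k x, cdiff j k (cdiff i j x) = 0
}.

Section TensorComplex.
Variables (A D : nzRingType) (C : chainComplex A^c) (N : bimodule A D).

Let td i j : {linear tensor (C i) N -> tensor (C j) N} := tens_map N (cdiff C i j).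

Lemma tens_cdiff_shape i j : i <> j + 1 -> forall t, td i j t = 0.
Proof.
move=> ij; apply: (tens_ext (f := td i j) (g := \0)) => m v /=.
by rewrite tens_mapE cdiff_shape // tens0l.
Qed.

Lemma tens_cdiffK i j k t : td j k (td i j t) = 0.
Proof.
move: t; apply: (tens_ext (f := td j k \o td i j) (g := \0)) => m v /=.
by rewrite !tens_mapE cdiffK tens0l.
Qed.

Definition tensor_complex : chainComplex D^c :=
  @ChainComplex D^c (fun i => tensor (C i) N) td
    tens_cdiff_shape tens_cdiffK.

End TensorComplex.

Section Homology.
Variables (A : nzRingType) (C : chainComplex A) (i : int).

Definition cycle_pred : {pred C i} := fun x => cdiff C i (i - 1) x == 0.

Lemma cycle_pred_submod_closed : submod_closed cycle_pred.
Proof.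
split=> [|a x y]; rewrite !unfold_in; first by rewrite linear0.
by rewrite linearP => /eqP -> /eqP ->; rewrite scaler0 addr0.
Qed.
HB.instance Definition _ := GRing.isSubmodClosed.Build A (C i) cycle_pred
  cycle_pred_submod_closed.

Record cycles := Cycle { cycle_val : C i; _ : cycle_val \in cycle_pred }.
HB.instance Definition _ := [isSub for cycle_val].
HB.instance Definition _ := [Choice of cycles by <:].
HB.instance Definition _ := [SubChoice_isSubLmodule of cycles by <:].

Definition boundaries : {pred cycles} :=
  fun z => `[< exists y, cdiff C (i + 1) i y = val z >].

Lemma boundaries_submod_closed : submod_closed boundaries.
Proof.
split=> [|a x y /asboolP[u hu] /asboolP[v hv]]; apply/asboolP.
  by exists 0; rewrite !linear0.
by exists (a *: u + v); rewrite !linearP hu hv.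
Qed.
HB.instance Definition _ := GRing.isSubmodClosed.Build A cycles boundaries
  boundaries_submod_closed.

Definition homology : lmodType A := quot_mod boundaries.

End Homology.

Section Dimension.
Variables (R : realType) (A : nzRingType) (V : lmodType A).

Definition is_basis (k : nat) (b : 'I_k -> V) : Prop :=
  (forall x, exists a : 'I_k -> A, x = \sum_(i < k) a i *: b i) /\
  (forall a : 'I_k -> A, \sum_(i < k) a i *: b i = 0 -> forall i, a i = 0).

(* The cardinality of a finite basis, and [+oo] if there is none (the infimum
   of the empty set). Over a skew field all bases have the same cardinality. *)
Definition skew_dim : \bar R :=
  ereal_inf [set (k%:R)%:E | k in [set k | exists b : 'I_k -> V, is_basis b]].

End Dimension.

Definition skew_field (A : nzRingType) : Prop :=
  forall x : A, x != 0 -> exists y, x * y = 1 /\ y * x = 1.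

Section SquareSummable.
Variables (R : realType) (G : groupType).
Implicit Types (f h : G -> R[i]).

Definition sqsum f : \bar R :=
  \esum_(g in [set: G]) ((Normc.normc (f g)) ^+ 2)%:E.

Definition square_summable : {pred (G -> R[i])} :=
  fun f => (sqsum f < +oo)%E.

Lemma square_summable_submod_closed : submod_closed square_summable.
Proof.
have scl (n : nat) f : f \in square_summable ->
    (\esum_(g in [set: G]) (n%:R * Normc.normc (f g) ^+ 2)%:E < +oo)%E.
  rewrite unfold_in => hf; elim: n => [|n IH].
    by rewrite esum1 // => g _; rewrite mul0r.
  under eq_esum do rewrite -natr1 mulrDl mul1r EFinD.
  rewrite esumD; first by rewrite lte_add_pinfty.
    by move=> g _; rewrite lee_fin mulr_ge0 ?ler0n ?sqr_ge0.
  by move=> g _; rewrite lee_fin sqr_ge0.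
split=> [|a f h hf hh].
  rewrite unfold_in /sqsum esum1 // => g _.
  by rewrite [Normc.normc _]Normc.normc0 expr0n.
pose n := Num.bound (2 * Normc.normc a ^+ 2).
rewrite unfold_in; apply: le_lt_trans (lte_add_pinfty (scl n f hf) (scl 2 h hh)).
rewrite -esumD; last 2 first.
- by move=> g _; rewrite lee_fin mulr_ge0 ?ler0n ?sqr_ge0.
- by move=> g _; rewrite lee_fin mulr_ge0 ?ler0n ?sqr_ge0.
apply: le_esum => g _; rewrite -EFinD lee_fin.
rewrite (_ : (a *: f + h) g = a * f g + h g) //.
have nge0 (w : R[i]) : 0 <= Normc.normc w by case: w => u v; exact: sqrtr_ge0.
have le1 := le_normcD (a * f g) (h g).
rewrite Normc.normcM in le1.
set p := Normc.normc (_ + _) in le1 *.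
set x := Normc.normc a in le1 n *; set y := Normc.normc (f g) in le1 *.
set z := Normc.normc (h g) in le1 *.
have p0 : 0 <= p by exact: nge0.
apply: (@le_trans _ _ ((x * y + z) ^+ 2)).
  by rewrite ler_sqr // nnegrE // (le_trans p0).
apply: (@le_trans _ _ (2 * x ^+ 2 * y ^+ 2 + 2 * z ^+ 2)).
  rewrite -subr_ge0 (_ : _ - _ = (x * y - z) ^+ 2) ?sqr_ge0 //; ring.
by rewrite lerD2r ler_wpM2r ?sqr_ge0 // ltW // archi_boundP // mulr_ge0 ?ler0n ?sqr_ge0.
Qed.

HB.instance Definition _ := GRing.isSubmodClosed.Build R[i] (G -> R[i])
  square_summable square_summable_submod_closed.

Record l2 := L2 { l2_fun :> G -> R[i]; _ : l2_fun \in square_summable }.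
HB.instance Definition _ := [isSub for l2_fun].
HB.instance Definition _ := [Choice of l2 by <:].
HB.instance Definition _ := [SubChoice_isSubLmodule of l2 by <:].

End SquareSummable.

Definition l2norm (R : realType) (G : groupType) (f : l2 R G) : R :=
  Num.sqrt (fine (sqsum f)).

Section Translations.
Variables (R : realType) (G : groupType).

Lemma translate_subproof (e e' : G -> G) (f : l2 R G) :
  cancel e e' -> cancel e' e -> (fun x => f (e x)) \in @square_summable R G.
Proof.
move=> ee' e'e; have := valP f; rewrite !unfold_in /= /sqsum.
rewrite (@reindex_esum _ _ _ [set: G] [set: G] e) //.
by split=> // [x y _ _ /(can_inj ee')|y _] //; exists (e' y).
Qed.

Definition ltrans (g : G) (f : l2 R G) : l2 R G :=
  L2 (translate_subproof f (mulKg g^-1%g) (mulVKg g^-1%g)).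

Definition rtrans (g : G) (f : l2 R G) : l2 R G :=
  L2 (translate_subproof f (mulgK g) (mulgVK g)).

Lemma ltransE g f x : ltrans g f x = f (g^-1 * x)%g. Proof. by []. Qed.
Lemma rtransE g f x : rtrans g f x = f (x * g)%g. Proof. by []. Qed.

Definition lconv (a : groupRing R[i] G) (f : l2 R G) : l2 R G :=
  \sum_(g <- msupp (a : {malg R[i][G]})) (a : {malg R[i][G]})@_g *: ltrans g f.

End Translations.

Section Operators.
Variables (R : realType) (G : groupType).
Local Notation H := (l2 R G).

Definition bounded_op (T : {linear H -> H}) : Prop :=
  exists M : R, forall f, l2norm (T f) <= M * l2norm f.

(* The commutant of the right translations; it contains the complex group
   ring acting by left convolution. *)
Definition group_vN_algebra : set {linear H -> H} :=
  [set T | bounded_op T /\ forall g f, T (rtrans g f) = rtrans g (T f)].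

Definition commutant (N : set {linear H -> H}) : set {linear H -> H} :=
  [set S | bounded_op S /\ forall T, N T -> forall f, S (T f) = T (S f)].

(* Unbounded operators are represented by their graphs. *)
Definition graph_closure (T : set (H * H)) : set (H * H) :=
  [set p | forall e : R, 0 < e -> exists q, [/\ T q,
     l2norm (p.1 - q.1) < e & l2norm (p.2 - q.2) < e]].

Record closed_densely_defined (T : set (H * H)) : Prop := {
  op_linear : forall (a : R[i]) p q, T p -> T q ->
    T (a *: p.1 + q.1, a *: p.2 + q.2);
  op_functional : forall y, T (0, y) -> y = 0;
  op_dense : forall (x : H) (e : R), 0 < e ->
    exists p, T p /\ l2norm (x - p.1) < e;
  op_closed : graph_closure T = T
}.

(* [S T] is contained in [T S] for every bounded [S] in the commutant. *)
Definition affiliated (T : set (H * H)) : Prop :=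
  closed_densely_defined T /\
  forall S, commutant group_vN_algebra S ->
    forall x y, T (x, y) -> T (S x, S y).

Definition op_graph (f : H -> H) : set (H * H) := [set p | p.2 = f p.1].

Definition op_add (S T : set (H * H)) : set (H * H) :=
  [set p | exists y z, [/\ S (p.1, y), T (p.1, z) & p.2 = y + z]].

Definition op_comp (S T : set (H * H)) : set (H * H) :=
  [set p | exists y, T (p.1, y) /\ S (y, p.2)].

Definition op_scale (a : R[i]) (T : set (H * H)) : set (H * H) :=
  [set p | exists y, T (p.1, y) /\ p.2 = a *: y].

(* The algebra of operators affiliated to the group von Neumann algebra: by
   Murray and von Neumann, the closed densely defined affiliated operators form
   a complex algebra under the closures of the sum, composition and scaling of
   partially defined operators. An element of this record is this algebra:
   [aff_op] identifies its elements with the affiliated operators, so it is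
   determined up to a unique isomorphism. [aff_incl] is the embedding of the
   complex group ring, acting on l^2(G) by left convolution; it is determined
   by [aff_inclE] because [aff_op] is injective. *)
Record affiliatedAlgebra := AffiliatedAlgebra {
  aff_sort :> algType R[i];
  aff_op : aff_sort -> set (H * H);
  aff_op_inj : injective aff_op;
  aff_op_range : range aff_op = affiliated;
  aff_opD : forall x y,
    aff_op (x + y) = graph_closure (op_add (aff_op x) (aff_op y));
  aff_opZ : forall a x, aff_op (a *: x) = graph_closure (op_scale a (aff_op x));
  aff_opM : forall x y,
    aff_op (x * y) = graph_closure (op_comp (aff_op x) (aff_op y));
  aff_op1 : aff_op 1 = op_graph id;
  aff_incl : {rmorphism groupRing R[i] G -> aff_sort};
  aff_inclE : forall a, aff_op (aff_incl a) = op_graph (lconv a)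
}.

End Operators.

(* [divclosedV]: closed under inverses of elements that are invertible in [U]. *)
Record division_closed (U : nzRingType) (S : set U) : Prop := {
  divclosed1 : S 1;
  divclosedB : forall x y, S x -> S y -> S (x - y);
  divclosedM : forall x y, S x -> S y -> S (x * y);
  divclosedV : forall x y, S x -> x * y = 1 -> y * x = 1 -> S y
}.

Definition division_closure (U : nzRingType) (E : set U) : set U :=
  smallest (@division_closed U) E.

Section Linnell.
Variables (R : realType) (G : groupType) (U : affiliatedAlgebra R G).

Definition linnell_pred : {pred U} :=
  fun x => `[< division_closure (range (@aff_incl R G U)) x >].

Lemma linnell_subring_closed : subring_closed linnell_pred.
Proof.
split=> [|x y /asboolP hx /asboolP hy|x y /asboolP hx /asboolP hy];
  apply/asboolP => S hS; case: (hS) => dS _.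
- exact: divclosed1.
- by apply: divclosedB => //; [exact: hx | exact: hy].
- by apply: divclosedM => //; [exact: hx | exact: hy].
Qed.
HB.instance Definition _ := GRing.isSubringClosed.Build U linnell_pred
  linnell_subring_closed.

Record linnell := Linnell { linnell_val : U; _ : linnell_val \in linnell_pred }.
HB.instance Definition _ := [isSub for linnell_val].
HB.instance Definition _ := [Choice of linnell by <:].
HB.instance Definition _ := [SubChoice_isSubNzRing of linnell by <:].

Lemma aff_incl_linnell a : aff_incl U a \in linnell_pred.
Proof. by apply/asboolP => S [_]; apply; exists a. Qed.

Definition linnell_incl (a : groupRing R[i] G) : linnell :=
  Linnell (aff_incl_linnell a).

Lemma linnell_incl_zmod_morphism : zmod_morphism linnell_incl.
Proof. by move=> a b; apply/val_inj; rewrite /= !raddfB. Qed.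
HB.instance Definition _ := GRing.isZmodMorphism.Build
  (groupRing R[i] G) linnell linnell_incl linnell_incl_zmod_morphism.

Lemma linnell_incl_monoid_morphism : monoid_morphism linnell_incl.
Proof.
by split=> [|a b]; apply/val_inj; rewrite /= ?rmorph1 ?rmorphM.
Qed.
HB.instance Definition _ := GRing.isMonoidMorphism.Build
  (groupRing R[i] G) linnell linnell_incl linnell_incl_monoid_morphism.

End Linnell.

Section GroupRingLift.
Variables (G : groupType) (B : pzRingType) (phi : G -> B).
Hypothesis phi1 : phi 1%g = 1.
Hypothesis phiM : forall g h, phi (g * h)%g = phi g * phi h.

Definition gr_lift (a : groupRing int G) : B := free_lift phi a.

Lemma gr_lift1 : gr_lift 1 = 1.
Proof. by rewrite /gr_lift free_liftU phi1. Qed.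

Lemma gr_liftD a b : gr_lift (a + b) = gr_lift a + gr_lift b.
Proof. exact: (raddfD (free_lift phi)). Qed.

Lemma gr_liftM a b : gr_lift (a * b) = gr_lift a * gr_lift b.
Proof.
rewrite /gr_lift [a * b]/(gr_mul a b) /gr_mul raddf_sum /= [X in X * _]/free_lift.
rewrite mulr_suml; apply/eq_bigr => g _.
rewrite raddf_sum /= [X in _ * X]/free_lift mulr_sumr; apply/eq_bigr => h _.
by rewrite free_liftU phiM mulrzAl mulrzAr -mulrzA [X in _ *~ X]mulrC.
Qed.

End GroupRingLift.

Record representation (K : comUnitRingType) (G : groupType) (n : nat) :=
  Representation {
    rep_mx :> G -> 'M[K]_n;
    rep_unit : forall g, rep_mx g \in unitmx;
    rep1 : rep_mx 1%g = 1%:M;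
    repM : forall g h, rep_mx (g * h)%g = rep_mx g *m rep_mx h
  }.

Lemma mulr_swap (B : pzRingType) (a b s t : B) :
  b * s = s * b -> a * b * (s * t) = a * s * (b * t).
Proof. by move=> bs; rewrite -!mulrA (mulrA b) bs !mulrA. Qed.

Section Twist.
Variables (R : realType) (G : groupType) (U : affiliatedAlgebra R G).
Local Notation D := (linnell U).
Local Notation tau := (@linnell_incl R G U).

Definition tau_elt (g : G) : D := tau (gr_elt R[i] g).
Definition tau_const (c : R[i]) : D := tau (gr_const G c).

Lemma tau_elt1 : tau_elt 1%g = 1.
Proof. by rewrite /tau_elt -(rmorph1 tau). Qed.

Lemma tau_eltM g h : tau_elt (g * h)%g = tau_elt g * tau_elt h.
Proof.
rewrite /tau_elt -rmorphM; congr (tau _).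
by rewrite /gr_elt [RHS]gr_mulUU mulr1.
Qed.

Lemma tau_const_zmod_morphism : zmod_morphism tau_const.
Proof.
move=> x y; rewrite /tau_const -raddfB; congr (tau _).
exact: (raddfB (mkmalgU 1%g)).
Qed.
HB.instance Definition _ := GRing.isZmodMorphism.Build R[i] D tau_const
  tau_const_zmod_morphism.

Lemma tau_const_monoid_morphism : monoid_morphism tau_const.
Proof.
split=> [|x y]; first by rewrite /tau_const -(rmorph1 tau).
rewrite /tau_const -rmorphM; congr (tau _).
by rewrite /gr_const [RHS]gr_mulUU mulg1.
Qed.
HB.instance Definition _ := GRing.isMonoidMorphism.Build R[i] D tau_const
  tau_const_monoid_morphism.

Lemma tau_constC c g : tau_const c * tau_elt g = tau_elt g * tau_const c.
Proof.
have E : gr_const G c * gr_elt R[i] g = gr_elt R[i] g * gr_const G c.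
  by rewrite [LHS]gr_mulUU [RHS]gr_mulUU mulr1 mul1r mulg1 mul1g.
exact: etrans (esym (rmorphM tau _ _)) (etrans (congr1 tau E) (rmorphM tau _ _)).
Qed.

Definition untwisted_lact (a : groupRing int G) (x : D^c^o) : D^c^o :=
  (gr_lift tau_elt a : D) * (x : D).

Lemma untwisted_lact1 x : untwisted_lact 1 x = x.
Proof. by rewrite /untwisted_lact gr_lift1 ?mul1r //; exact: tau_elt1. Qed.

Lemma untwisted_lactM a b x :
  untwisted_lact (a * b) x = untwisted_lact a (untwisted_lact b x).
Proof.
by rewrite /untwisted_lact gr_liftM ?mulrA //; exact: tau_eltM.
Qed.

Lemma untwisted_lactDl a b x :
  untwisted_lact (a + b) x = untwisted_lact a x + untwisted_lact b x.
Proof. by rewrite /untwisted_lact gr_liftD; exact: (@mulrDl D). Qed.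

Lemma untwisted_lactDr a x y :
  untwisted_lact a (x + y) = untwisted_lact a x + untwisted_lact a y.
Proof. exact: (@mulrDr D). Qed.

Lemma untwisted_lactZ a (d : D^c) x :
  untwisted_lact a (d *: x) = d *: untwisted_lact a x.
Proof. exact: (@mulrA D). Qed.

(* The (ZG, D)-bimodule D, with G acting by left multiplication via [tau]. *)
Definition untwisted_bimodule : bimodule (groupRing int G) D :=
  @Bimodule (groupRing int G) D D^c^o untwisted_lact untwisted_lact1
    untwisted_lactM untwisted_lactDl untwisted_lactDr untwisted_lactZ.

Variables (n : nat) (sigma : representation R[i] G n).

(* The matrix of the action of [g], i.e. of [v |-> sigma(g) tau(g) v]. *)
Definition twist_mx (g : G) : 'M[D]_n :=
  \matrix_(i, j) (tau_const (sigma g i j) * tau_elt g).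

Lemma twist_mx1 : twist_mx 1%g = 1.
Proof.
apply/matrixP => i j; rewrite !mxE rep1 mxE tau_elt1 mulr1.
by case: (i == j); rewrite ?rmorph1 ?rmorph0.
Qed.

Lemma twist_mxM g h : twist_mx (g * h)%g = twist_mx g * twist_mx h.
Proof.
apply/matrixP => i k; rewrite !mxE repM mxE rmorph_sum mulr_suml.
apply/eq_bigr => j _; rewrite !mxE rmorphM tau_eltM.
by apply: mulr_swap; exact: tau_constC.
Qed.

(* The right D-module of column vectors: scaling by [d : D^c] multiplies the
   entries by [d] on the right. *)
Definition twisted_lact (a : groupRing int G) (v : 'cV[D^c]_n) : 'cV[D^c]_n :=
  (gr_lift twist_mx a : 'M[D]_n) *m (v : 'cV[D]_n).

Lemma twisted_lact1 v : twisted_lact 1 v = v.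
Proof.
by rewrite /twisted_lact gr_lift1 ?(@mul1mx D) //; exact: twist_mx1.
Qed.

Lemma twisted_lactM a b v :
  twisted_lact (a * b) v = twisted_lact a (twisted_lact b v).
Proof.
by rewrite /twisted_lact gr_liftM ?(@mulmxA D) //; exact: twist_mxM.
Qed.

Lemma twisted_lactDl a b v :
  twisted_lact (a + b) v = twisted_lact a v + twisted_lact b v.
Proof. by rewrite /twisted_lact gr_liftD; exact: (@mulmxDl D). Qed.

Lemma twisted_lactDr a v w :
  twisted_lact a (v + w) = twisted_lact a v + twisted_lact a w.
Proof. exact: (@mulmxDr D). Qed.

Lemma twisted_lactZ a (d : D^c) v :
  twisted_lact a (d *: v) = d *: twisted_lact a v.
Proof.
apply/matrixP => i j; rewrite /twisted_lact !mxE.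
rewrite [RHS](@mulr_suml D); apply/eq_bigr => k _.
by rewrite mxE; exact: (@mulrA D).
Qed.

(* The (ZG, D)-bimodule D^n, with G acting by g . v = sigma(g) tau(g) v. *)
Definition twisted_bimodule : bimodule (groupRing int G) D :=
  @Bimodule (groupRing int G) D 'cV[D^c]_n twisted_lact twisted_lact1
    twisted_lactM twisted_lactDl twisted_lactDr twisted_lactZ.

Variable C : chainComplex (groupRing int G)^c.

Definition l2_betti (i : int) : \bar R :=
  skew_dim R (homology (tensor_complex C untwisted_bimodule) i).

Definition twisted_l2_betti (i : int) : \bar R :=
  skew_dim R (homology (tensor_complex C twisted_bimodule) i).

End Twist.

(* Main.v *)
From HB Require Import structures.
Require Import Defs.
From mathcomp Require Import all_boot all_order all_algebra.
From mathcomp Require Import complex finmap.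
From mathcomp.multinomials Require Import monalg.
From mathcomp Require Import all_classical all_reals all_analysis.
From mathcomp Require Import zify ring lra.
From Stdlib Require Import Wellfounded.

Set Implicit Arguments.
Unset Strict Implicit.
Unset Printing Implicit Defensive.

(** Write [D] for the Linnell skew field, [tau] for the inclusion of the group
    into it and [Phi g = sigma g * tau g], a matrix over [D].

    If [Phi] extends to a ring homomorphism [psi] from [D] to the matrices over
    [D], then the twisted column space is a left module over [D] through [psi],
    and the twisted complex is the base change along [psi] of the untwisted one.
    All modules over a skew field are free, so this base change commutes with
    homology, and it multiplies dimensions by [n], for arbitrary modules in the
    complex ([skew_dim_base_change]).

    The existence of [psi] ([twisted_extension]) comes from the direct sum of the
    trivial representation and [sigma]. Let [E] be the ring of the matrices that
    are values of rational expressions in the twisted group elements and the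
    constants. Its elements are block diagonal. If each of them is zero or
    invertible, then the upper left corner is an injective map from [E] to [D];
    its image is division closed and contains the group ring, so it is all of
    [D], and [psi] is the inverse of this map followed by the lower right block.

    That each value of a rational expression is zero or invertible
    ([expr_good]) is proved by the induction of Hughes on the complexity of the
    expression. Up to a group element, only a finitely generated subgroup [H]
    enters the expression. If [H] is trivial, then the value is a constant. If not,
    take a homomorphism [phi] of [H] onto the integers. It grades a part of [D]:
    there are subgroups [D_k], whose sum is direct, with [tau h] in [D_k]
    for [phi h = k], and every nonzero element of [D_k] has its inverse in
    [D_(-k)]. Such a grading makes the sums of homogeneous elements behave like
    skew Laurent polynomials over the skew field [D_0]. They satisfy the Ore
    condition ([ore_matrix]), and the matrices of fractions have Laurent
    expansions. The coefficients in the expansion of the value of the expression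
    are values of strictly simpler expressions ([expr_controlled]); by induction
    the first nonzero coefficient is invertible, and so is the value.

    The grading ([rot_grading]) is where the operators enter. The homomorphism
    [phi] extends to a function [d] on the group which is equivariant for left
    translations by [H]. For [z] in the unit circle, multiplication by [z ^ d] is
    a unitary operator of [l^2(G)], and [D_k] consists of the elements on which
    conjugation by all these unitary operators is multiplication by [z ^ k].
    A Vandermonde determinant shows that the sum of the [D_k] is direct, and they
    are compatible with inversion because an inverse in the algebra of affiliated
    operators is the inverse operator ([aff_op_inverse]). *)

Import Order.TTheory GRing.Theory Num.Theory.
Local Open Scope ring_scope.

(** * Linear algebra over a skew field *)

Section DivisionSubring.
Variables (D : nzRingType) (K : set D).
Hypothesis dK : division_closed K.

Lemma divclosed0 : K 0.
Proof. by rewrite -(subrr 1); apply: divclosedB => //; apply: divclosed1. Qed.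

Lemma divclosedN x : K x -> K (- x).
Proof. by move=> Kx; rewrite -[- x]add0r; apply: divclosedB => //; exact: divclosed0. Qed.

Lemma divclosedD x y : K x -> K y -> K (x + y).
Proof. by move=> Kx Ky; rewrite -[y]opprK; apply: divclosedB => //; exact: divclosedN. Qed.

Lemma divclosed_sum (I : Type) (r : seq I) (P : pred I) (F : I -> D) :
  (forall i, P i -> K (F i)) -> K (\sum_(i <- r | P i) F i).
Proof.
by move=> KF; apply: (big_ind K) => //; [exact: divclosed0|exact: divclosedD].
Qed.

End DivisionSubring.

Section SkewLinear.
Variables (D : nzRingType).
Hypothesis skD : skew_field D.

Variable (K : set D).
Hypothesis dK : division_closed K.

(** Gaussian elimination one equation at a time: an equation with a nonzero
    coefficient expresses one unknown through the others. *)
Lemma wide_system_seq (I : finType) (rows : seq (I -> D)) (S : {set I}) :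
  (forall a, List.In a rows -> forall i, K (a i)) -> (size rows < #|S|)%N ->
  exists x : I -> D, [/\ forall i, K (x i), forall i, i \notin S -> x i = 0,
    exists i, x i <> 0 & forall a, List.In a rows -> \sum_i a i * x i = 0].
Proof.
have [k] := ubnP (size rows); elim: k rows S => // k IH [|a rows] /= S ltk Krows ltS.
  have /card_gt0P[i0 i0S] := ltS.
  exists (fun i => (i == i0)%:R); split=> //.
  - by move=> i; case: (i == i0); [exact: divclosed1|exact: divclosed0].
  - by move=> i iS; case: eqVneq => // ii0; rewrite ii0 i0S in iS.
  - by exists i0; rewrite eqxx; apply/eqP/oner_neq0.
have Ka i : K (a i) by apply: (Krows a); left.
have Kr b : List.In b rows -> forall i, K (b i) by move=> ?; apply: Krows; right.
case: (pselect (exists2 i, i \in S & a i != 0)) => [[i0 i0S ai0]|noi]; last first.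
  have a0 i : i \in S -> a i = 0.
    by move=> iS; apply/eqP/negPn/negP => ai; apply: noi; exists i.
  have [x [Kx x0 xn xr]] := IH rows S ltk Kr (ltnW ltS).
  exists x; split=> // b [<-|]; last exact: xr.
  rewrite big1 // => i _; have [iS|iS] := boolP (i \in S).
    by rewrite a0 ?mul0r.
  by rewrite x0 ?mulr0.
have [c [ac ca]] := skD ai0.
have Kc : K c by apply: (divclosedV dK (Ka i0)).
pose rows' := [seq (fun i => b i - b i0 * c * a i) | b <- rows].
have inrows' b : List.In b rows ->
    List.In (fun i => b i - b i0 * c * a i) rows'.
  by move=> bin; apply: (List.in_map (fun (b : I -> D) i => b i - b i0 * c * a i)).
have Kr' b : List.In b rows' -> forall i, K (b i).
  move=> /(List.in_map_iff (fun (b : I -> D) i => b i - b i0 * c * a i))[b' [<- b'in]] i.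
  by apply: divclosedB => //; [exact: Kr|do 2?apply: divclosedM => //; exact: Kr].
have lt' : (size rows' < #|S :\ i0|)%N.
  by rewrite size_map; move: ltS; rewrite (cardsD1 i0 S) i0S.
have szk : (size rows' < k)%N by rewrite size_map.
have [x [Kx x0 [i1 xi1] xr]] := IH _ _ szk Kr' lt'.
have xi0 : x i0 = 0 by apply: x0; rewrite !inE eqxx.
pose s := \sum_i a i * x i.
exists (fun i => if i == i0 then - (c * s) else x i); split.
- move=> i; case: ifP => // _; apply: divclosedN => //; apply: divclosedM => //.
  by apply: divclosed_sum => // j _; apply: divclosedM.
- move=> i iS; case: eqVneq => [ii0|ii0]; first by rewrite -ii0 (negPf iS) in i0S.
  by apply: x0; rewrite !inE (negPf iS) andbF.
- by exists i1; case: eqVneq => // ii0; case: xi1; rewrite ii0.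
have rep b : \sum_i b i * (if i == i0 then - (c * s) else x i)
    = \sum_i b i * x i - b i0 * c * s.
  rewrite (bigD1 i0) //= eqxx [X in _ = X - _](bigD1 i0) //= xi0 mulr0 add0r.
  rewrite addrC mulrN mulrA; congr (_ - _).
  by apply: eq_bigr => i /negPf ->.
move=> b [<-|bin]; rewrite rep; first by rewrite ac mul1r /s subrr.
have := xr _ (inrows' b bin).
under eq_bigr do rewrite mulrBl -[X in _ - X]mulrA.
by rewrite sumrB -mulr_sumr.
Qed.

(** The dimension count behind the Ore condition and the invariance of bases.
    In the Ore condition, [K] is the degree-zero part of a graded skew field, and
    the solution has to be found inside it. *)
Lemma wide_system (I J : finType) (A : J -> I -> D) :
  (forall j i, K (A j i)) -> (#|J| < #|I|)%N ->
  exists x : I -> D, [/\ forall i, K (x i), exists i, x i <> 0 &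
    forall j, \sum_i A j i * x i = 0].
Proof.
move=> KA lt.
have [||x [Kx _ xn xr]] := @wide_system_seq I [seq A j | j <- enum J] [set: I].
- by move=> a /(List.in_map_iff A)[j [<- _]].
- by rewrite size_map -cardE cardsT.
exists x; split=> // j; apply: xr; apply/(List.in_map_iff A); exists j; split=> //.
have : j \in enum J by rewrite mem_enum.
by elim: (enum J) => //= k s IH; rewrite in_cons => /orP[/eqP->|/IH]; [left|right].
Qed.

Definition mx_in n p (A : 'M[D]_(n, p)) := forall i j, K (A i j).

(** A column of the inverse is a solution [v] of [A v = e_j c]. This system in [v]
    and [c] has one unknown more than equations, and injectivity of [A] makes [c]
    nonzero in any nontrivial solution. *)
Lemma mx_right_inverse n (A : 'M[D]_n) : mx_in A ->
  (forall v : 'cV[D]_n, mx_in v -> A *m v = 0 -> v = 0) ->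
  exists2 A' : 'M[D]_n, mx_in A' & A *m A' = 1%:M.
Proof.
move=> KA inj.
have col_ex (j : 'I_n) : exists v : 'cV[D]_n, mx_in v /\ A *m v = delta_mx j 0.
  pose M (i : 'I_n) (k : option 'I_n) : D := if k is Some k then A i k else - (i == j)%:R.
  have KM i k : K (M i k).
    case: k => //= ; apply: divclosedN => //.
    by case: (i == j); [exact: divclosed1|exact: divclosed0].
  have [|x [Kx xn xr]] := @wide_system (option 'I_n) 'I_n M KM.
    by rewrite card_option ltnS.
  have big_opt i : \sum_k M i k * x k = \sum_k A i k * x (Some k) - (i == j)%:R * x None.
    rewrite (bigD1 None) //= addrC mulNr; congr (_ - _).
    rewrite (reindex_omap Some id) /=; last by case.
    by apply: eq_bigl => k; rewrite eqxx.
  have [x0|/skD[c [xc cx]]] := eqVneq (x None) 0.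
    have v0 : (\col_k x (Some k)) = 0 :> 'cV[D]_n.
      apply: inj => [i l|]; first by rewrite mxE.
      apply/matrixP => i l; rewrite !mxE.
      have := xr i; rewrite big_opt x0 mulr0 subr0 => xri; rewrite -[RHS]xri.
      by apply: eq_bigr => k _; rewrite mxE.
    case: xn => -[k|] //; have := congr1 (fun v : 'cV[D]_n => v k 0) v0.
    by rewrite !mxE.
  have Kc : K c by apply: (divclosedV dK (Kx None)).
  exists (\col_k (x (Some k) * c)); split=> [i l|].
    by rewrite mxE; apply: divclosedM.
  apply/matrixP => i l; rewrite !mxE.
  have := xr i; rewrite big_opt => /eqP; rewrite subr_eq0 => /eqP E.
  under eq_bigr do rewrite mxE mulrA.
  by rewrite -mulr_suml E -mulrA xc mulr1 ord1 eqxx andbT.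
have [v vP] := choice col_ex.
exists (\matrix_(i, j) v j i 0); first by move=> i j; rewrite mxE; apply: (vP j).1.
apply/matrixP => i j; have := congr1 (fun u : 'cV[D]_n => u i 0) (vP j).2.
rewrite !mxE eqxx andbT => <-.
by apply: eq_bigr => k _; rewrite mxE.
Qed.

End SkewLinear.

Section Units.
Variable B : nzRingType.
Definition is_unit (x : B) := exists y, x * y = 1 /\ y * x = 1.
Lemma is_unitM x y : is_unit x -> is_unit y -> is_unit (x * y).
Proof.
move=> [x' [xx' x'x]] [y' [yy' y'y]]; exists (y' * x'); split.
  by rewrite -mulrA (mulrA y) yy' mul1r.
by rewrite -mulrA (mulrA x') x'x mul1r.
Qed.
Lemma is_unit_neq0 x : is_unit x -> x <> 0.
Proof. by move=> [y [+ _]] x0; rewrite x0 mul0r => /esym/eqP; rewrite (negPf (oner_neq0 _)). Qed.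
Lemma inv_unique (x y y' : B) : y * x = 1 -> x * y' = 1 -> y = y'.
Proof. by move=> yx xy'; rewrite -[y]mulr1 -xy' mulrA yx mul1r. Qed.
End Units.

Section SkewMatrix.
Variables (D : nzRingType).
Hypothesis skD : skew_field D.

Lemma setT_division_closed : division_closed [set: D]%classic.
Proof. by split. Qed.

(** Square matrices over a skew field are Dedekind finite: the right inverse [A']
    is injective on columns, hence has a right inverse, which must be [A]. *)
Lemma mx_right_unit n (A A' : 'M[D]_n.+1) : A * A' = 1 -> is_unit A.
Proof.
move=> AA'.
have [//|v _ A'v|A2 _ A'A2] := mx_right_inverse skD setT_division_closed (A := A').
  by rewrite -[v]mul1mx -[1%:M]AA' -mulmxA A'v mulmx0.
have A'A : A' * A = 1 by rewrite (inv_unique AA' A'A2) -[RHS]A'A2.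
by exists A'.
Qed.

Variable (K : set D).
Hypothesis dK : division_closed K.

Lemma mx_in_inverse n (A A' : 'M[D]_n.+1) : mx_in K A ->
  A' * A = 1 -> A * A' = 1 -> mx_in K A'.
Proof.
move=> KA A'A AA'.
have [//|v _ Av|A2 KA2 AA2] := mx_right_inverse skD dK (A := A).
  by rewrite -[v]mul1mx -[1%:M]A'A -mulmxA Av mulmx0.
by rewrite (inv_unique A'A AA2).
Qed.

End SkewMatrix.

(** * The Ore condition in a graded skew field *)

(** A family of additive subgroups of a skew field, graded by degree. Directness
    is stated for consecutive degrees; missing ones can be filled with zeros.
    [grd_unit] makes each component free of rank one over the degree-zero one. *)
Record skew_grading (D : nzRingType) (Dg : int -> set D) : Prop := {
  grdB : forall k x y, Dg k x -> Dg k y -> Dg k (x - y);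
  grd1 : Dg 0 1;
  grdM : forall k l x y, Dg k x -> Dg l y -> Dg (k + l) (x * y);
  grdV : forall k x y, Dg k x -> x * y = 1 -> y * x = 1 -> Dg (- k) y;
  grd_direct : forall (k : int) (m : nat) (x : nat -> D),
    (forall i, Dg (k + i%:Z) (x i)) -> \sum_(i < m) x i = 0 ->
    forall i, (i < m)%N -> x i = 0;
  grd_unit : forall k, exists2 u, Dg k u & is_unit u
}.

Lemma sum_conv_trunc (V : nmodType) (M k : nat) (F : nat -> V) :
  (forall i, (M <= i)%N -> F i = 0) ->
  \sum_(i < k.+1) F i = \sum_(i < M) (if (i <= k)%N then F i else 0).
Proof.
move=> F0; rewrite (big_ord_widen (k.+1 + M)) ?leq_addr //.
rewrite (big_ord_widen (k.+1 + M) (fun i => if (i <= k)%N then F i else 0)) ?leq_addl //.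
rewrite big_mkcond [RHS]big_mkcond; apply: eq_bigr => i _; rewrite ltnS.
by case: ifP => // ik; case: ltnP => // /F0.
Qed.

Section Graded.
Variables (D : nzRingType) (Dg : int -> set D).
Hypothesis skD : skew_field D.
Hypothesis gD : skew_grading Dg.

Lemma grd0 k : Dg k 0.
Proof. by have [u uk _] := grd_unit gD k; rewrite -(subrr u); apply: grdB. Qed.

Lemma grdN k x : Dg k x -> Dg k (- x).
Proof. by move=> xk; rewrite -[- x]add0r; apply: grdB => //; exact: grd0. Qed.

Lemma grdD k x y : Dg k x -> Dg k y -> Dg k (x + y).
Proof. by move=> xk yk; rewrite -[y]opprK; apply: grdB => //; exact: grdN. Qed.

Lemma grd_sum k (I : Type) (r : seq I) (P : pred I) (F : I -> D) :
  (forall i, P i -> Dg k (F i)) -> Dg k (\sum_(i <- r | P i) F i).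
Proof. by move=> KF; apply: (big_ind (Dg k)) => //; [exact: grd0|exact: grdD]. Qed.

Lemma grdM_eq k l n x y : k + l = n -> Dg k x -> Dg l y -> Dg n (x * y).
Proof. by move=> <-; exact: grdM. Qed.

Lemma grd0_division_closed : division_closed (Dg 0).
Proof.
split=> [|x y|x y|x y]; [exact: grd1|exact: grdB|exact: grdM_eq|].
by move=> ? ? ?; rewrite -oppr0; apply: (grdV gD (x := x)).
Qed.

(** The Ore condition, one column at a time: the polynomials [b] and [w] of
    bounded degree with [q w = f b] are the solutions of a linear system over
    the degree-zero skew field, which has more unknowns than equations as soon
    as the bound is large. Normalising [q] to have constant term [1] makes the
    order of vanishing of [w] at least that of [b], so that the common factor
    can be cancelled. *)
Lemma ore_column m (q : nat -> 'M[D]_m) (f : nat -> 'cV[D]_m) (l : int) (d : nat) :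
  (forall i, mx_in (Dg i%:Z) (q i)) -> q 0 = 1%:M ->
  (forall i, mx_in (Dg (l + i%:Z)) (f i)) ->
  (forall i, (d <= i)%N -> q i = 0 /\ f i = 0) ->
  exists (N : nat) (w : nat -> 'cV[D]_m) (b : nat -> D),
  [/\ forall i, mx_in (Dg (l + i%:Z)) (w i) /\ Dg i%:Z (b i), b 0 = 1,
      forall i, (N <= i)%N -> w i = 0 /\ b i = 0 &
      forall k, \sum_(i < k.+1) q i *m w (k - i)%N =
        \sum_(i < k.+1) map_mx ( *%R^~ (b (k - i)%N)) (f i)].
Proof.
move=> qD q0 fD qf0.
have [tt /all_and2[ttD ttU]] := choice (fun k =>
  let: ex_intro2 u uD uU := grd_unit gD k in ex_intro _ u (conj uD uU)).
have [tv /all_and2[ttv tvt]] := choice ttU.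
have tvD k : Dg (- k) (tv k) by exact: (grdV gD (ttD k)).
(* [w] and [b] have [M * m + M] coefficients, subject to [(M + d) * m] equations *)
pose M := (m * d).+1.
pose I : finType := (('I_M * 'I_m) + 'I_M)%type.
pose J : finType := ('I_(M + d) * 'I_m)%type.
(* the factors [tt] and [tv], units of known degree, shift everything to degree 0 *)
pose A (ks : J) (i : I) : D := let: (k, s) := ks in
  match i with
  | inl (i, r) => if (i <= k)%N
      then tv (l + k%:Z) * q (k - i)%N s r * tt (l + i%:Z) else 0
  | inr i => if (i <= k)%N then - (tv (l + k%:Z) * f (k - i)%N s 0 * tt i%:Z) else 0
  end.
have AD ks i : Dg 0 (A ks i).
  case: ks i => k s [[i r]|i] /=; case: ifP => [ik|_]; try exact: grd0.
    apply: (@grdM_eq (- (l + i%:Z)) (l + i%:Z)); first lia.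
      apply: (@grdM_eq (- (l + k%:Z)) (k - i)%N%:Z) => //; first lia.
      exact: qD.
    exact: ttD.
  apply: grdN; apply: (@grdM_eq (- i%:Z) i%:Z); first lia.
    apply: (@grdM_eq (- (l + k%:Z)) (l + (k - i)%N%:Z)) => //; first lia.
    exact: fD.
  exact: ttD.
have [|y [yD [i0 yi0] yA]] := wide_system skD grd0_division_closed AD.
  by rewrite card_sum !card_prod !card_ord /M; lia.
pose w (i : nat) : 'cV[D]_m := if insub i is Some i'
  then \col_r (tt (l + i%:Z) * y (inl (i', r))) else 0.
pose b (i : nat) : D := if insub i is Some i' then tt i%:Z * y (inr i') else 0.
have wE (i : 'I_M) : w i = \col_r (tt (l + i%:Z) * y (inl (i, r))).
  by rewrite /w valK.
have bE (i : 'I_M) : b i = tt i%:Z * y (inr i) by rewrite /b valK.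
have wb0 i : (M <= i)%N -> w i = 0 /\ b i = 0.
  by move=> Mi; rewrite /w /b insubF // ltnNge Mi.
have wD i : mx_in (Dg (l + i%:Z)) (w i).
  move=> r c; rewrite /w; case: insubP => [i' _ _|_]; rewrite mxE; last exact: grd0.
  by apply: (@grdM_eq (l + i%:Z) 0) => //; rewrite addr0.
have bD i : Dg i%:Z (b i).
  rewrite /b; case: insubP => [i' _ _|_]; last exact: grd0.
  by apply: (@grdM_eq i%:Z 0) => //; rewrite addr0.
have sys k : \sum_(i < k.+1) q (k - i)%N *m w i =
    \sum_(i < k.+1) map_mx ( *%R^~ (b i)) (f (k - i)%N).
  have [kMd|kMd] := ltnP k (M + d); last first.
    have z (i : 'I_k.+1) : (w i = 0 /\ b i = 0) \/ (q (k - i)%N = 0 /\ f (k - i)%N = 0).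
      have [iM|/wb0] := ltnP i M; last by left.
      by right; apply: qf0; lia.
    rewrite !big1 // => i _; case: (z i) => -[u v]; rewrite ?(u, v) ?mulmx0 ?mul0mx //;
      by apply/matrixP => r c; rewrite !mxE ?mulr0 ?mul0r.
  rewrite (@sum_conv_trunc _ M k (fun i => q (k - i)%N *m w i)); last first.
    by move=> i /wb0[-> _]; rewrite mulmx0.
  rewrite (@sum_conv_trunc _ M k (fun i => map_mx ( *%R^~ (b i)) (f (k - i)%N))); last first.
    by move=> i /wb0[_ ->]; apply/matrixP => r c; rewrite !mxE mulr0.
  apply/matrixP => s c; rewrite !ord1 {c} !summxE.
  have := yA (Ordinal kMd, s); rewrite /I big_sumType /= => E.
  rewrite -[LHS]mul1r -[RHS]mul1r -(ttv (l + k%:Z)) -!mulrA; congr (_ * _).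
  apply/eqP; rewrite -subr_eq0; apply/eqP; rewrite -[RHS]E; congr (_ + _).
    rewrite mulr_sumr.
    transitivity (\sum_i \sum_r A (Ordinal kMd, s) (inl (i, r)) * y (inl (i, r)));
      last by rewrite pair_bigA; apply: eq_bigr => -[].
    apply: eq_bigr => i _; case: ifP => ik; last first.
      by rewrite mxE mulr0 big1 // => r _; rewrite /= ik mul0r.
    rewrite mxE mulr_sumr; apply: eq_bigr => r _.
    by rewrite /= ik wE mxE !mulrA.
  rewrite mulr_sumr -sumrN; apply: eq_bigr => i _; case: ifP => ik; last first.
    by rewrite mxE mulr0 oppr0 mul0r.
  by rewrite mxE bE mulNr !mulrA.
have low r : (forall i, (i < r)%N -> b i = 0) -> forall i, (i < r)%N -> w i = 0.
  move=> br; elim/ltn_ind => i IH ir; have := sys i.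
  rewrite big_ord_recr /= subnn q0 mul1mx big1 ?add0r => [->|j _]; last first.
    by rewrite IH ?mulmx0 //; apply: leq_trans ir; apply: ltnW; rewrite ltnS.
  rewrite big1 // => j _; apply/matrixP => s c; rewrite !mxE br ?mulr0 //.
  by apply: leq_trans ir.
have [r br brmin] : exists2 r, b r != 0 & forall i, (i < r)%N -> b i = 0.
  case: (pselect (exists r, b r != 0)) => [exb|nob].
    case: (ex_minnP exb) => r br rmin; exists r => // i ir.
    by apply/eqP/negPn/negP => /rmin; rewrite leqNgt ir.
  have b0 i : b i = 0 by apply/eqP/negPn/negP => bi; apply: nob; exists i.
  have w0 i : w i = 0 by apply: (low i.+1).
  case: yi0; case: i0 => [[i s]|i].
    have := congr1 (fun v : 'cV_m => v s 0) (w0 i); rewrite wE !mxE => E.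
    by rewrite -[y _]mul1r -(tvt (l + i%:Z)) -mulrA E mulr0.
  have := b0 i; rewrite bE => E.
  by rewrite -[y _]mul1r -(tvt i%:Z) -mulrA E mulr0.
have wmin := low r brmin.
have [c [bc cb]] := skD br.
have cD : Dg (- r%:Z) c by apply: (grdV gD (bD r)).
exists M, (fun i => map_mx ( *%R^~ c) (w (r + i)%N)), (fun i => b (r + i)%N * c).
split.
- move=> i; split=> [s t|]; last by apply: (grdM_eq _ (bD (r + i)%N) cD); lia.
  by rewrite mxE; apply: (grdM_eq _ (wD (r + i)%N s t) cD); lia.
- by rewrite addn0.
- move=> i Mi; have [|-> ->] := wb0 (r + i)%N; first by lia.
  by rewrite mul0r; split=> //; apply/matrixP => s t; rewrite !mxE mul0r.
move=> k.
have shift (F : nat -> nat -> 'cV[D]_m) : (forall i j, (j < r)%N -> F i j = 0) ->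
    \sum_(i < k.+1) F i (r + (k - i))%N =
    \sum_(i < (r + k).+1) F ((r + k) - i)%N i.
  move=> F0; rewrite (reindex_inj rev_ord_inj) /= -addnS big_split_ord /=.
  rewrite [X in _ = X + _]big1 ?add0r => [|i _]; last exact: F0.
  apply: eq_bigr => i _; have ik : (i <= k)%N by rewrite -ltnS.
  by congr (F _ _) => /=; lia.
rewrite (shift (fun i j => q i *m map_mx ( *%R^~ c) (w j))); last first.
  move=> i j /wmin ->; rewrite (_ : map_mx _ _ = 0) ?mulmx0 //.
  by apply/matrixP => s t; rewrite !mxE mul0r.
rewrite (shift (fun i j => map_mx ( *%R^~ (b j * c)) (f i))); last first.
  by move=> i j /brmin ->; apply/matrixP => s t; rewrite !mxE mul0r mulr0.
have Mr (p : nat) (X : 'M[D]_(p, m)) (Y : 'cV[D]_m) :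
    X *m map_mx ( *%R^~ c) Y = map_mx ( *%R^~ c) (X *m Y).
  apply/matrixP => s t; rewrite !mxE mulr_suml.
  by apply: eq_bigr => j _; rewrite mxE mulrA.
have sumr (F : nat -> 'cV[D]_m) p :
    \sum_(i < p) map_mx ( *%R^~ c) (F i) = map_mx ( *%R^~ c) (\sum_(i < p) F i).
  apply/matrixP => s t; rewrite mxE !summxE mulr_suml.
  by apply: eq_bigr => j _; rewrite mxE.
under eq_bigr do rewrite Mr.
rewrite (sumr (fun i => q (r + k - i)%N *m w i)) sys.
rewrite -(sumr (fun i => map_mx ( *%R^~ (b i)) (f (r + k - i)%N))).
by apply: eq_bigr => i _; apply/matrixP => s t; rewrite !mxE mulrA.
Qed.

End Graded.

(** * Laurent expansions of matrices *)

Section GradedMatrix.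
Variables (D : nzRingType) (Dg : int -> set D).
Hypothesis skD : skew_field D.
Hypothesis gD : skew_grading Dg.
Variable m : nat.
Local Notation B := 'M[D]_m.+1.
Implicit Types (k l : int) (x y : B) (p q : {poly B}).

Lemma addPosz0 k : k + 0%N%:Z = k. Proof. exact: addr0. Qed.

Definition mxdeg k : set B := fun x => mx_in (Dg k) x.

Lemma mxdeg0 k : mxdeg k 0.
Proof. by move=> i j; rewrite mxE; exact: grd0. Qed.

Lemma mxdegB k x y : mxdeg k x -> mxdeg k y -> mxdeg k (x - y).
Proof. by move=> hx hy i j; rewrite !mxE; apply: grdB. Qed.

Lemma mxdegN k x : mxdeg k x -> mxdeg k (- x).
Proof. by rewrite -[- x]add0r; apply: mxdegB; exact: mxdeg0. Qed.

Lemma mxdegD k x y : mxdeg k x -> mxdeg k y -> mxdeg k (x + y).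
Proof. by move=> hx hy; rewrite -[y]opprK; apply: mxdegB => //; exact: mxdegN. Qed.

Lemma mxdegM k l n x y : k + l = n -> mxdeg k x -> mxdeg l y -> mxdeg n (x * y).
Proof.
by move=> kl hx hy i j; rewrite mxE; apply: grd_sum => // r _; apply: (grdM_eq gD kl).
Qed.

Lemma mxdeg1 : mxdeg 0 1.
Proof.
by move=> i j; rewrite mxE; case: (i == j); [exact: grd1|exact: grd0].
Qed.

Lemma mxdeg_sum k (I : Type) (r : seq I) (P : pred I) (F : I -> B) :
  (forall i, P i -> mxdeg k (F i)) -> mxdeg k (\sum_(i <- r | P i) F i).
Proof.
by move=> KF; apply: (big_ind (mxdeg k)) => //; [exact: mxdeg0|exact: mxdegD].
Qed.

(** Multiplying by a homogeneous unit of the skew field brings the matrix to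
    degree zero, where its entries lie in a skew subfield. *)
Lemma mxdegV k x y : mxdeg k x -> x * y = 1 -> y * x = 1 -> mxdeg (- k) y.
Proof.
move=> hx xy yx; have [u uk [v [uv vu]]] := grd_unit gD k.
have vk := grdV gD uk uv vu.
have E1 : (y * u%:M) * (v%:M * x) = 1.
  by rewrite -mulrA (mulrA u%:M) -[u%:M * _]scalar_mxM uv mul1r.
have E2 : (v%:M * x) * (y * u%:M) = 1.
  by rewrite -mulrA (mulrA x) xy mul1r -[_ * _]scalar_mxM vu.
have hs : mxdeg (- k) v%:M.
  by move=> i j; rewrite mxE; case: (i == j) => //; exact: grd0.
have hu : mxdeg k u%:M.
  by move=> i j; rewrite mxE; case: (i == j) => //; exact: grd0.
have := mx_in_inverse skD (grd0_division_closed gD) (mxdegM (addNr k) hs hx) E1 E2.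
move=> /mxdegM-/(_ (- k) (- k) v%:M (add0r _) hs).
by rewrite -mulrA -[u%:M * _]scalar_mxM uv mulr1.
Qed.

(** A polynomial with coefficient of index [i] in degree [k + i] represents the sum
    [ev p] of its coefficients. The coefficients carry the degree themselves, so
    these polynomials multiply without a twist, although they model skew ones. *)
Definition pdeg k p := forall i, mxdeg (k + i%:Z) p`_i.

Lemma pdegM k l n p q : k + l = n -> pdeg k p -> pdeg l q -> pdeg n (p * q).
Proof.
move=> kl hp hq i; rewrite coefM; apply: mxdeg_sum => j _.
by apply: mxdegM (hp j) (hq _); have := ltn_ord j; lia.
Qed.

Lemma pdegD k p q : pdeg k p -> pdeg k q -> pdeg k (p + q).
Proof. by move=> hp hq i; rewrite coefD; apply: mxdegD. Qed.

Lemma pdegC k x : mxdeg k x -> pdeg k x%:P.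
Proof.
move=> hx [|i]; rewrite coefC ?addPosz0 //=; exact: mxdeg0.
Qed.

Lemma pdegXn k (n : nat) p : pdeg (k + n%:Z) p -> pdeg k (p * 'X^n).
Proof.
move=> hp i; rewrite coefMXn; case: ltnP => ni; first exact: mxdeg0.
by have := hp (i - n)%N; congr mxdeg; lia.
Qed.

Definition ev p : B := p.[1].

Lemma evD p q : ev (p + q) = ev p + ev q. Proof. exact: hornerD. Qed.
Lemma evC x : ev x%:P = x. Proof. exact: hornerC. Qed.
Lemma evM p q : ev (p * q) = ev p * ev q.
Proof. by apply: hornerM_comm; apply: commr_sym; exact: commr1. Qed.
Lemma evXn n : ev 'X^n = 1. Proof. by rewrite /ev hornerXn expr1n. Qed.
Lemma ev_sum p : ev p = \sum_(i < size p) p`_i.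
Proof. by rewrite /ev horner_coef; apply: eq_bigr => i _; rewrite expr1n mulr1. Qed.

Lemma ev_eq0 k p : pdeg k p -> ev p = 0 -> p = 0.
Proof.
move=> hp; rewrite ev_sum => p0; apply/polyP => i; rewrite coef0.
apply/matrixP => r s; have [ip|ip] := ltnP i (size p); last first.
  by rewrite nth_default.
rewrite [RHS]mxE.
apply: (grd_direct gD (k := k) (m := size p) (x := fun i => p`_i r s)) => //.
  by move=> j; apply: hp.
by rewrite -summxE p0 mxE.
Qed.

Lemma ev_inj k p q : pdeg k p -> pdeg k q -> ev p = ev q -> p = q.
Proof.
move=> hp hq pq; apply/eqP; rewrite -subr_eq0; apply/eqP/(@ev_eq0 k).
  by move=> i; rewrite coefB; apply: mxdegB.
by rewrite /ev hornerD hornerN -/(ev p) pq subrr.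
Qed.

(** The columns of [w] and their denominators come from [ore_column]. The
    denominators are the entries of the diagonal matrix [b], which is invertible
    at 1 because, by directness of the grading, none of them vanishes there. *)
Lemma ore_matrix l (q f : {poly B}) : pdeg 0 q -> q`_0 = 1 -> pdeg l f ->
  exists w b : {poly B},
  [/\ pdeg l w, pdeg 0 b, b`_0 = 1, is_unit (ev b) & q * w = f * b].
Proof.
move=> hq q0 hf.
have colP (j : 'I_m.+1) := @ore_column D Dg skD gD m.+1 (fun i => q`_i)
  (fun i => col j f`_i) l (maxn (size q) (size f)).
have col_ex (j : 'I_m.+1) : exists r : nat * (nat -> 'cV[D]_m.+1) * (nat -> D),
  [/\ forall i, mx_in (Dg (l + i%:Z)) (r.1.2 i) /\ Dg i%:Z (r.2 i), r.2 0 = 1,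
      forall i, (r.1.1 <= i)%N -> r.1.2 i = 0 /\ r.2 i = 0 &
      forall k : nat, \sum_(i < k.+1) q`_i *m r.1.2 (k - i)%N =
        \sum_(i < k.+1) map_mx ( *%R^~ (r.2 (k - i)%N)) (col j f`_i)].
  have [||||N [w [b H]]] := colP j.
  - by move=> i; have := hq i; rewrite add0r.
  - exact: q0.
  - by move=> i r s; rewrite mxE; apply: hf.
  - move=> i; rewrite geq_max => /andP[qi fi]; rewrite !nth_default //.
    by split=> //; apply/matrixP => r s; rewrite !mxE.
  by exists (N, w, b).
move=> {colP}; have {col_ex}[r rP] := choice col_ex.
pose N := \max_j (r j).1.1.
pose w : {poly B} := \poly_(i < N) \matrix_(s, j) (r j).1.2 i s 0.
pose b : {poly B} := \poly_(i < N) diag_mx (\row_j (r j).2 i).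
have big i j : (N <= i)%N -> (r j).1.2 i = 0 /\ (r j).2 i = 0.
  by have [_ _ h _] := rP j => Ni; apply: h; apply: leq_trans Ni; exact: leq_bigmax.
have wE i : w`_i = \matrix_(s, j) (r j).1.2 i s 0.
  rewrite coef_poly; case: ltnP => // Ni; apply/matrixP => s j.
  by have [E _] := big i j Ni; rewrite !mxE E mxE.
have bE i : b`_i = diag_mx (\row_j (r j).2 i).
  rewrite coef_poly; case: ltnP => // Ni; apply/matrixP => s j.
  by have [_ E] := big i s Ni; rewrite !mxE E mul0rn.
have hb : pdeg 0 b.
  move=> i s j; rewrite bE !mxE add0r; case: (s == j); last exact: grd0.
  by have [h _ _ _] := rP s; exact: (h i).2.
exists w, b; split=> //.
- by move=> i s j; rewrite wE mxE; have [h _ _ _] := rP j; exact: (h i).1.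
- apply/matrixP => s j; rewrite bE !mxE.
  by have [_ -> _ _] := rP s.
- have evb : ev b = diag_mx (\row_j \sum_(i < size b) (r j).2 i).
    rewrite ev_sum; apply/matrixP => s j; rewrite summxE !mxE -sumrMnl.
    by apply: eq_bigr => i _; rewrite bE !mxE.
  have unz (j : 'I_m.+1) : exists c, \sum_(i < size b) (r j).2 i * c = 1 /\
      c * \sum_(i < size b) (r j).2 i = 1.
    have [] := @skD (\sum_(i < size b) (r j).2 i).
      apply/eqP => E; have [h r1 _ _] := rP j.
      have : (r j).2 0 = 0.
        apply: (grd_direct gD (k := 0) (m := size b) (x := (r j).2)) => //.
          by move=> i; rewrite add0r; apply: (h i).2.
        rewrite lt0n; apply: contra_eq_neq (bE 0) => /eqP.
        rewrite size_poly_eq0 => /eqP -> ; rewrite coef0; apply/eqP => E'.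
        have := congr1 (fun M : B => M j j) E'; rewrite !mxE eqxx r1 => /eqP.
        by rewrite eq_sym oner_eq0.
      by rewrite r1 => /eqP; rewrite oner_eq0.
    by move=> c [E1 E2]; exists c; rewrite -mulr_suml.
  have [c cP] := choice unz.
  exists (diag_mx (\row_j c j)); rewrite evb; split.
    apply/matrixP => s j; rewrite -[_ * _]/(_ *m _) mul_diag_mx !mxE.
    by case: eqVneq => [->|_]; rewrite ?mulr0 // mulr_suml (cP _).1.
  apply/matrixP => s j; rewrite -[_ * _]/(_ *m _) mul_diag_mx !mxE.
  by case: eqVneq => [->|_]; rewrite ?mulr0 // (cP _).2.
apply/polyP => k; rewrite !coefM; apply/matrixP => s j.
have [_ _ _ /(_ k)] := rP j => /(congr1 (fun M : 'cV_ _ => M s 0)).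
rewrite !summxE => E; transitivity (\sum_(i < k.+1) (q`_i *m (r j).1.2 (k - i)%N) s 0).
  apply: eq_bigr => i _; rewrite wE !mxE; apply: eq_bigr => t _.
  by rewrite mxE.
rewrite E; apply: eq_bigr => i _; rewrite bE -[_ * _]/(_ *m _) mul_mx_diag !mxE.
by [].
Qed.

(** The Ore condition with numerator 1 provides a right inverse. *)
Lemma ev_unit q : pdeg 0 q -> q`_0 = 1 -> is_unit (ev q).
Proof.
move=> hq q0; have [w [b [_ _ _ [c [bc _]] E]]] := ore_matrix hq q0 (pdegC mxdeg1).
apply: (@mx_right_unit D skD m _ (ev w * c)).
by rewrite mulrA -evM E mul1r.
Qed.

(** The valuation filtration of the matrices of fractions; the requirement
    [q`_0 = 1] says that the denominator is a unit for the valuation. *)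
Definition ord_ge k : set B := fun y => exists q a : {poly B},
  [/\ pdeg 0 q, q`_0 = 1, pdeg k a & y * ev q = ev a].

Lemma ord_ge_deg k l x : k <= l -> mxdeg l x -> ord_ge k x.
Proof.
move=> kl hx; exists 1, (x%:P * 'X^`|l - k|%N); split.
- exact: pdegC mxdeg1.
- by rewrite coefC.
- by apply: pdegXn; have -> : k + `|l - k|%N%:Z = l; [lia|exact: pdegC].
- by rewrite evM evXn !evC.
Qed.

Lemma ord_geM k l x y : ord_ge k x -> ord_ge l y -> ord_ge (k + l) (x * y).
Proof.
move=> [q [a [hq q0 ha E]]] [q' [a' [hq' q0' ha' E']]].
have [w [b [hw hb b0 _ Ew]]] := ore_matrix hq q0 ha'.
exists (q' * b), (a * w); split.
- exact: (pdegM (addr0 0) hq' hb).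
- by rewrite coef0M q0' b0 mulr1.
- exact: pdegM ha hw.
by rewrite evM -mulrA (mulrA y) E' -evM -Ew evM mulrA E evM.
Qed.

Lemma ord_geN k x : ord_ge k x -> ord_ge k (- x).
Proof.
move=> hx; rewrite -mulN1r -[k]add0r; apply: ord_geM => //.
by apply: (@ord_ge_deg _ 0) => //; apply: mxdegN; exact: mxdeg1.
Qed.

Lemma ord_geD k x y : ord_ge k x -> ord_ge k y -> ord_ge k (x + y).
Proof.
move=> [q [a [hq q0 ha E]]] [q' [a' [hq' q0' ha' E']]].
have [w [b [hw hb b0 _ Ew]]] := ore_matrix hq q0 hq'.
have w0 : w`_0 = 1.
  by have := congr1 (fun p : {poly B} => p`_0) Ew; rewrite /= !coef0M q0 q0' b0 !mul1r.
exists (q * w), (a * w + a' * b); split.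
- exact: (pdegM (addr0 0) hq hw).
- by rewrite coef0M q0 w0 mulr1.
- by apply: pdegD; apply: (pdegM (addr0 k)).
by rewrite mulrDl evD {2}Ew !evM !mulrA E E'.
Qed.

Lemma ord_ge_sum k (I : Type) (r : seq I) (P : pred I) (F : I -> B) :
  (forall i, P i -> ord_ge k (F i)) -> ord_ge k (\sum_(i <- r | P i) F i).
Proof.
move=> KF; apply: (big_ind (ord_ge k)) => //; last exact: ord_geD.
by apply: (@ord_ge_deg k k) => //; exact: mxdeg0.
Qed.

Lemma ord_ge_le k l x : l <= k -> ord_ge k x -> ord_ge l x.
Proof.
move=> lk [q [a [hq q0 ha E]]]; exists q, (a * 'X^`|k - l|%N); split=> //.
  by apply: pdegXn; have -> : l + `|k - l|%N%:Z = k; [lia|].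
by rewrite evM evXn mulr1.
Qed.

(** Directness of the grading forbids a nonzero fraction of infinite order. *)
Lemma ord_ge_inf k x : (forall n : nat, ord_ge (k + n%:Z) x) -> x = 0.
Proof.
move=> hx; have [q [a [hq q0 ha E]]] := hx 0.
have [a0|an0] := eqVneq a 0.
  have [c [qc _]] := ev_unit hq q0.
  by rewrite -[x]mulr1 -qc mulrA E a0 /ev horner0 mul0r.
have [q' [a' [hq' q0' ha' E']]] := hx (size a).
have [w [b [hw hb b0 _ Ew]]] := ore_matrix hq q0 hq'.
have w0 : w`_0 = 1.
  by have := congr1 (fun p : {poly B} => p`_0) Ew; rewrite /= !coef0M q0 q0' b0 !mul1r.
have aw : a * w = a' * b * 'X^(size a).
  apply: (@ev_inj k).
  - by apply: (pdegM (addr0 k)) => //; rewrite -[k]addr0.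
  - by apply: pdegXn; apply: (pdegM (addr0 _)).
  - by rewrite !evM -E -E' evXn mulr1 -!mulrA -!evM Ew.
have ex : exists i, a`_i != 0.
  by exists (size a).-1; rewrite -lead_coefE lead_coef_eq0.
case: (ex_minnP ex) => i ai imin; case/negP: ai; apply/eqP.
have := congr1 (fun p : {poly B} => p`_i) aw.
rewrite /= coefMXn; case: ltnP => [_|si]; last by rewrite [a`_i]nth_default.
rewrite coefM big_ord_recr /= subnn w0 mulr1 big1 ?add0r // => j _.
have -> : a`_j = 0; last by rewrite mul0r.
by apply/eqP/negPn/negP => /imin; rewrite leqNgt ltn_ord.
Qed.

(** The Laurent expansion of [x], starting in degree [k], as a sequence of
    congruences modulo the filtration. *)
Definition expansion k x (e : nat -> B) :=
  (forall i, mxdeg (k + i%:Z) (e i)) /\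
  forall n : nat, ord_ge (k + n%:Z) (x - \sum_(i < n) e i).

Lemma expansion_deg k x : mxdeg k x ->
  expansion k x (fun i => if i is 0%N then x else 0).
Proof.
move=> hx; split=> [[|i]|[|n]]; first by rewrite addPosz0.
- exact: mxdeg0.
- by rewrite addPosz0 big_ord0 subr0; apply: (@ord_ge_deg k k).
rewrite big_ord_recl /= big1 // addr0 subrr.
by apply: (ord_ge_deg (lexx _)); exact: mxdeg0.
Qed.

Lemma expansionD k x y e f : expansion k x e -> expansion k y f ->
  expansion k (x + y) (fun i => e i + f i).
Proof.
move=> [he hx] [hf hy]; split=> [i|n]; first exact: mxdegD.
by rewrite big_split opprD addrACA; apply: ord_geD.
Qed.

Lemma expansion_shift k (j : nat) x e : expansion k x e ->
  expansion (k - j%:Z) x (fun i => if (i < j)%N then 0 else e (i - j)%N).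
Proof.
move=> [he hx]; split=> [i|n].
  case: ltnP => ij; first exact: mxdeg0.
  by have := he (i - j)%N; congr mxdeg; lia.
have [nj|jn] := leqP n j.
  rewrite big1 ?subr0 => [|i _]; last by rewrite (leq_trans (ltn_ord i) nj).
  by have := hx 0; rewrite addPosz0 big_ord0 subr0; apply: ord_ge_le; lia.
have -> : \sum_(i < n) (if (i < j)%N then 0 else e (i - j)%N) =
    \sum_(i < j + (n - j)) (if (i < j)%N then 0 else e (i - j)%N).
  by rewrite subnKC // ltnW.
rewrite big_split_ord /= big1 ?add0r => [|i _]; last first.
  by rewrite ltn_ord.
under eq_bigr do rewrite ltnNge leq_addr /= addKn.
by have := hx (n - j)%N; congr (ord_ge _ _); lia.
Qed.

Lemma expansion_drop k (j : nat) x e : expansion k x e ->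
  (forall i, (i < j)%N -> e i = 0) -> expansion (k + j%:Z) x (fun i => e (j + i)%N).
Proof.
move=> [he hx] e0; split=> [i|n]; first by rewrite -addrA; exact: he.
have := hx (j + n)%N; rewrite big_split_ord /= big1 ?add0r => [|i _]; last exact: e0.
by congr (ord_ge _ _); lia.
Qed.

Lemma sum_triangle (V : nmodType) (F : nat -> nat -> V) n :
  \sum_(i < n) \sum_(j < n - i) F i j = \sum_(k < n) \sum_(i < k.+1) F i (k - i)%N.
Proof.
elim: n => [|n IH]; first by rewrite !big_ord0.
rewrite big_ord_recr [RHS]big_ord_recr /= -IH subSnn big_ord1.
transitivity (\sum_(i < n) (\sum_(j < n - i) F i j + F i (n - i)%N) + F n 0).
  congr (_ + _); apply: eq_bigr => i _.
  by rewrite subSn ?(ltnW (ltn_ord i)) // big_ord_recr.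
by rewrite big_split -addrA; congr (_ + _); rewrite [RHS]big_ord_recr /= subnn.
Qed.

Lemma expansionM_defect k l x y e f n :
  expansion k x e -> expansion l y f ->
  ord_ge (k + l + n%:Z)
    (x * y - \sum_(i < n) \sum_(j < i.+1) e j * f (i - j)%N).
Proof.
move=> [he hx] [hf hy]; rewrite -(sum_triangle (fun i j => e i * f j)).
have -> : x * y - \sum_(i < n) \sum_(j < n - i) e i * f j =
    (x - \sum_(i < n) e i) * y + \sum_(i < n) e i * (y - \sum_(j < n - i) f j).
  under [X in _ = _ + X]eq_bigr do rewrite mulrBr.
  rewrite sumrB mulrBl mulr_suml addrA subrK; congr (_ - _).
  by apply: eq_bigr => i _; rewrite mulr_sumr.
apply: ord_geD.
  rewrite addrAC; apply: ord_geM => //.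
  by have := hy 0; rewrite addPosz0 big_ord0 subr0.
apply: ord_ge_sum => i _.
have -> : k + l + n%:Z = (k + i%:Z) + (l + (n - i)%N%:Z) by have := ltn_ord i; lia.
by apply: ord_geM => //; apply: (ord_ge_deg (lexx _)).
Qed.

Lemma expansionM k l x y e f : expansion k x e -> expansion l y f ->
  expansion (k + l) (x * y) (fun i => \sum_(j < i.+1) e j * f (i - j)%N).
Proof.
move=> hx hy; split=> [i|n]; last exact: expansionM_defect.
apply: mxdeg_sum => j _; apply: mxdegM (hx.1 j) (hy.1 _).
by have := ltn_ord j; lia.
Qed.

Lemma expansion0 k x e : expansion k x e -> (forall i, e i = 0) -> x = 0.
Proof.
move=> [_ hx] e0; apply: (@ord_ge_inf k) => n.
by have := hx n; rewrite big1 ?subr0 // => i _.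
Qed.

Lemma expansion_mulr_deg k l x z e : expansion k x e -> mxdeg l z ->
  expansion (k + l) (x * z) (fun i => e i * z).
Proof.
move=> [he hx] hz; split=> [i|n]; first by apply: mxdegM (he i) hz; lia.
rewrite -mulr_suml -mulrBl addrAC; apply: ord_geM => //.
exact: (ord_ge_deg (lexx _)).
Qed.

(** An invertible leading coefficient can be factored out. If [x - e 0] is the
    fraction with denominator [q] and numerator [p] of degree [k + 1], then
    [x * ev q] is [e 0] times the value of [q + c p X], where [c] inverts [e 0];
    this polynomial has constant term 1, like [q]. *)
Lemma expansion_lead k x e : expansion k x e -> is_unit (e 0) ->
  exists q a, [/\ pdeg 0 q, q`_0 = 1, pdeg 0 a, a`_0 = 1 & x * ev q = e 0 * ev a].
Proof.
move=> [he hx] [c [ec ce]].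
have hc : mxdeg (- k) c by apply: (mxdegV _ ec ce); have := he 0; rewrite addPosz0.
have [q [a [hq q0 ha E]]] := hx 1.
exists q, (q + c%:P * a * 'X^1); split=> //.
- apply: pdegD => //; apply: pdegXn; apply: (@pdegM (- k) (k + 1)); first lia.
    exact: pdegC.
  exact: ha.
- by rewrite coefD q0 coefMXn addr0.
rewrite evD !evM evXn mulr1 mulrDr evC !mulrA ec mul1r -E big_ord1.
by rewrite mulrBl addrC subrK.
Qed.

Lemma expansion_unit k x e : expansion k x e -> is_unit (e 0) -> is_unit x.
Proof.
move=> hx eU; have [q [a [hq q0 ha a0 E]]] := expansion_lead hx eU.
have [r [qr _]] := ev_unit hq q0; have [s [as_ _]] := ev_unit ha a0.
have [c [ec _]] := eU.
apply: (@mx_right_unit D skD m _ (ev q * s * c)).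
by rewrite !mulrA E -(mulrA (e 0)) as_ mulr1.
Qed.

(** If [s] is a partial sum of [f], then [y - s = y * (1 - x * s)], where [1 - x * s]
    has large order by the convolution identity. That [y] has order at least [- k]
    follows from [expansion_lead]. *)
Lemma expansionV k x y e (f : nat -> B) : expansion k x e -> x * y = 1 -> y * x = 1 ->
  (forall i, mxdeg (- k + i%:Z) (f i)) ->
  (forall i : nat, \sum_(j < i.+1) e j * f (i - j)%N = (i == 0%N)%:R) ->
  expansion (- k) y f.
Proof.
move=> hx xy yx hf ef; split=> // n.
have ef0 := ef 0; rewrite big_ord1 /= in ef0.
have eU : is_unit (e 0) by exact: (mx_right_unit skD ef0).
have yk : ord_ge (- k) y.
  have [q [a [hq q0 ha a0 E]]] := expansion_lead hx eU.
  have -> : y = y * e 0 * f 0 by rewrite -mulrA ef0 mulr1.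
  rewrite -[- k]add0r; apply: ord_geM.
    by exists a, q; split=> //; rewrite -mulrA -E mulrA yx mul1r.
  by apply: (@ord_ge_deg _ (- k)) => //; have := hf 0; rewrite addPosz0.
case: n => [|n]; first by rewrite addPosz0 big_ord0 subr0.
have -> : y - \sum_(i < n.+1) f i = y * (1 - x * \sum_(i < n.+1) f i).
  by rewrite mulrBr mulr1 mulrA yx mul1r.
apply: ord_geM => //.
have [he hxn] := hx.
have -> : 1 - x * \sum_(i < n.+1) f i =
    - \sum_(i < n.+1) (x - \sum_(j < n.+1 - i) e j) * f i.
  under [X in _ = - X]eq_bigr do rewrite mulrBl.
  rewrite sumrB opprB mulr_sumr; congr (_ - _).
  transitivity (\sum_(i < n.+1) \sum_(j < i.+1) e j * f (i - j)%N).
    under eq_bigr do rewrite ef.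
    by rewrite big_ord_recl /= big1 ?addr0.
  under [RHS]eq_bigr do rewrite mulr_suml.
  rewrite (sum_triangle (fun i j => e j * f i)).
  apply: eq_bigr => i _; rewrite (reindex_inj rev_ord_inj) /=.
  by apply: eq_bigr => j _; have := ltn_ord j; rewrite ltnS => ji; rewrite subSS subKn.
apply: ord_geN; apply: ord_ge_sum => i _.
have -> : n.+1%:Z = (k + (n.+1 - i)%N%:Z) + (- k + i%:Z) by have := ltn_ord i; lia.
by apply: ord_geM; [exact: hxn|exact: (ord_ge_deg (lexx _))].
Qed.

End GradedMatrix.

Lemma inverse_series (B : nzRingType) (c : B) (e : nat -> B) : e 0 * c = 1 ->
  exists f : nat -> B, [/\ f 0 = c,
    forall n, f n.+1 = - c * \sum_(i < n.+1) e i.+1 * f (n - i)%N &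
    forall i, \sum_(j < i.+1) e j * f (i - j)%N = (i == 0)%:R].
Proof.
move=> ec.
pose next (s : seq B) := - c * \sum_(i < size s) e i.+1 * nth 0 s (size s - i.+1).
(* course-of-values recursion: [pre n] is the list of [f 0], ..., [f n] *)
pose pre := fix pre (n : nat) : seq B := if n is n'.+1
  then rcons (pre n') (next (pre n')) else [:: c].
have szpre n : size (pre n) = n.+1 by elim: n => //= n IH; rewrite size_rcons IH.
pose f n := nth 0 (pre n) n.
have preE n i : (i <= n)%N -> nth 0 (pre n) i = f i.
  elim: n => [|n IH]; first by rewrite leqn0 => /eqP ->.
  rewrite leq_eqVlt => /orP[/eqP->//|]; rewrite ltnS => ni.
  by rewrite /= nth_rcons szpre ltnS ni IH.
have fS n : f n.+1 = - c * \sum_(i < n.+1) e i.+1 * f (n - i)%N.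
  rewrite {1}/f /= nth_rcons szpre ltnn eqxx /next szpre.
  by congr (_ * _); apply: eq_bigr => i _; rewrite subSS preE // leq_subr.
exists f; split=> // -[|n]; first by rewrite big_ord1.
rewrite big_ord_recl /= subn0 fS mulrA mulrN ec mulN1r.
by rewrite addrC; apply/eqP; rewrite subr_eq0; apply/eqP/eq_bigr.
Qed.

(** * Complexity trees *)

(** The complexity of a rational expression: for a sum, the list of its monomials,
    and for a monomial, the list of the sums that it inverts. *)
Inductive tree : Type := Node of seq tree.

(** The multiset order of Dershowitz and Manna at all levels of a tree, without
    permutations of the lists: the operations on expressions preserve the order
    of the terms. *)
Inductive tlt : tree -> tree -> Prop :=
| tlt_replace a x b c : (forall y, List.In y b -> tlt y x) ->
    tlt (Node (a ++ b ++ c)) (Node (a ++ x :: c))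
| tlt_trans s t u : tlt s t -> tlt t u -> tlt s u.

Lemma tree_In_ind (P : tree -> Prop) :
  (forall l, (forall x, List.In x l -> P x) -> P (Node l)) -> forall t, P t.
Proof.
move=> PN; fix IH 1; case=> l; apply: PN.
elim: l => [|y l IHl] x /=; first by case.
by case=> [<-|]; [exact: IH|exact: IHl].
Qed.

Section WellFounded.

Definition lstep (l l' : seq tree) : Prop := exists a x b c,
  [/\ l = a ++ b ++ c, l' = a ++ x :: c & forall y, List.In y b -> tlt y x].

Lemma tlt_lstep s t : tlt s t -> forall l l', s = Node l -> t = Node l' ->
  Relation_Operators.clos_trans _ lstep l l'.
Proof.
elim=> {s t} [a x b c bx _|s t u _ IH1 _ IH2] l l'.
  move=> [<-] [<-]; apply: Relation_Operators.t_step.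
  by exists a, x, b, c.
move=> sl ul'; case: t IH1 IH2 => l2 IH1 IH2.
by apply: Relation_Operators.t_trans (IH1 _ _ sl erefl) (IH2 _ _ erefl ul').
Qed.

(** A step in [x :: l] either takes place in [l] or replaces [x] by smaller elements,
    which are accessible. *)
Lemma Acc_lstep_cons x : Acc tlt x ->
  forall l, Acc lstep l -> Acc lstep (x :: l).
Proof.
elim=> {}x _ IHx l; elim=> {}l accl IHl; constructor=> l1 [[|x' a] [z [b [c [-> /=]]]]].
  move=> [<- <-] bx; elim: b bx => [|y b IHb] bx /=; first by constructor.
  apply: IHx; first by apply: bx; left.
  by apply: IHb => z' z'b; apply: bx; right.
move=> [<- lE] bz; apply: IHl; exists a, z, b, c; split=> //.
Qed.

Lemma Acc_Node l : Acc lstep l -> Acc tlt (Node l).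
Proof.
move=> accl; elim: (@Acc_clos_trans _ lstep l accl) => {accl}l _ IH; constructor=> -[l'] l'l.
by apply: IH; exact: (tlt_lstep l'l).
Qed.

Lemma tlt_wf : well_founded tlt.
Proof.
elim/tree_In_ind => l IH; apply: Acc_Node.
elim: l IH => [|x l IHl] IH; last first.
  by apply: Acc_lstep_cons; [apply: IH; left|apply: IHl => y yl; apply: IH; right].
by constructor=> l [[|y a] [x [b [c [_ //]]]]].
Qed.

End WellFounded.

Definition tle s t := s = t \/ tlt s t.

Lemma tlt_tle_trans s t u : tlt s t -> tle t u -> tlt s u.
Proof. by move=> st [<-//|]; exact: tlt_trans. Qed.

Lemma tle_tlt_trans s t u : tle s t -> tlt t u -> tlt s u.
Proof. by move=> [->//|]; exact: tlt_trans. Qed.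

Lemma tlt_cat a b l l' : tlt (Node l) (Node l') ->
  tlt (Node (a ++ l ++ b)) (Node (a ++ l' ++ b)).
Proof.
move Es: (Node l) => s; move Et: (Node l') => t lt.
elim: lt l l' Es Et => {s t} [c x d e dx _|s [l2] u _ IH1 _ IH2] l l'.
  move=> [->] [->].
  by have := tlt_replace (a ++ c) (e ++ b) dx; rewrite -!catA.
by move=> sl ul; apply: tlt_trans (IH1 l l2 sl erefl) (IH2 l2 l' erefl ul).
Qed.

Lemma tlt_nil x l : tlt (Node [::]) (Node (x :: l)).
Proof.
elim: l x => [|y l IH] x; first exact: (@tlt_replace [::] x [::] [::]).
by apply: tlt_trans (IH y) _; exact: (@tlt_replace [::] x [::] (y :: l)).
Qed.

Lemma tlt_catr a l : l <> [::] -> tlt (Node a) (Node (a ++ l)).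
Proof.
by case: l => // x l _; have := tlt_cat a [::] (tlt_nil x l); rewrite !cats0.
Qed.

Lemma tlt_catl a l : l <> [::] -> tlt (Node a) (Node (l ++ a)).
Proof. by case: l => // x l _; exact: (tlt_cat [::] a (tlt_nil x l)). Qed.

Lemma tle_catr a l : tle (Node a) (Node (a ++ l)).
Proof. by case: l => [|x l]; [left; rewrite cats0|right; exact: tlt_catr]. Qed.

Lemma tle_catl a l : tle (Node a) (Node (l ++ a)).
Proof. by case: l => [|x l]; [left|right; exact: tlt_catl]. Qed.

Lemma tlt_single l x : (forall y, List.In y l -> tlt y x) -> tlt (Node l) (Node [:: x]).
Proof. by move=> /(@tlt_replace [::] x l [::]); rewrite cats0. Qed.

Lemma tlt_In x l : List.In x l -> tlt x (Node l).
Proof.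
elim/tree_In_ind: x l => k IH l /(@List.in_split tree)[a [b ->]].
have lt := @tlt_replace a (Node k) k b (fun y yk => IH y yk k yk).
apply: tle_tlt_trans lt; case: (tle_catr k b) => [[<-]|lt]; first exact: tle_catl.
by right; apply: tlt_tle_trans lt (tle_catl _ _).
Qed.

Lemma tlt_cat2 a a' b b' : tlt (Node a) (Node a') -> tle (Node b) (Node b') ->
  tlt (Node (a ++ b)) (Node (a' ++ b')).
Proof.
move=> aa' [[<-]|bb']; first exact: (tlt_cat [::] b aa').
apply: (@tlt_trans _ (Node (a' ++ b))); first exact: (tlt_cat [::] b aa').
by have := tlt_cat a' [::] bb'; rewrite !cats0.
Qed.

Lemma tlt_cat2r a a' b b' : tle (Node a) (Node a') -> tlt (Node b) (Node b') ->
  tlt (Node (a ++ b)) (Node (a' ++ b')).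
Proof.
move=> [[->]|aa'] bb'; last by apply: tlt_cat2 => //; right.
by have := tlt_cat a' [::] bb'; rewrite !cats0.
Qed.

(** * Rational expressions *)

Section HasExpansion.
Variables (D : nzRingType) (Dg : int -> set D).
Hypothesis skD : skew_field D.
Hypothesis gD : skew_grading Dg.
Variable m : nat.
Local Notation B := 'M[D]_m.+1.
Implicit Types (x y : B) (P Q R : set B).

Definition good x := x = 0 \/ is_unit x.

(** [P] will bound the complexity of the coefficients. *)
Definition has_expansion x P := exists k e, expansion Dg k x e /\ forall i, P (e i).

Lemma has_expansion_deg k x P : mxdeg Dg k x -> P x -> P 0 -> has_expansion x P.
Proof.
move=> hx Px P0; exists k, (fun i => if i is 0%N then x else 0); split.
  exact: expansion_deg.
by case.
Qed.

Lemma has_expansion_align x y P Q : P 0 -> Q 0 ->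
  has_expansion x P -> has_expansion y Q ->
  exists k e f, [/\ expansion Dg k x e, expansion Dg k y f,
    forall i, P (e i) & forall i, Q (f i)].
Proof.
move=> P0 Q0 [k [e [hx Pe]]] [l [f [hy Qf]]].
pose n := Order.min k l.
exists n, (fun i => if (i < `|k - n|)%N then 0 else e (i - `|k - n|)%N),
  (fun i => if (i < `|l - n|)%N then 0 else f (i - `|l - n|)%N).
have nk : n <= k by rewrite /n ge_min lexx.
have nl : n <= l by rewrite /n ge_min lexx orbT.
split; last 2 first.
- by move=> i; case: ifP.
- by move=> i; case: ifP.
- by have := expansion_shift gD `|k - n|%N hx; congr expansion; lia.
- by have := expansion_shift gD `|l - n|%N hy; congr expansion; lia.
Qed.

Lemma has_expansionD x y P Q R : P 0 -> Q 0 ->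
  (forall u v, P u -> Q v -> R (u + v)) ->
  has_expansion x P -> has_expansion y Q -> has_expansion (x + y) R.
Proof.
move=> P0 Q0 PQR hx hy.
have [k [e [f [ex fy Pe Qf]]]] := has_expansion_align P0 Q0 hx hy.
exists k, (fun i => e i + f i); split; first exact: expansionD.
by move=> i; exact: PQR.
Qed.

Lemma has_expansionM x y P Q R : R 0 -> (forall u v, R u -> R v -> R (u + v)) ->
  (forall u v, P u -> Q v -> R (u * v)) ->
  has_expansion x P -> has_expansion y Q -> has_expansion (x * y) R.
Proof.
move=> R0 RD PQR [k [e [hx Pe]]] [l [f [hy Qf]]].
exists (k + l), (fun i => \sum_(j < i.+1) e j * f (i - j)%N).
split; first exact: expansionM.
by move=> i; apply: (big_ind R) => // j _; exact: PQR.
Qed.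

Lemma has_expansion_deg2 k l x y P : k <> l -> mxdeg Dg k x -> mxdeg Dg l y ->
  P 0 -> P x -> P y -> has_expansion (x + y) P.
Proof.
wlog: k l x y / k < l => [H kl hx hy P0 Px Py|kl _ hx hy P0 Px Py].
  case: (ltgtP k l) => // lt; first exact: (H k l).
  by rewrite addrC; apply: (H l k) => //; lia.
have := expansion_shift gD `|l - k|%N (expansion_deg gD hy).
have -> : l - `|l - k|%N%:Z = k by lia.
move=> /(expansionD skD gD (expansion_deg gD hx)) hxy.
eexists; eexists; split; first exact: hxy.
case=> [|i] /=; first by rewrite absz_gt0 subr_eq0 gt_eqF // addr0.
by rewrite add0r; case: ifP => // _; case: (i.+1 - _)%N.
Qed.

(** The first nonzero coefficient decides. *)
Lemma has_expansion_good x : has_expansion x good -> good x.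
Proof.
move=> [k [e [hx ge]]].
case: (pselect (exists j, e j != 0)) => [ex|no]; last first.
  left; apply: (expansion0 skD gD hx) => i; apply/eqP/negPn/negP => ei.
  by apply: no; exists i.
case: (ex_minnP ex) => j ej jmin; right.
have e0 i : (i < j)%N -> e i = 0.
  by move=> ij; apply/eqP/negPn/negP => /jmin; rewrite leqNgt ij.
apply: (expansion_unit skD gD (expansion_drop hx e0)); rewrite addn0.
by case: (ge j) => // ej0; rewrite ej0 eqxx in ej.
Qed.

(** The inverse of a series is computed from its coefficients and the inverse of
    the first nonzero one by ring operations. *)
Lemma has_expansionV x y P R : x * y = 1 -> y * x = 1 ->
  (forall u, P u -> good u) -> (forall u, P u -> R u) ->
  (forall u v, P u -> u * v = 1 -> v * u = 1 -> R v) ->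
  R 0 -> R (- 1) -> (forall u v, R u -> R v -> R (u + v)) ->
  (forall u v, R u -> R v -> R (u * v)) ->
  has_expansion x P -> has_expansion y R.
Proof.
move=> xy yx Pg PR RV R0 RN1 RD RM [k [e [hx Pe]]].
have xn0 : x <> 0 by apply: is_unit_neq0; exists y.
have [j ej jmin] : exists2 j, e j != 0 & forall i, (i < j)%N -> e i = 0.
  case: (pselect (exists j, e j != 0)) => [ex|no]; last first.
    case: xn0; apply: (expansion0 skD gD hx) => i; apply/eqP/negPn/negP => ei.
    by apply: no; exists i.
  case: (ex_minnP ex) => j ej jmin; exists j => // i ij.
  by apply/eqP/negPn/negP => /jmin; rewrite leqNgt ij.
have hx' := expansion_drop hx jmin.
have [c [ec ce]] : is_unit (e j) by case: (Pg _ (Pe j)) => // E; rewrite E eqxx in ej.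
have [|f [f0 fS ef]] := @inverse_series _ c (fun i => e (j + i)%N).
  by rewrite addn0.
have Rc : R c by exact: RV ec ce.
have hc : mxdeg Dg (- (k + j%:Z)) c by apply: (mxdegV skD gD _ ec ce); exact: hx.1.
have find (A : nat -> set B) : A 0%N c ->
    (forall n, (forall i, (i <= n)%N -> A i (f i)) -> A n.+1 (f n.+1)) ->
    forall i, A i (f i).
  by move=> A0 AS; elim/ltn_ind => -[|n] IH; [rewrite f0|apply: AS].
exists (- (k + j%:Z)), f; split; last first.
  apply: (find (fun=> R)) => // n IH; rewrite fS.
  rewrite -mulN1r -mulrA; apply: (RM) => //; apply: (RM) => //.
  apply: (big_ind R) => // i _; apply: (RM); first exact: PR.
  by apply: IH; exact: leq_subr.
apply: (expansionV skD gD hx' xy yx _ ef).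
apply: (find (fun i => mxdeg Dg (- (k + j%:Z) + i%:Z))) => [|n IH].
  by rewrite addPosz0.
rewrite fS; apply: (@mxdegM _ _ gD _ (- (k + j%:Z)) n.+1%:Z) => //.
  exact: mxdegN.
apply: mxdeg_sum => // i _; have := ltn_ord i; rewrite ltnS => ilen.
apply: (@mxdegM _ _ gD _ (k + j%:Z + i.+1%:Z) (- (k + j%:Z) + (n - i)%N%:Z)).
- by lia.
- exact: hx'.1.
by apply: IH; exact: leq_subr.
Qed.

End HasExpansion.

Section Expressions.
Variables (D : nzRingType) (m : nat) (G : groupType) (F : fieldType).
Hypothesis skD : skew_field D.
Local Notation B := 'M[D]_m.+1.
Variables (Phi : G -> B) (kap : {rmorphism F -> B}).
Hypothesis Phi1 : Phi 1%g = 1.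
Hypothesis PhiM : forall g h, Phi (g * h)%g = Phi g * Phi h.
Hypothesis PhiC : forall c g, kap c * Phi g = Phi g * kap c.

(** The values of rational expressions, with their complexities: monomials for
    [true], sums for [false]. Constants and group elements do not count. The
    summands of [expr_add] are nonempty, so that each of them is strictly simpler
    than the sum. *)
Inductive expr : bool -> seq tree -> B -> Prop :=
| expr_unit c g : expr true [::] (kap c * Phi g)
| expr_inv l x y : expr false l x -> x * y = 1 -> y * x = 1 ->
    expr true [:: Node l] y
| expr_mul l l' x y : expr true l x -> expr true l' y -> expr true (l ++ l') (x * y)
| expr_zero : expr false [::] 0
| expr_mono l x : expr true l x -> expr false [:: Node l] x
| expr_add l l' x y : l <> [::] -> l' <> [::] -> expr false l x -> expr false l' y ->
    expr false (l ++ l') (x + y).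

Lemma expr_nil x : expr false [::] x -> x = 0.
Proof.
move Eb: false => b; move El: [::] => l h.
case: h Eb El => // l1 l2 ? ? n1 _ _ _ _ /esym/(congr1 size)/eqP.
by rewrite size_cat addn_eq0 => /andP[/nilP].
Qed.

Lemma exprD l l' x y : expr false l x -> expr false l' y ->
  expr false (l ++ l') (x + y).
Proof.
case: l => [/expr_nil ->|a l hx]; first by rewrite add0r.
case: l' => [/expr_nil ->|b l' hy]; first by rewrite cats0 addr0.
exact: expr_add.
Qed.

Lemma PhiV g : Phi g * Phi g^-1%g = 1.
Proof. by rewrite -PhiM mulgV. Qed.

Lemma PhiVl g : Phi g^-1%g * Phi g = 1.
Proof. by rewrite -PhiM mulVg. Qed.

Lemma expr_Phi g : expr true [::] (Phi g).
Proof. by have := expr_unit 1 g; rewrite rmorph1 mul1r. Qed.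

Lemma expr_shift b l x g h : expr b l x -> expr b l (Phi g * x * Phi h).
Proof.
have mono l' y : expr true l' y -> expr true l' (Phi g * y * Phi h).
  move=> hy; have := expr_mul (expr_mul (expr_Phi g) hy) (expr_Phi h).
  by rewrite cats0.
elim=> {b l x} [c k|l x y hx _ xy yx|l l' x y hx _ hy _||l x hx _|l l' x y l0 l0' _ hx _ hy].
- exact/mono/expr_unit.
- exact/mono/(expr_inv hx).
- exact/mono/expr_mul.
- by rewrite mulr0 mul0r; exact: expr_zero.
- exact/expr_mono/mono.
- by rewrite mulrDr mulrDl; exact: expr_add.
Qed.

(** Sums of monomials of bounded complexity. When the bound is stable under
    concatenation, they form a ring, whatever the number of summands. *)
Definition in_span (P : tree -> Prop) x :=
  exists2 l, expr false l x & forall w, List.In w l -> P w.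

Lemma in_span0 P : in_span P 0.
Proof. by exists [::] => //; exact: expr_zero. Qed.

Lemma in_spanD P x y : in_span P x -> in_span P y -> in_span P (x + y).
Proof.
move=> [l hx Pl] [l' hy Pl']; exists (l ++ l'); first exact: exprD.
by move=> w /(@List.in_app_or tree)[/Pl|/Pl'].
Qed.

Lemma in_span_mono (P : tree -> Prop) l x : expr true l x -> P (Node l) -> in_span P x.
Proof. by move=> hx Pl; exists [:: Node l] => [|w [<-|]] //; exact: expr_mono. Qed.

Lemma in_span_ind (P : tree -> Prop) (Q : B -> Prop) : Q 0 ->
  (forall l x, expr true l x -> P (Node l) -> Q x) ->
  (forall x y, Q x -> Q y -> Q (x + y)) -> forall x, in_span P x -> Q x.
Proof.
move=> Q0 Qm QD x [l + Pl]; move Eb: false => b h.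
elim: h Eb Pl => {b l x} // [l x hx _ _ Pl|l l' x y _ _ _ IHx _ IHy _ Pl].
  by apply: Qm hx _; apply: Pl; left.
by apply: QD; [apply: IHx|apply: IHy] => // w wl; apply: Pl; apply: List.in_or_app;
  [left|right].
Qed.

Lemma in_spanM (P Q R : tree -> Prop) x y :
  (forall a b, P (Node a) -> Q (Node b) -> R (Node (a ++ b))) ->
  in_span P x -> in_span Q y -> in_span R (x * y).
Proof.
move=> PQR hx hy; apply: (in_span_ind (Q := fun x => in_span R (x * y)) _ _ _ hx) => {x hx}.
- by rewrite mul0r; exact: in_span0.
- move=> l x hx Pl; apply: (in_span_ind (Q := fun y => in_span R (x * y)) _ _ _ hy) => {y hy}.
  + by rewrite mulr0; exact: in_span0.
  + by move=> l' y hy Ql; apply: in_span_mono (expr_mul hx hy) _; exact: PQR.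
  + by move=> y z hy hz; rewrite mulrDr; exact: in_spanD.
- by move=> x z hx hz; rewrite mulrDl; exact: in_spanD.
Qed.

(** The coefficients allowed in the expansion of an element of complexity [l]. For
    a monomial these are sums of any number of simpler monomials, for a sum they
    are simpler sums. *)
Definition coef_ok (strict b : bool) (l : seq tree) : set B :=
  let R := if strict then tlt else tle in
  if b then in_span (R^~ (Node l))
  else fun x => exists2 l', expr false l' x & R (Node l') (Node l).

Lemma coef_ok0 strict b l : l <> [::] -> coef_ok strict b l 0.
Proof.
move=> l0; rewrite /coef_ok; case: b; first exact: in_span0.
exists [::]; first exact: expr_zero.
by case: l l0 => // x l _; case: strict; [|right]; exact: tlt_nil.
Qed.

Lemma coef_ok_self b l x : expr b l x -> coef_ok false b l x.
Proof.
rewrite /coef_ok; case: b => hx; first by apply: (in_span_mono hx); left.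
by exists l => //; left.
Qed.

Lemma coef_ok_weak strict b l x : coef_ok strict b l x -> coef_ok false b l x.
Proof.
case: strict => //; rewrite /coef_ok; case: b => [[l' hx h]|[l' hx h]]; exists l' => //.
  by move=> w /h; right.
by right.
Qed.

Record graded_by (H : set G) (phi : G -> int) (Dg : int -> set D) : Prop := {
  gb_sub : subgroup H;
  gb_hom : forall g h, H g -> H h -> phi (g * h)%g = phi g + phi h;
  gb_grd : skew_grading Dg;
  gb_Phi : forall g, H g -> mxdeg Dg (phi g) (Phi g);
  gb_kap : forall c, mxdeg Dg 0 (kap c)
}.

(** The finite set [s] decides how [x] looks from each grading: homogeneous of
    degree zero if [phi] kills [s], and otherwise with an expansion into strictly
    simpler coefficients. *)
Definition controlled b l (s : seq G) x := forall H phi Dg, graded_by H phi Dg ->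
  (forall g, g \in s -> H g) ->
  ((forall g, g \in s -> phi g = 0) -> mxdeg Dg 0 x) /\
  ((exists2 g, g \in s & phi g <> 0) -> has_expansion Dg x (coef_ok true b l)).

Definition conjs (v : G) (s : seq G) := [seq (v * g * v^-1)%g | g <- s].
Definition conjx (v : G) (x : B) := Phi v * x * Phi v^-1%g.

Lemma conjsM v w s : conjs v (conjs w s) = conjs (v * w)%g s.
Proof.
rewrite /conjs -map_comp; apply: eq_map => g /=.
by rewrite invgM !mulgA.
Qed.

Lemma conjxM v x y : conjx v (x * y) = conjx v x * conjx v y.
Proof. by rewrite /conjx !mulrA -(mulrA _ (Phi v^-1%g)) PhiVl mulr1. Qed.

Lemma conjxD v x y : conjx v (x + y) = conjx v x + conjx v y.
Proof. by rewrite /conjx mulrDr mulrDl. Qed.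

Lemma conjx_kap v c : conjx v (kap c) = kap c.
Proof. by rewrite /conjx -PhiC -mulrA PhiV mulr1. Qed.

Lemma conjx_Phi v g : conjx v (Phi g) = Phi (v * g * v^-1)%g.
Proof. by rewrite /conjx !PhiM. Qed.

Lemma conjx_conjx v w x : conjx v (conjx w x) = conjx (v * w)%g x.
Proof. by rewrite /conjx invgM !PhiM !mulrA. Qed.

Lemma conj_eq1 (v g : G) : (v * g * v^-1)%g = 1%g -> g = 1%g.
Proof.
by move=> /(congr1 (fun h => v^-1 * h * v)%g); rewrite mulg1 mulVg !mulgA mulVg mul1g mulgVK.
Qed.

Lemma controlled_weak b l s x H phi Dg : expr b l x -> l <> [::] \/ b ->
  controlled b l s x -> graded_by H phi Dg -> (forall g, g \in s -> H g) ->
  has_expansion Dg x (coef_ok false b l) /\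
  (has_expansion Dg x (coef_ok true b l) \/ forall g, g \in s -> phi g = 0).
Proof.
move=> hx l0 cs gr sH; have [c0 cn] := cs _ _ _ gr sH.
case: (pselect (exists2 g, g \in s & phi g <> 0)) => [/cn[k [e [ex ce]]]|no].
  split; last by left; exists k, e.
  by exists k, e; split=> // i; exact: coef_ok_weak (ce i).
have s0 g : g \in s -> phi g = 0.
  by move=> gs; apply: contrapT => pg; apply: no; exists g.
split; last by right.
apply: (has_expansion_deg (gb_grd gr) (c0 s0)); first exact: coef_ok_self.
by case: l0 => [/coef_ok0//|->]; exact: in_span0.
Qed.

(** By induction on the expression. Group elements are collected on the right, in
    the factor [u]; this conjugates the other factors, whence the quantification
    over the conjugates by [v]. A product of controlled elements is controlled by
    the union of the two sets. In a sum, factoring out [u] leaves the second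
    summand with a factor [w * u^-1], which is added to the set: if only this
    element has nonzero degree, then the two summands lie in different degrees,
    and each of them is strictly simpler than the sum. The expansion of an inverse
    involves the inverse of the first nonzero coefficient, which exists because
    this coefficient is a simpler sum; this is the use of the hypothesis. *)
Lemma expr_controlled b l x : expr b l x ->
  (forall l' z, tlt (Node l') (Node l) -> expr false l' z -> good z) ->
  exists u s x', [/\ x = x' * Phi u,
    forall v, controlled b l (conjs v s) (conjx v x') &
    (forall g, g \in s -> g = 1%g) -> exists c, x' = kap c].
Proof.
elim=> {b l x}.
- move=> c g _; exists g, [::], (kap c); split=> // [v H phi Dg gr _|_]; last by exists c.
  split=> [_|[]//]; rewrite conjx_kap; exact: gb_kap gr c.
- move=> l x y hx IH xy yx glow.
  have [|u [s [x' [xE cs tr]]]] := IH.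
    move=> l' z l'l; apply: glow; apply: tlt_trans l'l _.
    by apply: tlt_In; left.
  exists u^-1%g, (conjs u^-1%g s), (y * Phi u); split.
  + by rewrite -mulrA PhiV mulr1.
  + move=> v H phi Dg gr; rewrite conjsM => sH.
    have [c0 cn] := cs _ _ _ _ gr sH.
    set z := conjx _ x' in c0 cn; set w := conjx _ _.
    have zw : z * w = 1.
      rewrite /z /w -conjx_conjx -conjxM {1}/conjx.
      rewrite [X in _ * X * _](_ : _ = 1) ?mulr1 ?PhiV //.
      by rewrite /conjx invgK -[_ * x' * _]mulrA -xE -mulrA (mulrA x) xy mul1r PhiVl.
    have wz : w * z = 1.
      by have [t [zt tz]] := mx_right_unit skD zw; rewrite -(inv_unique tz zw).
    split=> [/c0 z0|/cn hz].
      by rewrite -oppr0; apply: (mxdegV skD (gb_grd gr) z0 zw wz).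
    (* monomials that invert only sums simpler than [l]: their span is a ring that
       contains the coefficients of [z] and the inverses of the nonzero ones *)
    pose P (t : tree) := exists2 a, t = Node a & forall q, List.In q a -> tlt q (Node l).
    have Pok q : in_span P q -> coef_ok true true [:: Node l] q.
      move=> [L hq PL]; exists L => // t /PL[a -> al]; exact: tlt_single.
    have Plow l' z' : expr false l' z' -> tlt (Node l') (Node l) -> in_span P z'.
      move=> hz' lt; exists l' => // -[a] al'; exists a => // q qa.
      apply: tlt_trans (tlt_In qa) _; apply: tlt_trans lt; exact: tlt_In.
    suff [k [e [ew Pe]]] : has_expansion Dg w (in_span P).
      by exists k, e; split=> // i; exact: Pok.
    apply: (has_expansionV skD (gb_grd gr) zw wz _ _ _ _ _ _ _ hz).
    * move=> q [l' hq lt]; apply: glow hq; apply: tlt_trans lt _.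
      by apply: tlt_In; left.
    * by move=> q [l' hq lt]; exact: Plow hq lt.
    * move=> q r [l' hq lt] qr rq; apply: (in_span_mono (expr_inv hq qr rq)).
      by exists [:: Node l'] => // t [<-|].
    * exact: in_span0.
    * have := expr_unit (- 1) 1%g; rewrite Phi1 mulr1 rmorphN1 => h.
      by apply: (in_span_mono h); exists [::].
    * exact: in_spanD.
    * move=> q r; apply: in_spanM => a b [_ [<-] ha] [_ [<-] hb].
      by exists (a ++ b) => // t /(@List.in_app_or tree)[/ha|/hb].
  + move=> s1; have [|c x'E] := tr.
      move=> g gs; exact: conj_eq1 (s1 _ (map_f _ gs)).
    have xn0 : x <> 0 by apply: is_unit_neq0; exists y.
    have c0 : c != 0.
      by apply/eqP => c0; apply: xn0; rewrite xE x'E c0 rmorph0 mul0r.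
    exists c^-1; apply: (@inv_unique _ (kap c)).
      by rewrite -mulrA -PhiC -x'E -xE.
    by rewrite -rmorphM mulfV // rmorph1.
- move=> l l' x y hx IHx hy IHy glow.
  have [|u [s [x' [xE csx trx]]]] := IHx.
    move=> l1 z l1l; apply: glow; exact: tlt_tle_trans l1l (tle_catr _ _).
  have [|w [s' [y' [yE csy try_]]]] := IHy.
    move=> l1 z l1l; apply: glow; exact: tlt_tle_trans l1l (tle_catl _ _).
  have x'_expr : expr true l x'.
    by have := expr_shift 1%g u^-1%g hx; rewrite Phi1 mul1r xE -mulrA PhiV mulr1.
  have y'_expr : expr true l' y'.
    by have := expr_shift 1%g w^-1%g hy; rewrite Phi1 mul1r yE -mulrA PhiV mulr1.
  exists (u * w)%g, (s ++ conjs u s'), (x' * conjx u y'); split.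
  + by rewrite xE yE PhiM /conjx !mulrA -(mulrA _ (Phi u^-1%g) (Phi u)) PhiVl mulr1.
  + move=> v H phi Dg gr; rewrite conjxM conjx_conjx /conjs map_cat -!/(conjs _ _) conjsM => sH.
    have sH1 g : g \in conjs v s -> H g by move=> gs; apply: sH; rewrite mem_cat gs.
    have sH2 g : g \in conjs (v * u)%g s' -> H g.
      by move=> gs; apply: sH; rewrite mem_cat gs orbT.
    split=> [s0|[g gs gn]].
      apply: (mxdegM (gb_grd gr) (addr0 0)).
        by apply: (csx v _ _ _ gr sH1).1 => g gs; apply: s0; rewrite mem_cat gs.
      by apply: (csy (v * u)%g _ _ _ gr sH2).1 => g gs; apply: s0; rewrite mem_cat gs orbT.
    have [wx sx] := controlled_weak (expr_shift v v^-1%g x'_expr) (or_intror isT) (csx v) gr sH1.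
    have [wy sy] := controlled_weak (expr_shift (v * u)%g (v * u)^-1%g y'_expr)
      (or_intror isT) (csy (v * u)%g) gr sH2.
    have span strict1 strict2 : strict1 || strict2 ->
        has_expansion Dg (conjx v x') (coef_ok strict1 true l) ->
        has_expansion Dg (conjx (v * u)%g y') (coef_ok strict2 true l') ->
        has_expansion Dg (conjx v x' * conjx (v * u)%g y') (coef_ok true true (l ++ l')).
      move=> st; apply: (has_expansionM skD (gb_grd gr)).
      * exact: in_span0.
      * exact: in_spanD.
      move=> a b; apply: in_spanM => {}a {}b; case: strict1 st; case: strict2 => // _ la lb.
      * by apply: tlt_cat2 => //; right.
      * exact: tlt_cat2.
      * exact: tlt_cat2r.
    case: sx => [sx|sx0]; first exact: (span true false).
    case: sy => [sy|sy0]; first exact: (span false true).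
    by case: gn; move: gs; rewrite mem_cat => /orP[/sx0|/sy0].
  + move=> s1; have [|c x'E] := trx.
      by move=> g gs; apply: s1; rewrite mem_cat gs.
    have [|c' y'E] := try_.
      move=> g gs; apply: (@conj_eq1 u); apply: s1; rewrite mem_cat.
      by rewrite (map_f (fun g => (u * g * u^-1)%g) gs) orbT.
    by exists (c * c'); rewrite x'E y'E conjx_kap rmorphM.
- move=> _; exists 1%g, [::], 0; split.
  + by rewrite mul0r.
  + move=> v H phi Dg gr _; split=> [_|[]//].
    by rewrite /conjx mulr0 mul0r; exact: (mxdeg0 (gb_grd gr)).
  + by exists 0; rewrite rmorph0.
- move=> l x hx IH glow.
  have [|u [s [x' [xE cs tr]]]] := IH.
    by move=> l' z l'l; apply: glow; apply: tlt_trans l'l _; apply: tlt_In; left.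
  exists u, s, x'; split=> // v H phi Dg gr sH.
  have [c0 cn] := cs v _ _ _ gr sH; split=> // /cn[k [e [ex ce]]].
  exists k, e; split=> // i; have [l1 h1 ll1] := ce i; exists l1 => //.
  exact: tlt_single.
- move=> l l' x y l0 l0' hx IHx hy IHy glow.
  have [|u [s [x' [xE csx trx]]]] := IHx.
    move=> l1 z l1l; apply: glow; exact: tlt_tle_trans l1l (tle_catr _ _).
  have [|w [s' [y' [yE csy try_]]]] := IHy.
    move=> l1 z l1l; apply: glow; exact: tlt_tle_trans l1l (tle_catl _ _).
  have x'_expr : expr false l x'.
    by have := expr_shift 1%g u^-1%g hx; rewrite Phi1 mul1r xE -mulrA PhiV mulr1.
  have y'_expr : expr false l' y'.
    by have := expr_shift 1%g w^-1%g hy; rewrite Phi1 mul1r yE -mulrA PhiV mulr1.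
  exists u, (s ++ s' ++ [:: (w * u^-1)%g]), (x' + y' * Phi (w * u^-1)%g); split.
  + by rewrite xE yE PhiM mulrDl -!mulrA PhiVl mulr1.
  + move=> v H phi Dg gr; rewrite conjxD conjxM conjx_Phi /conjs !map_cat /= -!/(conjs _ _).
    set d := (v * (w * u^-1) * v^-1)%g => sH.
    have sH1 g : g \in conjs v s -> H g by move=> gs; apply: sH; rewrite mem_cat gs.
    have sH2 g : g \in conjs v s' -> H g.
      by move=> gs; apply: sH; rewrite !mem_cat gs orbT.
    have Hd : H d by apply: sH; rewrite !mem_cat mem_head !orbT.
    have dd := gb_Phi gr Hd.
    have [wx sx] := controlled_weak (expr_shift v v^-1%g x'_expr) (or_introl l0) (csx v) gr sH1.
    have [wy sy] := controlled_weak (expr_shift v v^-1%g y'_expr) (or_introl l0') (csy v) gr sH2.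
    have shift strict : has_expansion Dg (conjx v y') (coef_ok strict false l') ->
        has_expansion Dg (conjx v y' * Phi d) (coef_ok strict false l').
      move=> [k [e [ey ce]]]; exists (k + phi d), (fun i => e i * Phi d).
      split=> [|i]; first exact: (expansion_mulr_deg skD (gb_grd gr)).
      have [l1 h1 l1l'] := ce i; exists l1 => //.
      by have := expr_shift 1%g d h1; rewrite Phi1 mul1r.
    split=> [s0|[g gs gn]].
      have d0 : phi d = 0 by apply: s0; rewrite !mem_cat mem_head !orbT.
      apply: (mxdegD (gb_grd gr)).
        by apply: (csx v _ _ _ gr sH1).1 => g gs; apply: s0; rewrite mem_cat gs.
      apply: (mxdegM (gb_grd gr) (addr0 0)); last by rewrite -d0.
      by apply: (csy v _ _ _ gr sH2).1 => g gs; apply: s0; rewrite !mem_cat gs orbT.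
    have span strict1 strict2 : strict1 || strict2 ->
        has_expansion Dg (conjx v x') (coef_ok strict1 false l) ->
        has_expansion Dg (conjx v y') (coef_ok strict2 false l') ->
        has_expansion Dg (conjx v x' + conjx v y' * Phi d) (coef_ok true false (l ++ l')).
      move=> st hx' /shift hy'; apply: (has_expansionD skD (gb_grd gr) _ _ _ hx' hy').
      * exact: coef_ok0.
      * exact: coef_ok0.
      move=> a b [la ha lla] [lb hb llb]; exists (la ++ lb); first exact: exprD.
      case: strict1 st lla {hx'}; case: strict2 llb {hy'} => // llb _ lla.
      * by apply: tlt_cat2 => //; right.
      * exact: tlt_cat2.
      * exact: tlt_cat2r.
    case: sx => [sx|sx0]; first exact: (span true false).
    case: sy => [sy|sy0]; first exact: (span false true).
    have dn0 : 0 <> phi d.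
      move=> d0; case: gn; move: gs; rewrite !mem_cat => /or3P[/sx0|/sy0|] //.
      by rewrite inE => /eqP ->.
    apply: (has_expansion_deg2 skD (gb_grd gr) dn0).
    * exact: (csx v _ _ _ gr sH1).1.
    * by apply: (mxdegM (gb_grd gr) (add0r _)) => //; exact: (csy v _ _ _ gr sH2).1.
    * by apply: (@coef_ok0 true false); case: (l) l0.
    * by exists l; [exact: expr_shift|exact: tlt_catr].
    * exists l'; last exact: tlt_catl.
      have := expr_shift 1%g d (expr_shift v v^-1%g y'_expr).
      by rewrite Phi1 mul1r.
  + move=> s1; have [|c x'E] := trx.
      by move=> g gs; apply: s1; rewrite mem_cat gs.
    have [|c' y'E] := try_.
      by move=> g gs; apply: s1; rewrite !mem_cat gs orbT.
    exists (c + c'); rewrite x'E y'E (s1 (w * u^-1)%g) ?Phi1 ?mulr1 ?rmorphD //.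
    by rewrite !mem_cat mem_head !orbT.
Qed.

Hypothesis hughes : forall (s : seq G) (phi : G -> int),
  (forall x y, generated s x -> generated s y -> phi (x * y)%g = phi x + phi y) ->
  (forall k : int, exists2 x, generated s x & phi x = k) ->
  exists Dg, graded_by (generated s) phi Dg.
Hypothesis liG : locally_indicable G.

(** If the controlling set [s] is nontrivial, a homomorphism from the subgroup
    that it generates onto the integers cannot kill [s], so that the expansion has
    strictly simpler coefficients. *)
Theorem expr_good l x : expr false l x -> good x.
Proof.
move: x; have [t] : exists t, t = Node l by eexists.
elim/(well_founded_ind tlt_wf): t l => t IH l tl x hx; rewrite {}tl in IH.
have [|u [s [x' [xE cs tr]]]] := expr_controlled hx.
  by move=> l' z l'l; apply: (IH (Node l')).
have gx : good x' -> good x.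
  rewrite xE => -[->|x'U]; first by left; rewrite mul0r.
  by right; apply: is_unitM => //; exists (Phi u^-1%g); rewrite PhiV PhiVl.
apply: gx; case: (pselect (forall g, g \in s -> g = 1%g)) => [/tr[c ->]|s1].
  have [->|c0] := eqVneq c 0; first by left; rewrite rmorph0.
  by right; exists (kap c^-1); rewrite -!rmorphM mulfV // mulVf // rmorph1.
have sgen g : g \in s -> generated s g by move=> gs S [_]; apply.
have [g gs g1] : exists2 g, g \in s & g <> 1%g.
  by apply: contrapT => no; apply: s1 => g gs; apply: contrapT => g1; apply: no; exists g.
have [phi [phiM phiS]] := liG (ex_intro2 _ _ g (sgen g gs) g1).
have [Dg gr] := hughes phiM phiS.
have := cs 1%g; rewrite /conjx Phi1 mul1r invg1 Phi1 mulr1.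
have -> : conjs 1 s = s.
  by rewrite /conjs -[RHS]map_id; apply: eq_map => h; rewrite mul1g invg1 mulg1.
move=> /(_ _ _ _ gr sgen)[_ cn].
case: (pselect (exists2 g, g \in s & phi g <> 0)) => [/cn[k [e [ex ce]]]|no].
  apply: (has_expansion_good skD (gb_grd gr)); exists k, e; split=> // i.
  by have [l' h' lt] := ce i; exact: IH lt _ erefl _ h'.
have [y ys y1] := phiS 1.
suff : phi y = 0 by rewrite y1.
have phi11 : phi 1%g = 0.
  have [g1' _] := gb_sub gr.
  by have := phiM _ _ g1' g1'; rewrite mulg1 => /eqP; rewrite -subr_eq subrr eq_sym => /eqP.
have [] : (generated s `&` [set h | phi h = 0])%classic y; last by [].
apply: ys; split; last first.
  move=> h /= hs; split; first exact: sgen.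
  by apply: contrapT => h0; apply: no; exists h.
have [g1' gV] := gb_sub gr.
have gI h : generated s h -> generated s h^-1%g by move=> hg; rewrite -[h^-1%g]mul1g; exact: gV.
split=> [|a b [ga /= a0] [gb b0]]; first by split.
split; first exact: gV.
have := phiM _ _ gb (gI _ gb); rewrite mulgV b0 phi11 add0r => bV.
by rewrite /= phiM ?a0 -?bV ?addr0 //; exact: gI.
Qed.

End Expressions.

(** * Affiliated operators *)

Section L2Norm.
Variables (R : realType) (G : groupType).
Local Notation H := (l2 R G).
Local Notation nc := (@Normc.normc R).
Implicit Types f h : H.

Lemma l2_ext f h : (forall x, f x = h x) -> f = h.
Proof. by move=> fh; apply/val_inj/funext. Qed.

Lemma sqsum_ge0 (u : G -> R[i]) : (0 <= sqsum u)%E.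
Proof. by apply: esum_ge0 => g _; rewrite lee_fin sqr_ge0. Qed.

Lemma l2_sqsum f : (fine (sqsum f))%:E = sqsum f.
Proof.
apply: fineK; rewrite ge0_fin_numE ?sqsum_ge0 //.
by have := valP f; rewrite unfold_in.
Qed.

Lemma sqr_l2norm f : (l2norm f ^+ 2)%:E = sqsum f.
Proof. by rewrite sqr_sqrtr ?l2_sqsum // fine_ge0 ?sqsum_ge0. Qed.

Lemma l2norm_ge0 f : 0 <= l2norm f.
Proof. exact: sqrtr_ge0. Qed.

Lemma l2norm_eq0 f : l2norm f = 0 -> f = 0.
Proof.
move=> f0; apply: l2_ext => x; have fx : ((nc (f x) ^+ 2)%:E <= sqsum f)%E.
  apply: esum_ge; exists [set x]%classic; last by rewrite fsbig_set1.
  by split=> //; exact: finite_set1.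
move: fx; rewrite -sqr_l2norm f0 expr0n /= lee_fin => fx.
apply/Normc.eq0_normc/eqP; rewrite -sqrf_eq0; apply/eqP/le_anti.
by rewrite fx sqr_ge0.
Qed.

Lemma eq_l2norm f h : (forall x, nc (f x) = nc (h x)) -> l2norm f = l2norm h.
Proof.
move=> fh; rewrite /l2norm; congr (Num.sqrt (fine _)); apply: eq_esum => g _.
by rewrite fh.
Qed.

Lemma l2norm0 : l2norm (0 : H) = 0.
Proof.
rewrite /l2norm /sqsum esum1 ?sqrtr0 // => g _.
by rewrite [Normc.normc _]Normc.normc0 expr0n.
Qed.

Lemma l2normN f : l2norm (- f) = l2norm f.
Proof. by apply: eq_l2norm => x; rewrite -[RHS]normcN. Qed.

(** The factor 2 is harmless for limits and spares the Cauchy-Schwarz inequality. *)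
Lemma l2normD f h : l2norm (f + h) <= 2 * (l2norm f + l2norm h).
Proof.
have f0 := l2norm_ge0 f; have h0 := l2norm_ge0 h.
rewrite -ler_sqr ?nnegrE ?l2norm_ge0 //; last by rewrite mulr_ge0 ?addr_ge0.
apply: (@le_trans _ _ (2 * l2norm f ^+ 2 + 2 * l2norm h ^+ 2)); last first.
  rewrite -subr_ge0 (_ : _ - _ =
    2 * (l2norm f ^+ 2 + l2norm h ^+ 2) + 8 * (l2norm f * l2norm h)); last by ring.
  by rewrite addr_ge0 // mulr_ge0 // ?addr_ge0 ?sqr_ge0 ?mulr_ge0.
have E (u : H) : ((2 * l2norm u ^+ 2)%:E = 2%:E * sqsum u)%E.
  by rewrite -sqr_l2norm -EFinM.
rewrite -lee_fin EFinD !E sqr_l2norm {E}.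
have dbl (u : G -> R[i]) : (2%:E * sqsum u = \esum_(g in [set: G]) (2 * nc (u g) ^+ 2)%:E)%E.
  rewrite (_ : 2 = 1 + 1 :> R) // EFinD ge0_muleDl ?lee_fin // !mul1e -esumD.
  - by apply: eq_esum => g _; rewrite -EFinD mulrDl !mul1r.
  - by move=> g _; rewrite lee_fin sqr_ge0.
  - by move=> g _; rewrite lee_fin sqr_ge0.
rewrite !dbl -esumD; last 2 first.
- by move=> g _; rewrite lee_fin mulr_ge0 ?sqr_ge0.
- by move=> g _; rewrite lee_fin mulr_ge0 ?sqr_ge0.
apply: le_esum => g _; rewrite -EFinD lee_fin.
have nge0 (w : R[i]) : 0 <= nc w by case: w => u v; exact: sqrtr_ge0.
have -> : (f + h : H) g = f g + h g by [].
have := le_normcD (f g) (h g); set p := nc _; set x := nc _; set y := nc _ => le1.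
apply: (@le_trans _ _ ((x + y) ^+ 2)); first by rewrite ler_sqr ?nnegrE ?addr_ge0 ?nge0.
by rewrite -subr_ge0 (_ : _ - _ = (x - y) ^+ 2) ?sqr_ge0 //; ring.
Qed.

End L2Norm.

Section Graphs.
Variables (R : realType) (G : groupType).
Local Notation H := (l2 R G).
Implicit Types T : set (H * H).

Lemma sub_graph_closure T p : T p -> graph_closure T p.
Proof. by move=> Tp e e0; exists p; rewrite !subrr l2norm0. Qed.

Lemma graph_closure_map T T' (V W : H -> H) :
  (forall f h, l2norm (V f - V h) = l2norm (f - h)) ->
  (forall f h, l2norm (W f - W h) = l2norm (f - h)) ->
  (forall f h, T (f, h) -> T' (V f, W h)) ->
  forall f h, graph_closure T (f, h) -> graph_closure T' (V f, W h).
Proof.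
move=> Vi Wi TT' f h cl e e0; have [[f' h'] [Tq fe he]] := cl e e0.
by exists (V f', W h'); rewrite /= Vi Wi; split=> //; exact: TT'.
Qed.

Lemma graph_closure_id (S : set H) :
  (forall x e, 0 < e -> exists2 y, S y & l2norm (x - y) < e) ->
  graph_closure [set p | S p.1 /\ p.2 = p.1]%classic = op_graph id.
Proof.
move=> dS; apply/seteqP; split=> -[x y]; rewrite /op_graph /=.
  move=> cl; apply/eqP; rewrite -subr_eq0; apply/eqP/l2norm_eq0/le_anti.
  rewrite l2norm_ge0 andbT; apply/ler_addgt0Pl => e e0; rewrite addr0.
  have [|[z w] [[_ /= ->] /= xz yz]] := cl (e / 4); first by rewrite divr_gt0.
  have -> : y - x = (y - z) - (x - z) by rewrite opprB addrA subrK.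
  apply: le_trans (l2normD _ _) _; rewrite l2normN.
  have E : 2 * (e / 4 + e / 4) = e by field.
  rewrite -[leRHS]E; apply: ler_wpM2l => //.
  by apply: lerD; apply: ltW; [exact: yz|exact: xz].
move=> ->; move=> e e0; have [z Sz xz] := dS x e e0.
by exists (z, z).
Qed.

End Graphs.

Section Affiliated.
Variables (R : realType) (G : groupType) (U : affiliatedAlgebra R G).
Local Notation H := (l2 R G).
Implicit Types (x y : U) (f h : H).

Lemma aff_opP x : affiliated (aff_op x).
Proof. by rewrite -(aff_op_range U); exists x. Qed.

Lemma aff_op_lin x (a : R[i]) f h f' h' : aff_op x (f, h) -> aff_op x (f', h') ->
  aff_op x (a *: f + f', a *: h + h').
Proof. by move=> xf xf'; exact: (op_linear (aff_opP x).1 a xf xf'). Qed.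

Lemma aff_op0 x : aff_op x (0, 0).
Proof.
have [[f h] [xf _]] := op_dense (aff_opP x).1 0 ltr01.
by have := aff_op_lin (-1) xf xf; rewrite !scaleN1r !addNr.
Qed.

Lemma aff_op_fun x f h h' : aff_op x (f, h) -> aff_op x (f, h') -> h = h'.
Proof.
move=> xf xf'; have := aff_op_lin (-1) xf' xf; rewrite !scaleN1r addNr.
by move=> /(op_functional (aff_opP x).1) => /eqP; rewrite addrC subr_eq0 => /eqP.
Qed.

Lemma aff_opZ_sub x (a : R[i]) f h : aff_op x (f, h) -> aff_op (a *: x) (f, a *: h).
Proof. by move=> xf; rewrite aff_opZ; apply: sub_graph_closure; exists h. Qed.

(** [T_y] is the inverse of the operator [T_x] when [y] is the inverse of [x]:
    the inverse of the injective operator [T_x] is itself affiliated, hence of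
    the form [T_w], and [w] is a right inverse of [x]. *)
Lemma aff_op_inverse x y : x * y = 1 -> y * x = 1 ->
  forall f h, aff_op x (f, h) -> aff_op y (h, f).
Proof.
move=> xy yx.
have opM z w f h k : aff_op w (f, h) -> aff_op z (h, k) -> aff_op (z * w) (f, k).
  by move=> wf zh; rewrite aff_opM; apply: sub_graph_closure; exists h.
have dense f e : 0 < e -> exists2 h, (exists k, aff_op x (k, h)) & l2norm (f - h) < e.
  move=> e0; have : aff_op (x * y) (f, f) by rewrite xy aff_op1.
  rewrite aff_opM => /(_ e e0)[[f' h'] [[k [/= yk xk]] _ fh']].
  by exists h' => //; exists k.
pose T : set (H * H) := [set p | aff_op x (p.2, p.1)]%classic.
have affT : affiliated T.
  have [[xl xf xd xc] xS] := aff_opP x.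
  split; last by move=> S hS f h /(xS S hS).
  split=> [a p q Tp Tq|f Tf|f e e0|].
  - exact: aff_op_lin.
  - have ff : aff_op (1 : U) (f, f) by rewrite aff_op1.
    by apply: aff_op_fun ff _; rewrite -yx; exact: opM Tf (aff_op0 y).
  - by have [h [k xk] fh] := dense f e e0; exists (h, k).
  apply/seteqP; split=> [[f h] cl|p Tp]; last exact: sub_graph_closure.
  rewrite /T /= -xc => e e0; have [[f' h'] [Tq fe he]] := cl e e0.
  by exists (h', f').
have [w _ wT] : range (@aff_op R G U) T by rewrite aff_op_range.
have xw : x * w = 1.
  apply: (@aff_op_inj R G U); rewrite aff_opM aff_op1 wT.
  rewrite -(graph_closure_id dense); congr graph_closure.
  apply/seteqP; split=> -[f h] /=.
    by move=> [k [/= Tk xk]]; split; [exists k|exact: aff_op_fun xk Tk].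
  by move=> [[k xk] /= ->]; exists k.
by move=> f h xf; rewrite (inv_unique yx xw) wT.
Qed.

Section Intertwine.
Variable V : H -> H.
Hypothesis Vlin : linear V.
Hypothesis Viso : forall f, l2norm (V f) = l2norm f.

(** When [V] is unitary, [x] and [y] are intertwined if conjugation by [V] maps the
    operator of [x] to the operator of [y]. One inclusion of graphs is enough: it
    passes to sums, products and inverses. *)
Definition intertwined x y := forall f h, aff_op x (f, h) -> aff_op y (V f, V h).

Let VB f h : V (f - h) = V f - V h.
Proof. by rewrite [f - h]addrC [RHS]addrC; have := Vlin (-1) h f; rewrite !scaleN1r. Qed.

Let VZ a f : V (a *: f) = a *: V f.
Proof.
have V0 : V 0 = 0 by have := VB 0 0; rewrite !subrr.
by have := Vlin a f 0; rewrite V0 !addr0.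
Qed.

Let VD f h : V (f + h) = V f + V h.
Proof. by have := Vlin 1 f h; rewrite !scale1r. Qed.

Let Vdist f h : l2norm (V f - V h) = l2norm (f - h).
Proof. by rewrite -VB Viso. Qed.

Lemma intertwinedD x x' y y' : intertwined x x' -> intertwined y y' ->
  intertwined (x + y) (x' + y').
Proof.
move=> hx hy f h; rewrite !aff_opD; apply: graph_closure_map => // {}f {}h.
move=> [k [l [/= xk yl ->]]]; exists (V k), (V l); rewrite /= VD.
by split=> //; [exact: hx|exact: hy].
Qed.

Lemma intertwinedZ a x x' : intertwined x x' -> intertwined (a *: x) (a *: x').
Proof.
move=> hx f h; rewrite !aff_opZ; apply: graph_closure_map => // {}f {}h.
by move=> [k [/= xk ->]]; exists (V k); rewrite /= VZ; split=> //; exact: hx.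
Qed.

Lemma intertwinedM x x' y y' : intertwined x x' -> intertwined y y' ->
  intertwined (x * y) (x' * y').
Proof.
move=> hx hy f h; rewrite !aff_opM; apply: graph_closure_map => // {}f {}h.
by move=> [k [/= yk xk]]; exists (V k); split; [exact: hy|exact: hx].
Qed.

Lemma intertwined1 : intertwined 1 1.
Proof. by move=> f h; rewrite !aff_op1 /op_graph /= => ->. Qed.

Lemma intertwinedV x x' y y' : x * y = 1 -> y * x = 1 -> x' * y' = 1 -> y' * x' = 1 ->
  intertwined x x' -> intertwined y y'.
Proof.
move=> xy yx xy' yx' hx f h yf; apply: (aff_op_inverse xy' yx').
by apply: hx; exact: (aff_op_inverse yx xy).
Qed.

Lemma intertwined_sum (I : Type) (r : seq I) (F F' : I -> U) :
  (forall i, intertwined (F i) (F' i)) ->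
  intertwined (\sum_(i <- r) F i) (\sum_(i <- r) F' i).
Proof.
move=> hF; elim: r => [|i r IH]; last by rewrite !big_cons; exact: intertwinedD.
by rewrite !big_nil; have := intertwinedZ (a := 0) intertwined1; rewrite !scale0r.
Qed.

Lemma aff_op_zero f : aff_op (0 : U) (f, 0).
Proof.
rewrite -(scale0r (1 : U)) -(scale0r f); apply: aff_opZ_sub.
by rewrite aff_op1.
Qed.

Lemma intertwined0 y : (forall f, exists h, V h = f) -> intertwined 0 y -> y = 0.
Proof.
move=> Vsurj hy; apply: (@aff_op_inj R G U); apply/seteqP.
have y0 f : aff_op y (f, 0).
  have V0 : V 0 = 0 by have := VB 0 0; rewrite !subrr.
  by have [h <-] := Vsurj f; have := hy h 0 (aff_op_zero h); rewrite V0.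
split=> -[f h] xf; first by rewrite (aff_op_fun xf (y0 f)); exact: aff_op_zero.
by rewrite (aff_op_fun xf (aff_op_zero f)).
Qed.

End Intertwine.
End Affiliated.

Lemma vandermonde_eq0 (F : fieldType) (V : lmodType F) n (z : nat -> F) (u : nat -> V) :
  injective z ->
  (forall j, \sum_(i < n) z j ^+ i *: u i = 0) -> forall i, (i < n)%N -> u i = 0.
Proof.
move=> zinj zu i ilt; pose a : 'rV[F]_n := \row_j z j.
have aU : Vandermonde n a \in unitmx.
  rewrite unitmxE det_Vandermonde unitfE; apply/prodf_neq0 => j _.
  apply/prodf_neq0 => k jk; rewrite !mxE subr_eq0; apply/eqP => /zinj E.
  by move: jk; rewrite E ltnn.
have E := mulmxV aU; pose W := invmx (Vandermonde n a).
have : \sum_(j < n) W j (Ordinal ilt) *: \sum_(k < n) z j ^+ k *: u k = 0.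
  by rewrite big1 // => j _; rewrite zu scaler0.
under eq_bigr do rewrite scaler_sumr.
rewrite exchange_big (bigD1 (Ordinal ilt)) //= [X in _ + X]big1 ?addr0 => [|k ki].
  have := congr1 (fun M : 'M[F]_n => M (Ordinal ilt) (Ordinal ilt)) E.
  rewrite !mxE eqxx => E1 E2; rewrite -[u i]scale1r -[1]E1 scaler_suml -[RHS]E2.
  by apply: eq_bigr => j _; rewrite !mxE scalerA mulrC.
have := congr1 (fun M : 'M[F]_n => M k (Ordinal ilt)) E.
rewrite !mxE (negPf ki) => E1; rewrite -[RHS](scale0r (u k)) -[X in X *: _]E1 scaler_suml.
by apply: eq_bigr => j _; rewrite !mxE scalerA mulrC.
Qed.

Section UnitCircle.
Variable R : realType.
Local Notation nc := (@Normc.normc R).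

Lemma nc_exp (z : R[i]) (k : int) : nc z = 1 -> nc (z ^ k) = 1.
Proof.
have pos n w : nc w = 1 -> nc (w ^+ n) = 1.
  move=> w1; elim: n => [|n IH]; first by rewrite expr0 Normc.normc1.
  by rewrite exprS Normc.normcM w1 IH mulr1.
case: k => n z1; first exact: pos.
by rewrite NegzE -exprz_inv; apply: pos; rewrite Normc.normcV z1 invr1.
Qed.

Lemma nc1_neq0 (z : R[i]) : nc z = 1 -> z != 0.
Proof.
move=> z1; apply/eqP => z0; move/eqP: z1.
by rewrite z0 [Normc.normc _]Normc.normc0 eq_sym oner_eq0.
Qed.

(** The rational parametrisation [(1 + i j) / (1 - i j)]. *)
Lemma circle_points : exists2 z : nat -> R[i], injective z & forall j, nc (z j) = 1.
Proof.
pose w (j : nat) : R[i] := (1 +i* j%:R)%C.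
pose w' (j : nat) : R[i] := (1 -i* j%:R)%C.
have w'n j : w' j != 0 by rewrite eq_complex /= oner_eq0.
have nw j : nc (w j) = nc (w' j) by rewrite /Normc.normc /= sqrrN.
exists (fun j => w j / w' j) => [i j E|j]; last first.
  rewrite Normc.normcM Normc.normcV nw mulfV //.
  by apply/eqP => /Normc.eq0_normc/eqP; rewrite (negPf (w'n j)).
have : w i * w' j = w j * w' i.
  by rewrite -[w i](mulfVK (w'n i)) E mulrAC mulfVK.
case; rewrite !mul1r !mulr1 => _ E2.
by apply/eqP; rewrite -(eqr_nat R); apply/eqP; lra.
Qed.

End UnitCircle.

(** * Gradings of the Linnell skew field *)

Section LeftConvolution.
Variables (R : realType) (G : groupType).

Lemma lconvU (c : R[i]) (g : G) (f : l2 R G) :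
  lconv (mkmalgU g c : groupRing R[i] G) f = c *: ltrans g f.
Proof.
rewrite /lconv msuppU; case: eqVneq => [->|_].
  by rewrite finmap.big_seq_fset0 scale0r.
by rewrite finmap.big_seq_fset1 mcoeffUU.
Qed.

End LeftConvolution.

Section LinnellGrading.
Variables (R : realType) (G : groupType) (U : affiliatedAlgebra R G).
Local Notation D := (linnell U).
Local Notation nc := (@Normc.normc R).
Variables (H : set G) (phi : G -> int).
Hypothesis subH : subgroup H.
Hypothesis phiM : forall x y, H x -> H y -> phi (x * y)%g = phi x + phi y.
Hypothesis phiS : forall k : int, exists2 x, H x & phi x = k.

Let H1 : H 1%g. Proof. by case: subH. Qed.
Let HV x : H x -> H x^-1%g.
Proof. by move=> Hx; rewrite -[x^-1%g]mul1g; case: subH => _; apply. Qed.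
Let HM x y : H x -> H y -> H (x * y)%g.
Proof. by move=> Hx Hy; rewrite -[y]invgK; case: subH => _; apply => //; exact: HV. Qed.

Definition coset_rep (g : G) : G := xget 1%g [set r | H (r * g^-1)%g]%classic.

Lemma coset_repP g : H (coset_rep g * g^-1)%g.
Proof.
by apply: (@xgetPex _ 1%g [set r | H (r * g^-1)%g]%classic); exists g; rewrite /= mulgV.
Qed.

Lemma coset_repM h g : H h -> coset_rep (h * g)%g = coset_rep g.
Proof.
move=> Hh; rewrite /coset_rep; congr (xget _ _); apply/seteqP; split=> r /=.
  by move=> /HM/(_ Hh); rewrite invgM mulgA mulgVK.
by move=> /HM/(_ (HV Hh)); rewrite invgM mulgA.
Qed.

(** The extension of [phi] to [G] through a choice of representatives of the right
    cosets of [H]; it is equivariant for left translations by [H]. *)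
Definition coset_deg g := phi (g * (coset_rep g)^-1)%g.

Lemma coset_degM h g : H h -> coset_deg (h * g)%g = phi h + coset_deg g.
Proof.
move=> Hh; rewrite /coset_deg coset_repM // -mulgA (phiM Hh) //.
by have := HV (coset_repP g); rewrite invgM invgK.
Qed.

Section Rotation.
Variables (z : R[i]) (z1 : nc z = 1).

Lemma rotation_subproof (f : l2 R G) :
  (fun x => z ^ coset_deg x * f x) \in @square_summable R G.
Proof.
have := valP f; rewrite !unfold_in /= /sqsum; congr (_ < _)%E.
by apply: eq_esum => g _; rewrite Normc.normcM nc_exp ?mul1r.
Qed.

(** Multiplication by [z ^ coset_deg]. It conjugates the left translation by [g]
    in [H] to its multiple by [z ^ phi g]. *)
Definition rotation (f : l2 R G) : l2 R G := L2 (rotation_subproof f).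

Lemma rotation_linear : linear rotation.
Proof.
move=> a f h; apply: l2_ext => x /=.
rewrite [LHS](_ : _ = z ^ coset_deg x * (a * f x + h x)) //.
rewrite [RHS](_ : _ = a * (z ^ coset_deg x * f x) + z ^ coset_deg x * h x) //.
by rewrite mulrDr mulrCA.
Qed.

Lemma rotationZ a f : rotation (a *: f) = a *: rotation f.
Proof. by apply: l2_ext => x; exact: mulrCA. Qed.

Lemma rotation_iso f : l2norm (rotation f) = l2norm f.
Proof. by apply: eq_l2norm => x; rewrite /= Normc.normcM nc_exp ?mul1r. Qed.

Lemma rotation_ltrans g f : H g ->
  rotation (ltrans g f) = z ^ phi g *: ltrans g (rotation f).
Proof.
move=> Hg; apply: l2_ext => x.
rewrite [RHS](_ : _ = z ^ phi g * (z ^ coset_deg (g^-1 * x)%g * f (g^-1 * x)%g)) //.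
rewrite mulrA -expfzDr ?(nc1_neq0 z1) // -coset_degM //.
by rewrite /= mulVKg.
Qed.

Lemma rotation_intertwines g c : H g ->
  intertwined rotation (aff_incl U (mkmalgU g c : groupRing R[i] G))
    (z ^ phi g *: aff_incl U (mkmalgU g c : groupRing R[i] G)).
Proof.
move=> Hg f h; rewrite aff_inclE /op_graph /= => ->.
rewrite lconvU.
have -> : rotation (c *: ltrans g f) = z ^ phi g *: (c *: ltrans g (rotation f)).
  by rewrite rotationZ rotation_ltrans // !scalerA mulrC.
by apply: aff_opZ_sub; rewrite aff_inclE /op_graph /= lconvU.
Qed.

End Rotation.

Lemma rotation_surj z (z1 : nc z = 1) f : exists h, rotation z1 h = f.
Proof.
have zV : nc z^-1 = 1 by rewrite Normc.normcV z1 invr1.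
exists (rotation zV f); apply: l2_ext => x.
by rewrite /= mulrA -expfzMl mulfV ?exp1rz ?mul1r // nc1_neq0.
Qed.

(** The isotypic component of degree [k] for the circle acting on [D] through
    conjugation by the rotations. *)
Definition rot_deg (k : int) : set D := fun x =>
  forall z (z1 : nc z = 1), intertwined (rotation z1) (val x) (z ^ k *: val x).

Lemma rot_deg_tau g c : H g ->
  rot_deg (phi g) (linnell_incl U (mkmalgU g c : groupRing R[i] G)).
Proof. by move=> Hg z z1; exact: rotation_intertwines. Qed.

Lemma rot_degB k x y : rot_deg k x -> rot_deg k y -> rot_deg k (x - y).
Proof.
move=> hx hy z z1; have L := rotation_linear z1; have I := rotation_iso z1.
rewrite [val _](_ : _ = val x + (-1) *: val y); last by rewrite scaleN1r.
rewrite scalerDr; apply: (intertwinedD L I); first exact: hx.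
rewrite scalerA mulrC -scalerA; apply: (intertwinedZ L I); exact: hy.
Qed.

Lemma rot_deg_tau_eq k g c : H g -> phi g = k ->
  rot_deg k (linnell_incl U (mkmalgU g c : groupRing R[i] G)).
Proof. by move=> Hg <-; exact: rot_deg_tau. Qed.

Lemma phi_1 : phi 1%g = 0.
Proof. by have /eqP := phiM H1 H1; rewrite mulg1 -subr_eq subrr eq_sym => /eqP. Qed.

(** Rotating the relation [\sum_i x i = 0] by [z] gives [\sum_i z ^ i x i = 0], for
    infinitely many [z]. *)
Lemma rot_deg_direct (k : int) (m : nat) (x : nat -> D) :
  (forall i, rot_deg (k + i%:Z) (x i)) -> \sum_(i < m) x i = 0 ->
  forall i, (i < m)%N -> x i = 0.
Proof.
move=> hx sx i im; apply/val_inj.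
have [z zinj z1] := circle_points R.
apply: (@vandermonde_eq0 _ _ m z (fun i => val (x i)) zinj) => // j.
have L := rotation_linear (z1 j); have I := rotation_iso (z1 j).
have : intertwined (rotation (z1 j)) (\sum_(i < m) val (x i))
    (\sum_(i < m) z j ^ (k + i%:Z) *: val (x i)).
  by apply: (intertwined_sum L I) => l; exact: hx.
have -> : \sum_(i < m) val (x i) = 0.
  transitivity (val (\sum_(i < m) x i)); last by rewrite sx.
  by symmetry; apply: (big_morph (fun u : D => val u)).
move=> /(intertwined0 L (rotation_surj (z1 j))) E.
apply: (scalerI (expfz_neq0 k (nc1_neq0 (z1 j)))); rewrite scaler0 -[RHS]E scaler_sumr.
by apply: eq_bigr => l _; rewrite scalerA expfzDr ?nc1_neq0.
Qed.

Lemma rot_grading : skew_grading rot_deg.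
Proof.
split.
- exact: rot_degB.
- have := rot_deg_tau (c := 1) H1; rewrite phi_1.
  by rewrite [linnell_incl _ _](_ : _ = 1) // -(rmorph1 (linnell_incl U)).
- move=> k l x y hx hy z z1.
  rewrite [val _](_ : _ = val x * val y) // expfzDr ?nc1_neq0 //.
  have -> : (z ^ k * z ^ l) *: (val x * val y) = (z ^ k *: val x) * (z ^ l *: val y).
    by rewrite -scalerAl -scalerAr scalerA.
  by apply: (intertwinedM (rotation_linear z1) (rotation_iso z1)); [exact: hx|exact: hy].
- move=> k x y hx xy yx z z1.
  have E1 : val x * val y = 1 by have := congr1 val xy.
  have E2 : val y * val x = 1 by have := congr1 val yx.
  have zk : z ^ k * z ^ (- k) = 1 by rewrite -expfzDr ?nc1_neq0 // subrr expr0z.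
  apply: (intertwinedV E1 E2 _ _ (hx z z1)).
    by rewrite -scalerAl -scalerAr scalerA zk scale1r.
  by rewrite -scalerAl -scalerAr scalerA mulrC zk scale1r.
- exact: rot_deg_direct.
move=> k; have [g Hg <-] := phiS k; exists (tau_elt U g); first exact: rot_deg_tau.
exists (tau_elt U g^-1%g).
by rewrite -!tau_eltM mulgV mulVg tau_elt1.
Qed.

End LinnellGrading.

(** * Twisted rational expressions *)

Section TwistGood.
Variables (R : realType) (G : groupType) (U : affiliatedAlgebra R G).
Local Notation D := (linnell U).
Hypothesis liG : locally_indicable G.
Hypothesis skD : skew_field D.
Variables (m : nat) (sigma : representation R[i] G m.+1).
Local Notation B := 'M[D]_m.+1.

Definition twist_const : {rmorphism R[i] -> B} := @scalar_mx D m.+1 \o tau_const U.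

Lemma twist_constC c g : twist_const c * twist_mx U sigma g = twist_mx U sigma g * twist_const c.
Proof.
apply/matrixP => i j; rewrite -[_ * _]/(_ *m _) -[RHS]/((_ *m _) i j).
rewrite mul_scalar_mx !mxE (bigD1 j) //= big1 ?addr0 => [|k kj]; last first.
  by rewrite !mxE (negPf kj) mulr0.
rewrite !mxE eqxx mulr1n -mulrA -tau_constC !mulrA; congr (_ * _).
by rewrite -!rmorphM mulrC.
Qed.

Lemma twist_graded (s : seq G) (phi : G -> int) :
  (forall x y, generated s x -> generated s y -> phi (x * y)%g = phi x + phi y) ->
  (forall k : int, exists2 x, generated s x & phi x = k) ->
  exists Dg, graded_by (twist_mx U sigma) twist_const (generated s) phi Dg.
Proof.
move=> phiM phiS.
have sub : subgroup (generated s).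
  split=> [S [[S1 _] _] //|x y hx hy S hS]; have [[_ SV] _] := hS.
  by apply: SV; [exact: hx|exact: hy].
have H1 := sub.1.
have gr := rot_grading U sub phiM phiS.
have dconst c : @rot_deg R G U (generated s) phi 0 (tau_const U c).
  exact: (rot_deg_tau_eq (U := U) sub phiM (c := c) H1 (phi_1 sub phiM)).
exists (@rot_deg R G U (generated s) phi); split=> // [g Hg i j|c i j]; rewrite !mxE.
  by apply: (grdM_eq gr (add0r _)); [exact: dconst|exact: rot_deg_tau].
by case: (i == j); [exact: dconst|exact: (grd0 gr)].
Qed.

Lemma twist_expr_good l x : expr (twist_mx U sigma) twist_const false l x -> good x.
Proof.
apply: expr_good => //.
- exact: twist_mx1.
- exact: twist_mxM.
- exact: twist_constC.
- exact: twist_graded.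
Qed.

End TwistGood.

(** * Extension of the twisted representation *)

Section Augmented.
Variables (K : comUnitRingType) (G : groupType) (n : nat).
Variable sigma : representation K G n.

Definition aug_mx (g : G) : 'M[K]_(1 + n) := block_mx 1%:M 0 0 (sigma g).

Lemma aug_unit g : aug_mx g \in unitmx.
Proof. by rewrite unitmxE det_ublock det1 mul1r -unitmxE rep_unit. Qed.

Lemma aug1 : aug_mx 1%g = 1%:M.
Proof. by rewrite /aug_mx rep1 -scalar_mx_block. Qed.

Lemma augM g h : aug_mx (g * h)%g = aug_mx g *m aug_mx h.
Proof. by rewrite /aug_mx mulmx_block !mulmx0 !mul0mx !mul1mx !addr0 add0r repM. Qed.

Definition augmented : representation K G n.+1 :=
  @Representation K G n.+1 aug_mx aug_unit aug1 augM.

End Augmented.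

Section BlockDiagonal.
Variables (D : nzRingType) (n : nat).
Local Notation B := 'M[D]_n.+1.

Definition bdiag_mx (a : D) (y : 'M[D]_n) : B := block_mx (a%:M : 'M[D]_1) 0 0 y.
Definition corner (x : B) : D := ulsubmx (x : 'M[D]_(1 + n)) 0 0.
Definition lower (x : B) : 'M[D]_n := drsubmx (x : 'M[D]_(1 + n)).
Definition is_bdiag (x : B) := x = bdiag_mx (corner x) (lower x).

Lemma corner_bdiag a y : corner (bdiag_mx a y) = a.
Proof. by rewrite /corner /bdiag_mx block_mxKul mxE mulr1n. Qed.

Lemma lower_bdiag a y : lower (bdiag_mx a y) = y.
Proof. exact: block_mxKdr. Qed.

Lemma bdiagP a y : is_bdiag (bdiag_mx a y).
Proof. by rewrite /is_bdiag corner_bdiag lower_bdiag. Qed.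

Lemma bdiag_mxM a b y z : bdiag_mx a y * bdiag_mx b z = bdiag_mx (a * b) (y *m z).
Proof.
rewrite -[LHS]/(_ *m _) /bdiag_mx (@mulmx_block _ 1 n 1 n 1 n).
by rewrite !mulmx0 !mul0mx !addr0 add0r -scalar_mxM.
Qed.

Lemma bdiag_mxD a b y z : bdiag_mx a y + bdiag_mx b z = bdiag_mx (a + b) (y + z).
Proof. by rewrite /bdiag_mx (@add_block_mx _ 1 n 1 n) !addr0 -raddfD. Qed.

Lemma bdiag_mx1 : bdiag_mx 1 1%:M = 1.
Proof. by rewrite /bdiag_mx -scalar_mx_block. Qed.

Lemma bdiag_mx0 : bdiag_mx 0 0 = 0.
Proof. by rewrite /bdiag_mx raddf0 block_mx0. Qed.

Lemma cornerD x y : is_bdiag x -> is_bdiag y -> corner (x + y) = corner x + corner y.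
Proof. by move=> {1}-> {1}->; rewrite bdiag_mxD corner_bdiag. Qed.

Lemma lowerD x y : is_bdiag x -> is_bdiag y -> lower (x + y) = lower x + lower y.
Proof. by move=> {1}-> {1}->; rewrite bdiag_mxD lower_bdiag. Qed.

Lemma cornerM x y : is_bdiag x -> is_bdiag y -> corner (x * y) = corner x * corner y.
Proof. by move=> {1}-> {1}->; rewrite bdiag_mxM corner_bdiag. Qed.

Lemma lowerM x y : is_bdiag x -> is_bdiag y -> lower (x * y) = lower x *m lower y.
Proof. by move=> {1}-> {1}->; rewrite bdiag_mxM lower_bdiag. Qed.

Lemma is_bdiagD x y : is_bdiag x -> is_bdiag y -> is_bdiag (x + y).
Proof. by move=> -> ->; rewrite bdiag_mxD; exact: bdiagP. Qed.

Lemma is_bdiagM x y : is_bdiag x -> is_bdiag y -> is_bdiag (x * y).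
Proof. by move=> -> ->; rewrite bdiag_mxM; exact: bdiagP. Qed.

Lemma is_bdiag_sub (z : 'M[D]_(1 + n)) : ursubmx z = 0 -> dlsubmx z = 0 ->
  is_bdiag (z : B).
Proof.
move=> ur dl; rewrite /is_bdiag /bdiag_mx -{1}(submxK z) ur dl.
have -> : ulsubmx z = (corner z)%:M.
  by apply/matrixP => i j; rewrite !ord1 [RHS]mxE mulr1n.
by [].
Qed.

Lemma is_bdiagV x y : is_bdiag x -> x * y = 1 -> y * x = 1 -> is_bdiag y.
Proof.
move=> ->; pose z : 'M[D]_(1 + n) := y; rewrite -[y]/z -(submxK z) -bdiag_mx1.
rewrite -![_ * _]/(_ *m _) /bdiag_mx !(@mulmx_block _ 1 n 1 n 1 n) !mulmx0 !mul0mx !addr0 !add0r.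
move=> /(@eq_block_mx _ 1 n 1 n)[_ e2 e3 _] /(@eq_block_mx _ 1 n 1 n)[f1 _ _ f4].
rewrite submxK; apply: (is_bdiag_sub (z := z)).
  by rewrite -[LHS]mul1mx -f1 -mulmxA e2 mulmx0.
by rewrite -[LHS]mul1mx -f4 -mulmxA e3 mulmx0.
Qed.

Lemma corner1 : corner 1 = 1. Proof. by rewrite -bdiag_mx1 corner_bdiag. Qed.
Lemma lower1 : lower 1 = 1%:M. Proof. by rewrite -bdiag_mx1 lower_bdiag. Qed.
Lemma corner0 : corner 0 = 0. Proof. by rewrite -bdiag_mx0 corner_bdiag. Qed.
Lemma cornerN x : corner (- x) = - corner x. Proof. by rewrite /corner !mxE. Qed.

End BlockDiagonal.

Section Extension.
Variables (R : realType) (G : groupType) (U : affiliatedAlgebra R G).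
Local Notation D := (linnell U).
Hypothesis liG : locally_indicable G.
Hypothesis skD : skew_field D.
Variables (n : nat) (sigma : representation R[i] G n).
Local Notation B := 'M[D]_n.+1.
Local Notation Phi := (twist_mx U (augmented sigma)).
Local Notation kap := (@twist_const R G U n).
Local Notation tau := (@linnell_incl R G U).

Let Phi1 := twist_mx1 U (augmented sigma).
Let PhiM := twist_mxM U (augmented sigma).
Let E : set B := in_span Phi kap (fun=> True).

Let ED x y : E x -> E y -> E (x + y).
Proof. exact: in_spanD. Qed.
Let EM x y : E x -> E y -> E (x * y).
Proof. exact: in_spanM. Qed.
Let Eunit c g : E (kap c * Phi g).
Proof. exact: in_span_mono (expr_unit _ _ c g) I. Qed.
Let E1 : E 1.
Proof. by have := Eunit 1 1%g; rewrite Phi1 rmorph1 mulr1. Qed.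
Let EN x : E x -> E (- x).
Proof.
move=> Ex; rewrite -mulN1r; apply: EM => //.
by have := Eunit (-1) 1%g; rewrite Phi1 rmorphN1 mulr1.
Qed.
Let Egood x : E x -> x = 0 \/ is_unit x.
Proof. by move=> [l h _]; exact: twist_expr_good liG skD _ _ _ _ h. Qed.
Let EV x y : E x -> x * y = 1 -> y * x = 1 -> E y.
Proof. by move=> [l h _] xy yx; apply: in_span_mono (expr_inv h xy yx) I. Qed.

Let bdiag_unit c g : kap c * Phi g =
  bdiag_mx (tau_const U c * tau_elt U g) (tau_const U c *: twist_mx U sigma g).
Proof.
rewrite -[LHS]/(_ *m _) mul_scalar_mx; apply/matrixP => i j.
rewrite !mxE; case: splitP => i' ii'; rewrite !mxE; case: splitP => j' jj'; rewrite !mxE.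
- by rewrite !ord1 /= rmorph1 mul1r.
- by rewrite rmorph0 mul0r mulr0.
- by rewrite rmorph0 mul0r mulr0.
- by [].
Qed.

Let E_bdiag x : E x -> is_bdiag x.
Proof.
move=> [l h _]; elim: h => {l x} [c g|l x y _ hx xy yx|l l' x y _ hx _ hy||l x _ //|l l' x y _ _ _ hx _ hy].
- by rewrite bdiag_unit; exact: bdiagP.
- exact: is_bdiagV hx xy yx.
- exact: is_bdiagM.
- by rewrite -bdiag_mx0; exact: bdiagP.
- exact: is_bdiagD.
Qed.

(** A nonzero element of [E] is invertible in [E], hence so is its corner. *)
Let corner_inj x y : E x -> E y -> corner x = corner y -> x = y.
Proof.
move=> Ex Ey xy; apply/eqP; rewrite -subr_eq0; apply/eqP.
have Exy : E (x - y) by apply: ED => //; exact: EN.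
case: (Egood Exy) => // -[w [xyw wxy]].
have := congr1 (@corner D n) xyw; rewrite cornerM ?corner1; [|exact: E_bdiag|exact/E_bdiag/(EV Exy xyw wxy)].
rewrite cornerD; [|exact: E_bdiag|exact/E_bdiag/EN].
rewrite cornerN xy subrr mul0r.
by move/esym/eqP; rewrite oner_eq0.
Qed.

(** The corners of the elements of [E] form a division closed subring containing
    the group ring, hence exhaust the Linnell skew field. *)
Let corner_surj (a : D) : exists2 x, E x & corner x = a.
Proof.
pose S : set U := [set u | exists2 x, E x & val (corner x) = u]%classic.
have Sa : S (val a).
  have /asboolP := valP a; apply; split; first split.
  - by exists 1 => //; rewrite corner1.
  - move=> u v [x Ex <-] [y Ey <-]; exists (x - y); first by apply: ED => //; exact: EN.
    by rewrite cornerD ?cornerN //; [exact: E_bdiag|exact/E_bdiag/EN].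
  - by move=> u v [x Ex <-] [y Ey <-]; exists (x * y); [exact: EM|rewrite cornerM //; exact: E_bdiag].
  - move=> u v [x Ex <-] uv vu; case: (Egood Ex) => [x0|[y [xy yx]]].
      move: uv; rewrite x0 corner0 (_ : val 0 = 0) // mul0r => /eqP.
      by rewrite eq_sym oner_eq0.
    have Ey := EV Ex xy yx; exists y => //.
    apply: inv_unique uv; have := congr1 (fun w => val (corner w)) yx.
    by rewrite /= cornerM ?corner1 //; exact: E_bdiag.
  move=> _ [b _ <-].
  have -> : b = \sum_(g <- finmap.enum_fset (msupp b)) (mkmalgU g (mcoeff g b) : groupRing R[i] G).
    exact: monalgE.
  elim/big_ind: _ => [|u v [x Ex hx] [y Ey hy]|g _].
  - exists 0; first exact: in_span0.
    by rewrite rmorph0 corner0.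
  - by exists (x + y); [exact: ED|rewrite cornerD ?rmorphD -?hx -?hy //; exact: E_bdiag].
  exists (kap (mcoeff g b) * Phi g) => //.
  rewrite bdiag_unit corner_bdiag -[RHS]/(val (tau _)); congr (val _).
  rewrite /tau_const /tau_elt -rmorphM; congr (tau _).
  rewrite /gr_const /gr_elt [LHS]gr_mulUU mulr1 mul1g.
  by [].
by have [x Ex /val_inj] := Sa; exists x.
Qed.

(** The extension is the graph [E]: it maps the corner of an element of [E] to the
    lower block. *)
Lemma twisted_extension : exists psi : D -> 'M[D]_n,
  [/\ psi 1 = 1%:M, forall a b, psi (a + b) = psi a + psi b,
      forall a b, psi (a * b) = psi a *m psi b &
      forall g, psi (tau_elt U g) = twist_mx U sigma g].
Proof.
have /choice[theta] : forall a, exists x, E x /\ corner x = a.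
  by move=> a; have [x] := corner_surj a; exists x.
move=> /all_and2[Et ct]; exists (fun a => lower (theta a)).
have tE x : E x -> theta (corner x) = x by move=> Ex; apply: corner_inj.
split=> [|a b|a b|g].
- by have := tE _ E1; rewrite corner1 => ->; rewrite lower1.
- rewrite -lowerD; [|exact: E_bdiag|exact: E_bdiag].
  rewrite -{1}[a]ct -{1}[b]ct -cornerD; [|exact: E_bdiag|exact: E_bdiag].
  by rewrite tE //; exact: ED.
- rewrite -lowerM; [|exact: E_bdiag|exact: E_bdiag].
  rewrite -{1}[a]ct -{1}[b]ct -cornerM; [|exact: E_bdiag|exact: E_bdiag].
  by rewrite tE //; exact: EM.
have Eg := Eunit 1 g; rewrite bdiag_unit [tau_const U 1]rmorph1 mul1r scale1r in Eg.
by have := tE _ Eg; rewrite corner_bdiag => ->; rewrite lower_bdiag.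
Qed.

End Extension.

(** * Vector spaces of arbitrary dimension *)

Section LinearExtension.
Variables (A : nzRingType) (V W : lmodType A).
Hypothesis skA : skew_field A.

Definition linear_relation (T : set (V * W)) :=
  (forall a p q, T p -> T q -> T (a *: p.1 + q.1, a *: p.2 + q.2)) /\
  (forall w, T (0, w) -> w = 0).

(** The linear map to be extended is given by its graph. A maximal single-valued
    linear relation containing it, which exists by Zorn's lemma, is everywhere
    defined: otherwise it could be extended by zero to one more vector. *)
Lemma linear_extension (T : set (V * W)) : T (0, 0) -> linear_relation T ->
  exists f : {linear V -> W}, forall v w, T (v, w) -> f v = w.
Proof.
move=> T0 linT; pose P S := linear_relation (S `|` T)%classic.
have [F FP totF|S [PS maxS]] := @Zorn_bigcup _ P.
  have in_one p : (\bigcup_(X in F) X)%classic p -> exists2 X, F X & X p.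
    by move=> [X FX Xp]; exists X.
  split=> [a p q|w [/in_one[X FX Xw]|]]; last 2 first.
  - by apply: (FP X FX).2; left.
  - exact: linT.2.
  have one X : F X -> (X `|` T)%classic p -> (X `|` T)%classic q ->
      (\bigcup_(X in F) X `|` T)%classic (a *: p.1 + q.1, a *: p.2 + q.2).
    by move=> FX Xp Xq; case: ((FP X FX).1 a p q Xp Xq) => ?; [left; exists X|right].
  move=> [/in_one[X FX Xp]|Tp] [/in_one[Y FY Yq]|Tq].
  - have [XY|YX] := totF X Y FX FY.
      by apply: (one Y) => //; left => //; exact: XY.
    by apply: (one X) => //; left => //; exact: YX.
  - by apply: (one X) => //; [left|right].
  - by apply: (one Y) => //; [right|left].
  - by right; exact: linT.1.
pose S' : set (V * W) := (S `|` T)%classic.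
have S'0 : S' (0, 0) by right.
have [Slin Sfun] : linear_relation S' := PS.
have SZ a v w : S' (v, w) -> S' (a *: v, a *: w).
  by move=> h; have := Slin a _ _ h S'0; rewrite /= !addr0.
have total v : exists w, S' (v, w).
  apply: contrapT => nov.
  pose S2 : set (V * W) := [set p | exists a u, S' (u, p.2) /\ p.1 = a *: v + u]%classic.
  have S'S2 : (S' `<=` S2)%classic.
    by move=> [u w] h; exists 0, u; rewrite scale0r add0r.
  apply: (maxS S2).
    split; first by move=> p Sp; apply: S'S2; left.
    move=> S2S; apply: nov; exists 0; left; apply: S2S.
    by exists 1, 0; rewrite scale1r addr0.
  rewrite /P (_ : (S2 `|` T)%classic = S2); last first.
    by apply/seteqP; split=> p; [case=> // Tp; apply: S'S2; right|left].
  split=> [a [_ w] [_ w'] [b [u [/= h ->]]] [b' [u' [/= h' ->]]]|w [a [u [/= h]]]].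
    exists (a * b + b'), (a *: u + u'); split; first exact: Slin h h'.
    by rewrite /= scalerDr scalerA scalerDl -!addrA; congr (_ + _); rewrite addrCA.
  move=> /eqP; rewrite eq_sym addr_eq0 => /eqP avu.
  have [a0|/skA[c [_ ca]]] := eqVneq a 0.
    apply: Sfun; move: avu h; rewrite a0 scale0r => /eqP.
    by rewrite eq_sym oppr_eq0 => /eqP ->.
  case: nov; exists (- c *: w).
  rewrite -[v]scale1r -ca -scalerA avu scalerN -scaleNr; exact: SZ.
have [f fP] := choice total.
have f_uniq v w : S' (v, w) -> f v = w.
  move=> h; have := Slin (-1) _ _ h (fP v); rewrite /= !scaleN1r addNr.
  by move/Sfun/eqP; rewrite addrC subr_eq0 => /eqP.
have flin : linear f by move=> a u v; apply: f_uniq; exact: Slin (fP u) (fP v).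
pose f' : {linear V -> W} := HB.pack f (GRing.isLinear.Build A V W *:%R f flin).
by exists f' => v w Tvw; apply: f_uniq; right.
Qed.

End LinearExtension.

Section Dimension.
Variables (A : nzRingType).
Hypothesis skA : skew_field A.
Variable V : lmodType A.

Definition spanning (I : finType) (b : I -> V) :=
  forall x, exists a : I -> A, x = \sum_i a i *: b i.
Definition independent (I : finType) (b : I -> V) :=
  forall a : I -> A, \sum_i a i *: b i = 0 -> forall i, a i = 0.

Lemma skew_converse : skew_field A^c.
Proof. by move=> x /skA[y [xy yx]]; exists y. Qed.

Lemma independent_le_spanning (I J : finType) (u : I -> V) (v : J -> V) :
  independent u -> spanning v -> (#|I| <= #|J|)%N.
Proof.
move=> iu sv; rewrite leqNgt; apply/negP => lt.
have [a aP] := choice (fun i => sv (u i)).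
have [|x [_ [i xi] xa]] := @wide_system A^c skew_converse [set: A^c]%classic
  (setT_division_closed A^c) I J (fun j i => a i j) _ lt.
  by [].
apply: xi; apply: (iu x); under eq_bigr do rewrite aP scaler_sumr.
rewrite exchange_big big1 // => j _; under eq_bigr do rewrite scalerA.
by rewrite -scaler_suml [X in X *: _](xa j) scale0r.
Qed.

Lemma is_basisP (I : finType) (b : I -> V) : spanning b -> independent b ->
  is_basis (fun i : 'I_#|I| => b (enum_val i)).
Proof.
move=> sb ib.
have re (F : I -> V) : \sum_i F i = \sum_(i < #|I|) F (enum_val i).
  by rewrite (reindex (enum_val (A := {: I}))) //; apply: onW_bij; exact: enum_val_bij.
split=> [x|a sa i].
  by have [a ->] := sb x; exists (fun i => a (enum_val i)); rewrite re.
have := ib (fun i => a (enum_rank i)); rewrite re => /(_ _ (enum_val i)).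
rewrite enum_valK; apply; rewrite -[RHS]sa.
by apply: eq_bigr => j _; rewrite enum_valK.
Qed.

Lemma skew_dim_basis (R : realType) (I : finType) (b : I -> V) :
  spanning b -> independent b -> skew_dim R V = (#|I|%:R)%:E.
Proof.
move=> sb ib; rewrite /skew_dim.
rewrite (_ : [set _ | _ in _]%classic = [set (#|I|%:R : R)%:E]%classic) ?ereal_inf1 //.
apply/seteqP; split=> [y [k [c [sc ic]] <-]|y ->]; last first.
  by exists #|I| => //; exists (fun i => b (enum_val i)); exact: is_basisP.
congr (_%:R)%:E; apply/eqP; rewrite eqn_leq.
have := independent_le_spanning ic sb; have := independent_le_spanning ib sc.
by rewrite !card_ord => -> ->.
Qed.

Lemma skew_dim_infty (R : realType) :
  (forall (I : finType) (b : I -> V), spanning b -> independent b -> False) ->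
  skew_dim R V = +oo%E.
Proof.
move=> nob; rewrite /skew_dim (_ : [set _ | _ in _]%classic = set0) ?ereal_inf0 //.
by apply/seteqP; split=> // y [k [c [sc ic]] yE]; exact: nob sc ic.
Qed.

(** An independent family that is not a basis can be enlarged. *)
Lemma independent_any_size :
  (forall (I : finType) (b : I -> V), spanning b -> independent b -> False) ->
  forall l, exists (I : finType) (b : I -> V), #|I| = l /\ independent b.
Proof.
move=> nob; elim=> [|l [I [b [cI ib]]]].
  exists void, (@of_void V); split; first by rewrite card_void.
  by move=> a _ [].
have [x nx] : exists x, ~ exists a : I -> A, x = \sum_i a i *: b i.
  by apply: contrapT => no; apply: (nob I b) => // x; apply: contrapT => nx; apply: no; exists x.
pose b' (i : option I) := if i is Some i then b i else x.
exists (option I), b'; split; first by rewrite card_option cI.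
have sumE (a : option I -> A) : \sum_i a i *: b' i = a None *: x + \sum_i a (Some i) *: b i.
  rewrite (bigD1 None) //=; congr (_ + _).
  rewrite (reindex_omap Some id) /=; last by case.
  by apply: eq_bigl => k; rewrite eqxx.
move=> a; rewrite sumE => /eqP; have [a0|/skA[c [_ ca]]] := eqVneq (a None) 0.
  by rewrite a0 scale0r add0r => /eqP/ib ia [i|].
rewrite addr_eq0 => /eqP ax; case: nx; exists (fun i => - (c * a (Some i))).
rewrite -[x]scale1r -ca -scalerA ax scalerN scaler_sumr -sumrN.
by apply: eq_bigr => i _; rewrite scaleNr scalerA.
Qed.

End Dimension.

(** * Pairing of the untwisted and twisted complexes *)

Lemma tens_ind (A D : nzRingType) (M : rmodType A) (N : bimodule A D)
    (P : tensor M N -> Prop) :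
  P 0 -> (forall s t, P s -> P t -> P (s - t)) -> (forall m v, P (tens m v)) ->
  forall t, P t.
Proof.
move=> P0 PB Pt t.
have PD s u : P s -> P u -> P (s + u).
  by move=> Ps Pu; rewrite -[u]opprK; apply: (PB) => //; rewrite -sub0r; exact: PB.
have Pn s n : P s -> P (s *+ n).
  by move=> Ps; elim: n => [|n IH]; rewrite ?mulr0n // mulrS; exact: PD.
pose f : {additive {malg int[(M * N)%type]} -> tensor M N} := @tens_class A D M N.
rewrite -(tens_classK t) -[tens_class _]/(f (repr t)) [repr t](monalgE) raddf_sum.
elim/big_ind: _ => // -[m v] _.
set c := mcoeff _ _.
have -> : mkmalgU (m, v) c = (mkmalgU (m, v) 1 *~ c) by rewrite -raddfMz /= intz.
rewrite raddfMz -[f _]/(tens m v); case: c => k; first exact: Pn.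
by rewrite NegzE mulrNz -sub0r; apply: PB => //; exact: Pn.
Qed.

Section BaseChange.
Variables (R : realType) (G : groupType) (U : affiliatedAlgebra R G).
Local Notation D := (linnell U).
Local Notation ZG := (groupRing int G).
Variables (n : nat) (sigma : representation R[i] G n).
Variable psi : D -> 'M[D]_n.
Hypothesis psi1 : psi 1 = 1%:M.
Hypothesis psiD : forall a b, psi (a + b) = psi a + psi b.
Hypothesis psiM : forall a b, psi (a * b) = psi a *m psi b.
Hypothesis psi_tau : forall g, psi (tau_elt U g) = twist_mx U sigma g.

Local Notation V := 'cV[D^c]_n.
Local Notation X M := (tensor M (untwisted_bimodule U)).
Local Notation Y M := (tensor M (twisted_bimodule U sigma)).

Definition act (a : D) (v : V) : V := psi a *m (v : 'cV[D]_n).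

Lemma actDl a b v : act (a + b) v = act a v + act b v.
Proof. by rewrite /act psiD; exact: (@mulmxDl D). Qed.

Lemma actDr a v w : act a (v + w) = act a v + act a w.
Proof. exact: (@mulmxDr D). Qed.

Lemma actM a b v : act (a * b) v = act a (act b v).
Proof. by rewrite /act psiM (@mulmxA D). Qed.

Lemma act1 v : act 1 v = v.
Proof. by rewrite /act psi1 (@mul1mx D). Qed.

Lemma act0 v : act 0 v = 0.
Proof. by apply: (addrI (act 0 v)); rewrite -actDl !addr0. Qed.

Lemma actZ a (d : D^c) v : act a (d *: v) = d *: act a v.
Proof.
apply/matrixP => i j; rewrite /act !mxE [RHS](@mulr_suml D); apply/eq_bigr => k _.
by rewrite mxE; exact: (@mulrA D).
Qed.

Lemma psi_gr_lift a : psi (gr_lift (tau_elt U) a) = gr_lift (twist_mx U sigma) a.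
Proof.
have psi0 : psi 0 = 0 by apply: (addrI (psi 0)); rewrite -psiD !addr0.
have psiB : zmod_morphism psi.
  by move=> x y; apply/eqP; rewrite eq_sym subr_eq -psiD subrK.
pose psi' : {additive D -> 'M[D]_n} :=
  HB.pack psi (GRing.isZmodMorphism.Build D 'M[D]_n psi psiB).
have psiE x : psi x = psi' x by [].
rewrite psiE /gr_lift /free_lift raddf_sum.
by apply: eq_bigr => g _; rewrite raddfMz -psiE psi_tau.
Qed.

Lemma act_gr_lift a v : act (gr_lift (tau_elt U) a) v = twisted_lact sigma a v.
Proof. by rewrite /act psi_gr_lift. Qed.

Local Notation tensY m v := (@tens _ _ _ (twisted_bimodule U sigma) m v).
Local Notation tensX m d := (@tens _ _ _ (untwisted_bimodule U) m d).

Section Beta.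
Variable M : rmodType ZG.

Lemma base_change_bal (m : M) (a : ZG) (d : untwisted_bimodule U) v :
  tensY ((a : ZG^c) *: m) (act d v) = tensY m (act (untwisted_lact a d) v).
Proof. by rewrite tens_bal /= /untwisted_lact actM act_gr_lift. Qed.

(** [Y M] is the base change of [X M] along [psi], and the pairing is the elementary
    tensor of [x] and [v] in it. Working with the pairing avoids a second tensor
    product; [pairing_ind] and [induced_map] are what is needed of its universal
    property. *)
Definition pairing (x : X M) (v : V) : Y M :=
  tens_lift (fun m (d : untwisted_bimodule U) => tensY m (act d v)) x.

Let hDl v (m m' : M) (d : untwisted_bimodule U) :
  tensY (m + m') (act d v) = tensY m (act d v) + tensY m' (act d v).
Proof. exact: tensDl. Qed.

Let hDr v (m : M) (d d' : untwisted_bimodule U) :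
  tensY m (act (d + d') v) = tensY m (act d v) + tensY m (act d' v).
Proof. by rewrite -tensDr -actDl. Qed.

Lemma pairing_tens m (d : untwisted_bimodule U) v : pairing (tensX m d) v = tensY m (act d v).
Proof.
by rewrite /pairing (tens_liftE (h := fun m (d : untwisted_bimodule U) => tensY m (act d v))
  (hDl v) (hDr v) (fun m a d => base_change_bal m a d v)).
Qed.

Lemma pairing_zmod v : zmod_morphism (pairing^~ v).
Proof.
exact: (tens_lift_zmod_morphism (h := fun m (d : untwisted_bimodule U) => tensY m (act d v))
  (hDl v) (hDr v) (fun m a d => base_change_bal m a d v)).
Qed.

Lemma pairingBl x y v : pairing (x - y) v = pairing x v - pairing y v.
Proof. exact: pairing_zmod. Qed.

Lemma pairing0l v : pairing 0 v = 0.
Proof. by have := pairingBl 0 0 v; rewrite !subrr. Qed.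

Lemma pairingDl x y v : pairing (x + y) v = pairing x v + pairing y v.
Proof. by rewrite -{1}[y]opprK pairingBl -[- y]sub0r pairingBl pairing0l sub0r opprK. Qed.

Lemma pairingDr x v w : pairing x (v + w) = pairing x v + pairing x w.
Proof.
move: x; apply: tens_ind.
- by rewrite !pairing0l addr0.
- by move=> s t hs ht; rewrite !pairingBl hs ht opprD addrACA.
by move=> m d; rewrite !pairing_tens actDr tensDr.
Qed.

Lemma pairingZr x (d : D^c) v : pairing x (d *: v) = d *: pairing x v.
Proof.
move: x; apply: tens_ind.
- by rewrite !pairing0l scaler0.
- by move=> s t hs ht; rewrite !pairingBl hs ht scalerBr.
by move=> m e; rewrite !pairing_tens actZ tensZ.
Qed.

Lemma pairingZl x (d : D^c) v : pairing (d *: x) v = pairing x (act d v).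
Proof.
move: x; apply: tens_ind.
- by rewrite scaler0 !pairing0l.
- by move=> s t hs ht; rewrite scalerBr !pairingBl hs ht.
move=> m e; rewrite tensZ.
exact: (etrans (pairing_tens m (d *: e) v)
  (etrans (congr1 (fun w => tensY m w) (actM e d v))
    (esym (pairing_tens m e (act d v))))).
Qed.

Lemma pairing_ind (P : Y M -> Prop) :
  P 0 -> (forall s t, P s -> P t -> P (s - t)) -> (forall x v, P (pairing x v)) ->
  forall t, P t.
Proof.
move=> P0 PB Pp; apply: tens_ind => // m v.
by rewrite -[v]act1 -pairing_tens; exact: Pp.
Qed.

(** As [X M] is generated over [D] by the [m (x) 1], the map is forced to be
    [b (g (m (x) 1)) v] on the generators [m (x) v]. *)
Lemma induced_map (Z : lmodType D^c) (Z' : zmodType) (b : Z -> V -> Z')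
    (g : {linear X M -> Z}) :
  (forall z z' v, b (z + z') v = b z v + b z' v) ->
  (forall z v w, b z (v + w) = b z v + b z w) ->
  (forall z (d : D^c) v, b (d *: z) v = b z (act d v)) ->
  exists F : {additive Y M -> Z'}, forall x v, F (pairing x v) = b (g x) v.
Proof.
move=> bDl bDr bZ; pose one : untwisted_bimodule U := (1 : D).
pose h (m : M) (v : twisted_bimodule U sigma) : Z' := b (g (tensX m one)) v.
have hl m m' v : h (m + m') v = h m v + h m' v by rewrite /h tensDl linearD bDl.
have hr m v v' : h m (v + v') = h m v + h m v' by exact: bDr.
have tens_one (m : M) (d : untwisted_bimodule U) : tensX m d = (d : D^c) *: tensX m one.
  by rewrite tensZ; congr tens; rewrite /one; symmetry; exact: (@mul1r D).
have hb m (a : ZG) v : h ((a : ZG^c) *: m) v = h m (twisted_lact sigma a v).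
  rewrite /h tens_bal tens_one linearZ bZ; congr b.
  by rewrite /= /untwisted_lact mulr1 act_gr_lift.
pose F : {additive Y M -> Z'} := HB.pack (tens_lift h)
  (GRing.isZmodMorphism.Build (Y M) Z' _ (tens_lift_zmod_morphism hl hr hb)).
exists F => x v; move: x; apply: tens_ind.
- have b0 : b 0 v = 0 by apply: (addrI (b 0 v)); rewrite -bDl !addr0.
  by rewrite pairing0l !raddf0 b0.
- move=> s t hs ht; rewrite pairingBl !raddfB hs ht.
  by apply/eqP; rewrite subr_eq -bDl subrK.
move=> m d; rewrite pairing_tens [LHS](tens_liftE hl hr hb) /h.
by rewrite [Z in _ = b (g Z) _](tens_one m d) linearZ [RHS]bZ.
Qed.

End Beta.

Lemma pairing_map (M M' : rmodType ZG) (f : {linear M -> M'}) x v :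
  tens_map (twisted_bimodule U sigma) f (pairing x v) =
  pairing (tens_map (untwisted_bimodule U) f x) v.
Proof.
move: x; apply: tens_ind.
- by rewrite pairing0l !raddf0 pairing0l.
- by move=> s t hs ht; rewrite pairingBl !raddfB /= hs ht pairingBl.
by move=> m d; rewrite pairing_tens !tens_mapE pairing_tens.
Qed.

End BaseChange.

(** * Homology over a skew field *)

Section HomologySplitting.
Variables (A : nzRingType) (C : chainComplex A) (i : int).

Definition hclass (z : cycles C i) : homology C i := quot_class (boundaries (C:=C) (i:=i)) z.

Lemma hclassK (h : homology C i) : hclass (repr h) = h.
Proof. exact: quot_classK. Qed.

Lemma hclassB x y : hclass (x - y) = hclass x - hclass y.
Proof. exact: quot_class_zmod_morphism. Qed.

Lemma hclass0 : hclass 0 = 0.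
Proof. by have := hclassB 0 0; rewrite !subrr. Qed.

Lemma hclassD x y : hclass (x + y) = hclass x + hclass y.
Proof. by rewrite -{1}[y]opprK hclassB -[- y]sub0r hclassB hclass0 sub0r opprK. Qed.

Lemma hclassZ a x : hclass (a *: x) = a *: hclass x.
Proof. by symmetry; exact: quot_scaleE. Qed.

Lemma hclass_sum (I : Type) (r : seq I) (F : I -> cycles C i) :
  hclass (\sum_(j <- r) F j) = \sum_(j <- r) hclass (F j).
Proof. exact: (big_morph hclass hclassD hclass0). Qed.

Lemma hclass_eq0 z : hclass z = 0 <-> exists y, cdiff C (i + 1) i y = val z.
Proof.
rewrite -hclass0 /hclass quot_class_eq subr0; split=> [/asboolP//|h]; exact/asboolP.
Qed.

Lemma val_sum (I : Type) (r : seq I) (F : I -> cycles C i) :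
  val (\sum_(j <- r) F j) = \sum_(j <- r) val (F j).
Proof. exact: (big_morph (fun x : cycles C i => val x)). Qed.

Lemma cycle_diff (z : cycles C i) : cdiff C i (i - 1) (val z) = 0.
Proof. by apply/eqP; exact: (valP z). Qed.

Hypothesis skA : skew_field A.

(** A vector space of chains splits: [p] is a projection onto the cycles, and
    [1 - p] factors through the differential. These two identities survive any
    base change; flatness enters in this form. *)
Lemma cycle_splitting :
  exists (p : {linear C i -> cycles C i}) (s : {linear C (i - 1) -> C i}),
  (forall z, p (val z) = z) /\
  (forall x, s (cdiff C i (i - 1) x) = x - val (p x)).
Proof.
have [||p pP] := @linear_extension _ _ _ skA [set q : C i * cycles C i | q.1 = val q.2]%classic.
- by [].
- split=> [a q r /= -> ->//|w /= w0].
  by apply: val_inj; exact: esym w0.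
have pv z : p (val z) = z by apply: pP.
have [||s sP] := @linear_extension _ _ _ skA
  [set q : C (i - 1) * C i | exists2 x, q.1 = cdiff C i (i - 1) x & q.2 = x - val (p x)]%classic.
- by exists 0; rewrite /= linear0 // [val _](_ : _ = 0) ?subr0.
- split=> [a q r [x -> ->] [y -> ->]|w [x /= x0 ->]].
    exists (a *: x + y); first by rewrite linearP.
    have vE : val (a *: p x + p y) = a *: val (p x) + val (p y) by [].
    by rewrite /= linearP vE scalerBr opprD addrACA.
  have xc : x \in cycle_pred (C:=C) (i:=i) by rewrite unfold_in -x0.
  by rewrite (pv (Cycle xc)) subrr.
by exists p, s; split=> // x; apply: sP; exists x.
Qed.

(** Coordinate functionals for an independent family in homology. They vanish on
    boundaries, so after a base change they still detect independence. *)
Lemma dual_functionals (I : finType) (b : I -> homology C i) : independent b ->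
  forall l, exists f : {linear C i -> A^o},
   (forall j, f (val (repr (b j))) = (j == l)%:R) /\
   (forall y, f (cdiff C (i + 1) i y) = 0).
Proof.
move=> ib l; pose z j : cycles C i := repr (b j).
pose T : set (C i * A^o) := [set q | exists (a : I -> A) y,
  q.1 = \sum_j a j *: val (z j) + cdiff C (i + 1) i y /\ q.2 = a l]%classic.
have [||f fT] := @linear_extension _ _ _ skA T.
- exists (fun=> 0), 0; rewrite linear0 addr0 big1 // => j _; exact: scale0r.
- split=> [c q r [a [y [-> ->]]] [a' [y' [-> ->]]]|w [a [y [/= E ->]]]].
    exists (fun j => c * a j + a' j), (c *: y + y'); split=> //=.
    rewrite linearP scalerDr scaler_sumr addrACA; congr (_ + _).
    by rewrite -big_split; apply: eq_bigr => j _; rewrite scalerDl scalerA.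
  apply: ib; transitivity (hclass (\sum_j a j *: z j)).
    by rewrite hclass_sum; apply: eq_bigr => j _; rewrite hclassZ hclassK.
  apply/hclass_eq0; exists (- y); rewrite linearN val_sum.
  by apply/eqP; rewrite eq_sym -addr_eq0 -E.
exists f; split=> [j|y]; apply: fT.
- exists (fun k => (j == k)%:R), 0; split=> //=; rewrite linear0 addr0.
  rewrite (bigD1 j) //= eqxx scale1r big1 ?addr0 // => k kj.
  by rewrite eq_sym (negPf kj) scale0r.
exists (fun=> 0), y; split=> //=; rewrite big1 ?add0r // => j _; exact: scale0r.
Qed.
End HomologySplitting.

(** * Homology of a base change *)

Lemma subrACA (V : zmodType) (a b c d : V) : a - b - (c - d) = a - c - (b - d).
Proof. by rewrite !opprB addrACA [RHS]addrACA; congr (_ + _); rewrite addrC. Qed.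

(** A right vector space over [A^c] is a left one over [A]. The complex [CY] plays
    the role of the base change of [CX] along an action of [A] on the column space
    [V], with [pair x v] in the role of the elementary tensor of [x] and [v]. *)
Section BettiComparison.
Variables (A : nzRingType) (n : nat).
Hypothesis skA : skew_field A.
Local Notation V := 'cV[A]_n.
Variable act : A -> V -> V.
Hypothesis actDl : forall a b v, act (a + b) v = act a v + act b v.
Hypothesis actDr : forall a v w, act a (v + w) = act a v + act a w.
Hypothesis actM : forall a b v, act (a * b) v = act b (act a v).
Hypothesis act1 : forall v, act 1 v = v.
Variables (CX CY : chainComplex A) (i : int).
Variable pair : forall j, CX j -> V -> CY j.
Hypothesis pairDl : forall j (x y : CX j) v, pair (x + y) v = pair x v + pair y v.
Hypothesis pairDr : forall j (x : CX j) v w, pair x (v + w) = pair x v + pair x w.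
Hypothesis pairZr : forall j (x : CX j) a v, pair x (a *: v) = a *: pair x v.
Hypothesis pairZl : forall j (x : CX j) a v, pair (a *: x) v = pair x (act a v).
Hypothesis pair_ind : forall j (P : CY j -> Prop),
  P 0 -> (forall s t, P s -> P t -> P (s - t)) -> (forall x v, P (pair x v)) ->
  forall t, P t.
Hypothesis induced : forall j (Z : lmodType A) (Z' : zmodType) (b : Z -> V -> Z')
    (g : {linear CX j -> Z}),
  (forall z z' v, b (z + z') v = b z v + b z' v) ->
  (forall z v w, b z (v + w) = b z v + b z w) ->
  (forall z a v, b (a *: z) v = b z (act a v)) ->
  exists F : {additive CY j -> Z'}, forall x v, F (pair x v) = b (g x) v.
Hypothesis diff_pair : forall j k (x : CX j) v,
  cdiff CY j k (pair x v) = pair (cdiff CX j k x) v.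

Local Notation HX := (homology CX i).
Local Notation HY := (homology CY i).

Let pair0l j v : pair (0 : CX j) v = 0.
Proof. by apply: (addrI (pair 0 v)); rewrite -pairDl !addr0. Qed.
Let pair0r j (x : CX j) : pair x 0 = 0.
Proof. by apply: (addrI (pair x 0)); rewrite -pairDr !addr0. Qed.
Let pairBl j (x y : CX j) v : pair (x - y) v = pair x v - pair y v.
Proof. by apply/eqP; rewrite eq_sym subr_eq -pairDl subrK. Qed.
Let act0 v : act 0 v = 0.
Proof. by apply: (addrI (act 0 v)); rewrite -actDl !addr0. Qed.

Lemma pair_cycle_subproof (z : cycles CX i) v : pair (val z) v \in cycle_pred (C:=CY) (i:=i).
Proof. by rewrite unfold_in diff_pair cycle_diff pair0l. Qed.

Definition pair_cycle (z : cycles CX i) v : cycles CY i := Cycle (pair_cycle_subproof z v).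

Definition unit_col (r : 'I_n) : V := delta_mx r 0.

Lemma col_expand (v : V) : v = \sum_r v r 0 *: unit_col r.
Proof.
apply/matrixP => s c; rewrite ord1 summxE (bigD1 s) //= big1 ?addr0 => [|r rs].
  by rewrite !mxE !eqxx mulr1.
by rewrite !mxE eq_sym (negPf rs) mulr0.
Qed.

Lemma pair_sum_r j (x : CX j) (I : Type) (r : seq I) (F : I -> V) :
  pair x (\sum_(k <- r) F k) = \sum_(k <- r) pair x (F k).
Proof. exact: (big_morph (pair x) (@pairDr _ x) (pair0r x)). Qed.

Lemma pair_sum_l j (I : Type) (r : seq I) (F : I -> CX j) v :
  pair (\sum_(k <- r) F k) v = \sum_(k <- r) pair (F k) v.
Proof. by elim/big_rec2: _ => [|k x y _ <-]; [exact: pair0l|exact: pairDl]. Qed.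

Lemma pair_expand j (x : CX j) v : pair x v = \sum_r v r 0 *: pair x (unit_col r).
Proof. by rewrite {1}[v]col_expand pair_sum_r; apply: eq_bigr => r _; rewrite pairZr. Qed.

Section Family.
Variables (I : finType) (b : I -> HX).

Definition pair_family (jr : I * 'I_n) : HY :=
  hclass (pair_cycle (repr (b jr.1)) (unit_col jr.2)).

(** The map [K] induced by the projection onto cycles fixes every cycle of [CY], since
    [1 - K] factors through the differential, and its values are combinations of
    pairings of cycles of [CX]. *)
Lemma pair_family_spanning : spanning b -> spanning pair_family.
Proof.
move=> sb h; rewrite -(hclassK h); set t := repr h.
have [p [s [pv sd]]] := @cycle_splitting _ CX i skA.
have [K KE] := @induced i _ _ (fun (z : cycles CX i) v => pair (val z) v) p
  (fun z z' v => pairDl _ _ v) (fun z v w => pairDr _ v w) (fun z d v => pairZl _ d v).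
have [S SE] := @induced (i - 1) _ _ (@pair i) s
  (@pairDl i) (@pairDr i) (@pairZl i).
have tK u : u - K u = S (cdiff CY i (i - 1) u).
  move: u; apply: pair_ind.
  - by rewrite (raddf0 K) (raddf0 (cdiff CY i (i - 1))) (raddf0 S) subrr.
  - by move=> u w hu hw; rewrite (raddfB K) (raddfB (cdiff CY i (i - 1))) (raddfB S) -hu -hw subrACA.
  by move=> x v; rewrite KE diff_pair SE sd pairBl.
have KP u : exists (a : I * 'I_n -> A) y,
    K u = \sum_jr a jr *: val (pair_cycle (repr (b jr.1)) (unit_col jr.2)) + cdiff CY (i + 1) i y.
  move: u; apply: pair_ind.
  - exists (fun=> 0), 0; rewrite (raddf0 K) (raddf0 (cdiff CY (i + 1) i)) addr0.
    by rewrite big1 // => jr _; exact: scale0r.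
  - move=> u w [a [y ua]] [a' [y' wa]]; exists (fun jr => a jr - a' jr), (y - y').
    rewrite (raddfB K) (raddfB (cdiff CY (i + 1) i)) ua wa opprD addrACA -sumrB; congr (_ + _).
    by apply: eq_bigr => jr _; rewrite scalerBl.
  move=> x v; rewrite KE; have [c cE] := sb (hclass (p x)).
  have /hclass_eq0[y yE] : hclass (p x - \sum_j c j *: repr (b j)) = 0.
    rewrite hclassB hclass_sum cE; apply/eqP; rewrite subr_eq0; apply/eqP.
    by apply: eq_bigr => j _; rewrite hclassZ hclassK.
  exists (fun jr => (act (c jr.1) v) jr.2 0), (pair y v).
  have -> : val (p x) = \sum_j c j *: val (repr (b j)) + cdiff CX (i + 1) i y.
    have vB (u w : cycles CX i) : val (u - w) = val u - val w by [].
    by rewrite yE vB val_sum addrC subrK.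
  rewrite diff_pair pairDl; congr (_ + _); rewrite pair_sum_l.
  rewrite (eq_bigr (fun j => \sum_r act (c j) v r 0 *: pair (val (repr (b j))) (unit_col r))).
    by rewrite pair_bigA.
  by move=> j _; rewrite pairZl; exact: pair_expand.
have tE : val t = K (val t).
  by apply/eqP; rewrite -subr_eq0 tK cycle_diff raddf0.
have [a [y E]] := KP (val t); exists a.
apply/eqP; rewrite -subr_eq0; apply/eqP.
rewrite -[X in _ - X](_ :
  hclass (\sum_jr a jr *: pair_cycle (repr (b jr.1)) (unit_col jr.2)) = _); last first.
  by rewrite hclass_sum; apply: eq_bigr => jr _; rewrite hclassZ.
rewrite -hclassB; apply/hclass_eq0; exists y.
have vE (u w : cycles CY i) : val (u - w) = val u - val w by [].
by rewrite vE val_sum tE E [RHS]addrAC subrr add0r.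
Qed.

(** The map [F] induced by a coordinate functional kills boundaries and sends the
    pairing of the corresponding cycle with [v] to [v]. *)
Lemma pair_family_independent : independent b -> independent pair_family.
Proof.
move=> ib a; pose v j : V := \col_r a (j, r).
have -> : \sum_jr a jr *: pair_family jr =
    hclass (\sum_jr a jr *: pair_cycle (repr (b jr.1)) (unit_col jr.2)).
  by rewrite hclass_sum; apply: eq_bigr => jr _; rewrite hclassZ.
move=> /hclass_eq0[t]; rewrite val_sum => tE.
have {}tE : cdiff CY (i + 1) i t = \sum_j pair (val (repr (b j))) (v j).
  rewrite tE; under [RHS]eq_bigr do rewrite pair_expand.
  by rewrite pair_bigA; apply: eq_bigr => -[j r] _; rewrite mxE.
suff v0 l : v l = 0.
  by move=> [l r]; have := congr1 (fun w : V => w r 0) (v0 l); rewrite !mxE.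
have [f [fb fd]] := dual_functionals skA ib l.
have [F FE] := @induced i A^o V act f actDl actDr
  (fun z c w => actM c z w).
have Fd u : F (cdiff CY (i + 1) i u) = 0.
  move: u; apply: pair_ind.
  - by rewrite (raddf0 (cdiff CY (i + 1) i)) (raddf0 F).
  - move=> u w hu hw; rewrite (raddfB (cdiff CY (i + 1) i)) (raddfB F).
    by rewrite hu hw subrr.
  by move=> x w; rewrite diff_pair FE fd; exact: act0.
have := Fd t; rewrite tE raddf_sum (bigD1 l) //= big1 => [|j jl].
  by rewrite addr0 FE fb eqxx act1.
by rewrite FE fb (negPf jl); exact: act0.
Qed.

End Family.

(** If [HX] has no finite basis, it contains independent families of any size, and
    so does [HY] for positive [n]. *)
Theorem skew_dim_base_change (R : realType) :
  skew_dim R HY = (n%:R%:E * skew_dim R HX)%E.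
Proof.
case: (pselect (exists (I : finType) (b : I -> HX), spanning b /\ independent b)) =>
  [[I [b [sb ib]]]|nob].
  rewrite (skew_dim_basis skA R sb ib).
  rewrite (skew_dim_basis skA R (pair_family_spanning sb) (pair_family_independent ib)).
  by rewrite card_prod card_ord -EFinM -natrM mulnC.
have nobX (I : finType) (b : I -> HX) : spanning b -> independent b -> False.
  by move=> sb ib; apply: nob; exists I, b.
have [n0|n0] := posnP n.
  have Y0 (u : CY i) : u = 0.
    move: u; apply: pair_ind => // [s t -> ->|x v]; first by rewrite subrr.
    by rewrite pair_expand big1 // => r; have := ltn_ord r; rewrite {2}n0.
  have sp : spanning (@of_void HY).
    move=> h; exists (@of_void _); rewrite -(hclassK h) [RHS]big1 => [|[]//].
    by apply/hclass_eq0; exists 0; rewrite linear0 (Y0 (val _)).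
  have ind : independent (@of_void HY) by move=> a _ [].
  by rewrite (skew_dim_basis skA R sp ind) card_void n0 mul0e.
rewrite (skew_dim_infty R nobX) gt0_muley ?lte_fin ?ltr0n //.
apply: skew_dim_infty => J c sc _.
have [I [b [cI ib]]] := independent_any_size skA nobX #|J|.+1.
have := independent_le_spanning skA (pair_family_independent ib) sc.
rewrite card_prod card_ord cI leqNgt => /negP; apply.
by apply: leq_trans (leq_pmulr _ n0).
Qed.

End BettiComparison.

(** * Comparison of the Betti numbers *)

Local Close Scope ring_scope.

Theorem theorem4p4 (R : realType) (G : groupType)
    (U : affiliatedAlgebra R G)
    (C : chainComplex (groupRing int G)^c)
    (n : nat) (sigma : representation R[i] G n) :
  locally_indicable G -> skew_field (linnell U) ->
  forall i : int,
    twisted_l2_betti U sigma C i = (n%:R%:E * l2_betti U C i)%E.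
Proof.
move=> liG skD i.
have [psi [psi1 psiD psiM psi_tau]] := twisted_extension liG skD sigma.
apply: (@skew_dim_base_change (linnell U)^c n (skew_converse skD) (act psi)
  _ _ _ _ (tensor_complex C (untwisted_bimodule U))
  (tensor_complex C (twisted_bimodule U sigma)) i
  (fun j x v => @pairing R G U n sigma psi (C j) x v)).
- exact: actDl.
- exact: actDr.
- by move=> a b v; exact: (actM psiM b a v).
- exact: act1.
- move=> j x y v; exact: (pairingDl psiD psiM psi_tau).
- move=> j x v w; exact: (pairingDr psiD psiM psi_tau).
- move=> j x a v; exact: (pairingZr psiD psiM psi_tau).
- move=> j x a v; exact: (pairingZl psiD psiM psi_tau).
- move=> j P; exact: (pairing_ind psi1 psiD psiM psi_tau).
- move=> j Z Z' b g; exact: (induced_map psiD psiM psi_tau g).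
- move=> j k x v; exact: (pairing_map psiD psiM psi_tau).
Qed.
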